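(* Let $\zeta_5$ be a primitive fifth root of unity. (1) Bring's curve $B$ is isomorphic over $\mathbb{Q}(\zeta_5)$ to Hulek–Craig's curve $X^{\mathrm{HC}}$. (2) Hulek–Craig's curve $X^{\mathrm{HC}}$ is isomorphic over $\mathbb{Q}$ to $X(\Gamma_B)^{\mathrm{alg}}$.
   Context: Bring's curve $B$ is the curve in $\mathbb{P}^4$, with homogeneous coordinates $[x_0:x_1:x_2:x_3:x_4]$, defined over $\mathbb{Q}$ by $$\sum_{i=0}^4x_i=0,\qquad \sum_{i=0}^4x_i^2=0,\qquad \sum_{i=0}^4x_i^3=0.$$ Hulek–Craig's curve $X^{\mathrm{HC}}$ over $\mathbb{Q}$ is the desingularization of the projective geometrically irreducible singular curve $$x_1(y_1^5+z_1^5)+x_1^2y_1^2z_1^2-x_1^4y_1z_1-2y_1^3z_1^3=0$$ in $\mathbb{P}^2$ with homogeneous coordinates $[x_1:y_1:z_1]$. $X(\Gamma_B)^{\mathrm{alg}}$ is the curve over $\mathbb{Q}$ in $\mathbb{P}^3$, with homogeneous coordinates $[x:y:z:w]$, defined by $$-(x^2+y^2)+2(z^2+w^2)=0,\qquad x^3+xy^2+2y^3-4xz^2-8xzw=0.$$ It is an algebraic model over $\mathbb{Q}$ of the compactified modular curve $X(\Gamma_B)=\overline{\Gamma_B\backslash\mathbb{H}}$, where $\mathbb{H}$ is the upper half plane and $\Gamma_B=\Gamma_0(2)\cap\Gamma(5)$ is a congruence subgroup of $\mathrm{SL}_2(\mathbb{Z})$. *)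

(* Defs.v *)
From mathcomp Require Import all_boot all_order all_algebra all_field.
From mathcomp.multinomials Require Import mpoly.

Set Implicit Arguments.
Unset Strict Implicit.
Unset Printing Implicit Defensive.

Import GRing.Theory.
Local Open Scope ring_scope.

(* Projective varieties are handled through their geometric points, i.e. their
   points over algC, which is an algebraic closure of Q.  A point of P^n is
   given by a nonzero row vector of homogeneous coordinates, two vectors giving
   the same point when they satisfy [peq].  A field of definition is a subfield
   of algC, given as a predicate [k : algC -> Prop]. *)

Definition peq (n : nat) (u v : 'rV[algC]_n) : Prop :=
  exists2 c : algC, c != 0 & v = c *: u.

Definition homogeneous (n : nat) (p : {mpoly algC[n]}) : Prop :=
  exists d : nat, p \is d.-homog.

Definition over (k : algC -> Prop) (n : nat) (p : {mpoly algC[n]}) : Prop :=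
  forall m : 'X_{1..n}, k p@_m.

Definition locus (n : nat) (s : seq {mpoly algC[n.+1]})
    (v : 'rV[algC]_n.+1) : Prop :=
  v != 0 /\ forall p, p \in s -> p.@[v 0] = 0.

Section Topology.

Variable n : nat.
Implicit Types V Z : 'rV[algC]_n.+1 -> Prop.

Definition incl V Z : Prop := forall v, V v -> Z v.

(* By Hilbert's basis theorem, finitely many equations are enough. *)
Definition closed Z : Prop :=
  exists2 s : seq {mpoly algC[n.+1]},
    forall p, p \in s -> homogeneous p & forall v, Z v <-> locus s v.

Definition irreducible V : Prop :=
  (exists v, V v) /\
  forall Z1 Z2, closed Z1 -> closed Z2 ->
    (forall v, V v -> Z1 v \/ Z2 v) -> incl V Z1 \/ incl V Z2.

Definition has_chain V (r : nat) : Prop :=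
  exists Z : nat -> 'rV[algC]_n.+1 -> Prop,
    (forall i, (i <= r)%N -> [/\ closed (Z i), irreducible (Z i) & incl (Z i) V])
    /\ forall i, (i < r)%N -> incl (Z i) (Z i.+1) /\ ~ incl (Z i.+1) (Z i).

Definition dimension V (r : nat) : Prop := has_chain V r /\ ~ has_chain V r.+1.

End Topology.

Definition jacobian (n : nat) (s : seq {mpoly algC[n.+1]})
    (v : 'rV[algC]_n.+1) : 'M[algC]_(size s, n.+1) :=
  \matrix_(i < size s, j < n.+1) (s`_i)^`M(j).@[v 0].

(* The rank condition is the Jacobian criterion in homogeneous coordinates: at
   each point, the rank is the codimension n - 1 of a curve in P^n.  It bears
   on the given equations, so the scheme they define is smooth.
   Irreducibility is over algC, hence geometric. *)
Definition smooth_projective_curve (k : algC -> Prop) (n : nat)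
    (s : seq {mpoly algC[n.+1]}) : Prop :=
  [/\ forall p, p \in s -> homogeneous p /\ over k p,
      irreducible (locus s),
      dimension (locus s) 1
    & forall v, locus s v -> \rank (jacobian s v) = n.-1].

Section Maps.

Variable k : algC -> Prop.

Definition forms_over (n m : nat) (F : 'I_m.+1 -> {mpoly algC[n.+1]}) : Prop :=
  exists d : nat, forall j, F j \is d.-homog /\ over k (F j).

Definition eval_forms (n m : nat) (F : 'I_m.+1 -> {mpoly algC[n.+1]})
    (v : 'rV[algC]_n.+1) : 'rV[algC]_m.+1 :=
  \row_j (F j).@[v 0].

(* The map f on points is a morphism over k from V to W if around every
   geometric point v it is given by forms of the same degree with coefficients
   in k.  Taking u := v and then u := c *: v shows that f is compatible with
   [peq]. *)
Definition morphism (n m : nat)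
    (V : 'rV[algC]_n.+1 -> Prop) (W : 'rV[algC]_m.+1 -> Prop)
    (f : 'rV[algC]_n.+1 -> 'rV[algC]_m.+1) : Prop :=
  (forall v, V v -> W (f v)) /\
  forall v, V v ->
    exists F : 'I_m.+1 -> {mpoly algC[n.+1]},
      [/\ forms_over F, eval_forms F v != 0
        & forall u, V u -> eval_forms F u != 0 -> peq (eval_forms F u) (f u)].

Definition isomorphic (n m : nat)
    (V : 'rV[algC]_n.+1 -> Prop) (W : 'rV[algC]_m.+1 -> Prop) : Prop :=
  exists f g,
    [/\ morphism V W f, morphism W V g,
        forall v, V v -> peq v (g (f v))
      & forall w, W w -> peq w (f (g w))].

(* A morphism with a rational inverse over k, the latter being defined on the
   nonempty open set where the forms G have no common zero. *)
Definition birational_morphism (n m : nat)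
    (V : 'rV[algC]_n.+1 -> Prop) (W : 'rV[algC]_m.+1 -> Prop)
    (f : 'rV[algC]_n.+1 -> 'rV[algC]_m.+1) : Prop :=
  morphism V W f /\
  exists G : 'I_n.+1 -> {mpoly algC[m.+1]},
    [/\ forms_over G,
        exists2 w, W w & eval_forms G w != 0,
        forall w, W w -> eval_forms G w != 0 ->
          V (eval_forms G w) /\ peq w (f (eval_forms G w))
      & forall v, V v -> eval_forms G (f v) != 0 ->
          peq v (eval_forms G (f v))].

(* For curves, properness of f and its being an isomorphism over the regular
   locus of C are automatic. *)
Definition desingularization (n m : nat)
    (X : seq {mpoly algC[n.+1]}) (C : seq {mpoly algC[m.+1]})
    (f : 'rV[algC]_n.+1 -> 'rV[algC]_m.+1) : Prop :=
  smooth_projective_curve k X /\ birational_morphism (locus X) (locus C) f.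

End Maps.

Definition rationals (x : algC) : Prop := x \in Crat.

Definition rationals_adjoin (z x : algC) : Prop :=
  exists p q : {poly rat},
    (map_poly ratr q).[z] != 0 /\
    x = (map_poly ratr p).[z] / (map_poly ratr q).[z].

Definition bring : seq {mpoly algC[5]} :=
  [:: \sum_(i < 5) 'X_i; \sum_(i < 5) 'X_i ^+ 2; \sum_(i < 5) 'X_i ^+ 3].

Definition hulek_craig_plane : seq {mpoly algC[3]} :=
  let x1 : {mpoly algC[3]} := 'X_(inord 0) in
  let y1 : {mpoly algC[3]} := 'X_(inord 1) in
  let z1 : {mpoly algC[3]} := 'X_(inord 2) in
  [:: x1 * (y1 ^+ 5 + z1 ^+ 5) + x1 ^+ 2 * y1 ^+ 2 * z1 ^+ 2
      - x1 ^+ 4 * y1 * z1 - 2%:R * (y1 ^+ 3 * z1 ^+ 3)].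

Definition modular_model : seq {mpoly algC[4]} :=
  let x : {mpoly algC[4]} := 'X_(inord 0) in
  let y : {mpoly algC[4]} := 'X_(inord 1) in
  let z : {mpoly algC[4]} := 'X_(inord 2) in
  let w : {mpoly algC[4]} := 'X_(inord 3) in
  [:: - (x ^+ 2 + y ^+ 2) + 2%:R * (z ^+ 2 + w ^+ 2);
      x ^+ 3 + x * y ^+ 2 + 2%:R * y ^+ 3 - 4%:R * (x * z ^+ 2)
      - 8%:R * (x * z * w)].

(* Main.v *)
From Pilot Require Import Defs.
From mathcomp Require Import all_boot all_order all_algebra all_field.
From mathcomp.multinomials Require Import mpoly.
From HB Require Import structures.
From mathcomp Require Import ring zify.
From Stdlib Require Import Classical ClassicalEpsilon.

(* The quadric y_1 y_4 + y_2 y_3 = 0 and the cubic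
   y_1^2 y_3 + y_1 y_2^2 + y_3^2 y_4 + y_2 y_4^2 = 0 define a smooth curve N in
   P^3.  It is Bring's curve in the coordinates y_j = sum_i zeta^(ij) x_i, which
   diagonalize the 5-cycle of S_5, and an explicit rational matrix carries it to
   X(Gamma_B)^alg.  It is also the canonical model of Hulek-Craig's curve: the
   cubics through the six nodes of the plane sextic map the sextic to N, with an
   inverse given by quadrics, so N is a desingularization of the sextic over Q.

   The remaining point is the uniqueness of the desingularization X: the
   birational maps over Q between N and X extend to morphisms.  By the Jacobian
   criterion and Cramer's rule, every form vanishing at a point v of X is, up to
   forms that do not vanish at v, a multiple of a single form t.  Two functions
   on X are algebraically dependent (this is a dimension count on N), hence a
   function dividing no power of t up to a unit is zero, and the local ring at v
   is a valuation ring.  So a rational map can be given at v by forms without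
   common zero; their coefficients are taken in Q by means of the automorphisms
   of the field of algebraic numbers.

   The curve N is irreducible because it is birational to the Kummer curve
   (c + 1) a^5 = c^2 (c - 1), to which Eisenstein's criterion applies. *)

Set Implicit Arguments.
Unset Strict Implicit.
Unset Printing Implicit Defensive.

Import GRing.Theory.
Local Open Scope ring_scope.

(* Both names are shadowed by MathComp. *)
Local Notation closed := Pilot.Defs.closed.
Local Notation over := Pilot.Defs.over.
Local Notation pQtoC := (map_poly (ratr : rat -> algC)).

(** * Polynomials vanishing on a cone *)

(** The theorem quantifies over every desingularization X, in any projective space, so X is known
    only through its smooth equations and the forms relating it to the sextic. An isomorphism has to
    be given by forms around each point, which is what calls for a local ring argument on an
    arbitrary smooth curve. Dimension theory is condensed into one statement, [functions_dependent],
    which serves twice: it bounds orders of vanishing at a point, and it excludes chains of length 2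
    in N. It is carried from N to X by the rational map between them before X is known to be
    isomorphic to N.

    The Kummer equation comes from the 5-cycle, which multiplies y_j by a power zeta^j: a = y_2 /
    y_4 is an eigenfunction and c = - y_3 a^2 / y_4 is invariant. So c is a coordinate on the
    quotient line, and N is recovered by extracting the fifth root a. *)

Definition vanishes n (V : 'rV[algC]_n -> Prop) (p : {mpoly algC[n]}) : Prop :=
  forall u, V u -> p.@[u 0] = 0.

Definition cone n (V : 'rV[algC]_n -> Prop) : Prop :=
  forall u c, V u -> c != 0 -> V (c *: u).

Definition prime_set n (V : 'rV[algC]_n -> Prop) : Prop :=
  forall p q, vanishes V (p * q) -> vanishes V p \/ vanishes V q.

Lemma poly_eq0_of_nonzero_roots (q : {poly algC}) :
  (forall c, c != 0 -> q.[c] = 0) -> q = 0.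
Proof.
move=> q0; apply/eqP; apply: contraT => q_neq0.
pose rs := [seq (i.+1)%:R : algC | i <- iota 0 (size q)].
have rs_root : all (root q) rs.
  apply/allP => _ /mapP[i _ ->]; apply/eqP/q0.
  by rewrite Num.Theory.pnatr_eq0.
have rs_uniq : uniq rs.
  rewrite map_inj_uniq ?iota_uniq // => i j /eqP.
  by rewrite Num.Theory.eqr_nat eqSS => /eqP.
by have := max_poly_roots q_neq0 rs_root rs_uniq; rewrite size_map size_iota ltnn.
Qed.

Lemma meval_dhomogZ n d (p : {mpoly algC[n]}) (c : algC) (u : 'rV[algC]_n) :
  p \is d.-homog -> p.@[(c *: u) 0] = c ^+ d * p.@[u 0].
Proof.
move=> /dhomogP hp; rewrite !mevalE mulr_sumr; apply: eq_big_seq => m /hp hm.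
rewrite mulrCA; congr (_ * _).
under eq_bigr do rewrite mxE exprMn.
rewrite big_split /= prodrXr; congr (_ ^+ _ * _).
by rewrite -hm /= mdegE.
Qed.

(** As a polynomial in c this is p(c u), and its coefficients are the values at u of the homogeneous
    components of p. A cone contains c u for every nonzero c, which is enough to force such a
    polynomial to vanish. *)
Definition ray_poly n (p : {mpoly algC[n]}) (u : 'rV[algC]_n) : {poly algC} :=
  \poly_(i < msize p) (pihomog mdeg i p).@[u 0].

Lemma horner_ray_poly n (p : {mpoly algC[n]}) u c :
  (ray_poly p u).[c] = p.@[(c *: u) 0].
Proof.
rewrite horner_poly [in RHS](@pihomog_partitionE _ _ mdeg _ p (leqnn _)).
rewrite raddf_sum; apply: eq_bigr => i _ /=.
by rewrite (meval_dhomogZ _ _ (pihomogP mdeg i p)) mulrC.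
Qed.

Lemma coef_ray_poly n (p : {mpoly algC[n]}) u i :
  (ray_poly p u)`_i = (pihomog mdeg i p).@[u 0].
Proof.
rewrite coef_poly; case: ltnP => // hi; rewrite pihomogE big_seq_cond big1 ?raddf0 //.
move=> m /andP[mp /eqP mi]; move: (msize_mdeg_lt mp).
by rewrite mi ltnNge hi.
Qed.

Lemma vanishes_pihomog n (V : 'rV[algC]_n -> Prop) d p :
  cone V -> vanishes V p -> vanishes V (pihomog mdeg d p).
Proof.
move=> coneV pV u Vu; rewrite -coef_ray_poly (_ : ray_poly p u = 0) ?coef0 //.
apply: poly_eq0_of_nonzero_roots => c c0.
by rewrite horner_ray_poly; apply: pV; apply: coneV.
Qed.

Lemma vanishes_of_pihomog n (V : 'rV[algC]_n -> Prop) p :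
  (forall d, vanishes V (pihomog mdeg d p)) -> vanishes V p.
Proof.
move=> pV u Vu; rewrite (@pihomog_partitionE _ _ mdeg _ p (leqnn _)) raddf_sum.
by rewrite big1 // => i _; apply: pV.
Qed.

Lemma closed_cone n (Z : 'rV[algC]_n.+1 -> Prop) : closed Z -> cone Z.
Proof.
move=> [s hs Zs] u c /Zs[u0 us] c0; apply/Zs; split.
  by rewrite scaler_eq0 negb_or c0.
move=> p ps; have [d hp] := hs p ps.
by rewrite (meval_dhomogZ _ _ hp) (us p ps) mulr0.
Qed.

Lemma closed_neq0 n (Z : 'rV[algC]_n.+1 -> Prop) u : closed Z -> Z u -> u != 0.
Proof. by move=> [s hs Zs] /Zs[]. Qed.

Lemma closed_locus n (s : seq {mpoly algC[n.+1]}) :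
  (forall p, p \in s -> homogeneous p) -> closed (locus s).
Proof. by move=> hs; exists s. Qed.

Lemma closed_cons n (Z : 'rV[algC]_n.+1 -> Prop) p :
  closed Z -> homogeneous p -> closed (fun v => Z v /\ p.@[v 0] = 0).
Proof.
move=> [s hs Zs] hp; exists (p :: s) => [q|v].
  by rewrite inE => /predU1P[-> //|/hs].
split=> [[/Zs[v0 vs] pv]|[v0 vs]].
  by split=> // q; rewrite inE => /predU1P[-> //|/vs].
split; last by apply: vs; rewrite inE eqxx.
by apply/Zs; split=> // q qs; apply: vs; rewrite inE qs orbT.
Qed.

(* Restricted to the line through a point, a product vanishes only if one of
   the factors does, so the homogeneous case is enough. *)
Lemma irreducible_prime n (V : 'rV[algC]_n.+1 -> Prop) :
  closed V -> irreducible V -> prime_set V.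
Proof.
move=> clV [_ irrV] p q pq.
have coneV := closed_cone clV.
have hom_prime i j : vanishes V (pihomog mdeg i p) \/ vanishes V (pihomog mdeg j q).
  case: (irrV _ _ (closed_cons clV (ex_intro _ i (pihomogP mdeg i p)))
                  (closed_cons clV (ex_intro _ j (pihomogP mdeg j q)))).
  - move=> v Vv; have : ray_poly p v * ray_poly q v = 0.
      apply: poly_eq0_of_nonzero_roots => c c0.
      by rewrite hornerM !horner_ray_poly -mevalM; apply: pq; apply: coneV.
    move/eqP; rewrite mulf_eq0 => /orP[] /eqP r0; [left|right]; split=> //;
      by rewrite -coef_ray_poly r0 coef0.
  - by move=> h; left=> v /h[].
  - by move=> h; right=> v /h[].
have [hp|/not_all_ex_not[i hi]] :=
    classic (forall i, vanishes V (pihomog mdeg i p)).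
  by left; apply: vanishes_of_pihomog.
right; apply: vanishes_of_pihomog => j.
by have [] := hom_prime i j.
Qed.

(** If neither closed set contains V, each has an equation that fails somewhere on V, while the
    product of the two vanishes on V. Closed sets are cut out by forms, so primality is asked for
    forms only. *)
Lemma irreducible_of_prime n (V : 'rV[algC]_n.+1 -> Prop) :
  (exists v, V v) ->
  (forall p q, homogeneous p -> homogeneous q -> vanishes V (p * q) ->
    vanishes V p \/ vanishes V q) ->
  irreducible V.
Proof.
move=> neV prV; split=> // Z1 Z2 [s1 hs1 Zs1] [s2 hs2 Zs2] cov.
apply: NNPP => /not_or_and[].
have ex_eq (s : seq {mpoly algC[n.+1]}) Z : (forall v, Z v <-> locus s v) ->
    (forall v, V v -> v != 0) ->
    ~ incl V Z -> exists2 p, p \in s & ~ vanishes V p.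
  move=> Zs V0 VZ; apply: NNPP => h; apply: VZ => v Vv; apply/Zs.
  split=> [|p ps]; first exact: V0.
  by apply: NNPP => pv; apply: h; exists p => // /(_ v Vv).
have V0 v : V v -> v != 0 by case/cov=> [/Zs1[]|/Zs2[]].
move=> /(ex_eq _ _ Zs1 V0)[p ps1 pV] /(ex_eq _ _ Zs2 V0)[q qs2 qV].
have : vanishes V (p * q).
  move=> v /cov[/Zs1[_ /(_ p ps1)]|/Zs2[_ /(_ q qs2)]] h;
    by rewrite mevalM h ?mul0r ?mulr0.
by case/(prV _ _ (hs1 _ ps1) (hs2 _ qs2)).
Qed.

Lemma prime_setP n (V : 'rV[algC]_n -> Prop) p q :
  prime_set V -> ~ vanishes V p -> vanishes V (p * q) -> vanishes V q.
Proof. by move=> prV pV /prV[]. Qed.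

Lemma not_vanishesP n (V : 'rV[algC]_n -> Prop) p :
  ~ vanishes V p <-> exists2 u, V u & p.@[u 0] != 0.
Proof.
split=> [/not_all_ex_not[u /(imply_to_and (V u))[Vu pu]]|[u Vu /eqP pu]].
  by exists u => //; apply/eqP.
by move=> /(_ u Vu).
Qed.

Lemma not_vanishesM n (V : 'rV[algC]_n -> Prop) p q :
  prime_set V -> ~ vanishes V p -> ~ vanishes V q -> ~ vanishes V (p * q).
Proof. by move=> prV pV qV /prV[]. Qed.

Lemma not_vanishes_prod n (V : 'rV[algC]_n -> Prop) (I : Type) (r : seq I)
    (P : pred I) (F : I -> {mpoly algC[n]}) :
  prime_set V -> (exists u, V u) ->
  (forall i, ~ vanishes V (F i)) -> ~ vanishes V (\prod_(i <- r | P i) F i).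
Proof.
move=> prV [u Vu] FV; apply: (big_ind (fun p => ~ vanishes V p)) => //.
  by move=> /(_ u Vu)/eqP; rewrite meval1 oner_eq0.
by move=> p q; apply: not_vanishesM.
Qed.

Lemma meval_sum n (v : 'I_n -> algC) (I : Type) (r : seq I) (P : pred I)
    (F : I -> {mpoly algC[n]}) :
  (\sum_(i <- r | P i) F i).@[v] = \sum_(i <- r | P i) (F i).@[v].
Proof. exact: (raddf_sum (meval v)). Qed.

Lemma meval_prod n (v : 'I_n -> algC) (I : Type) (r : seq I) (P : pred I)
    (F : I -> {mpoly algC[n]}) :
  (\prod_(i <- r | P i) F i).@[v] = \prod_(i <- r | P i) (F i).@[v].
Proof. exact: (rmorph_prod (meval v)). Qed.

Lemma mderiv_sum n k (I : Type) (r : seq I) (P : pred I) (F : I -> {mpoly algC[n]}) :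
  (\sum_(i <- r | P i) F i)^`M(k) = \sum_(i <- r | P i) (F i)^`M(k).
Proof. exact: (raddf_sum (mderiv k)). Qed.

Lemma mderivXU n (j k : 'I_n) : ('X_j : {mpoly algC[n]})^`M(k) = (j == k)%:R%:MP.
Proof.
rewrite mderivX mnm1E; case: eqP => [->|_]; last by rewrite scale0r mpolyC0.
rewrite (_ : U_(k) - U_(k) = 0)%MM ?mpolyX0 ?scale1r ?mpolyC1 //.
by apply/mnmP => i; rewrite mnmBE subnn mnm0E.
Qed.

Lemma meval_dhomog0 n (p : {mpoly algC[n]}) (u v : 'I_n -> algC) :
  p \is 0.-homog -> p.@[u] = p.@[v].
Proof.
move=> /dhomogP hp; rewrite !mevalE; apply: eq_big_seq => m /hp /= /eqP.
by rewrite mdeg_eq0 => /eqP->; congr (_ * _); apply: eq_bigr => i _; rewrite mnm0E !expr0.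
Qed.

Lemma dhomogXU n (i : 'I_n) : ('X_i : {mpoly algC[n]}) \is 1.-homog.
Proof. by rewrite dhomogX /= mdeg1. Qed.

Lemma dhomogXn n d k (p : {mpoly algC[n]}) :
  p \is d.-homog -> p ^+ k \is (k * d)%N.-homog.
Proof. by move=> hp; rewrite mulnC; apply: dhomogMn. Qed.

(** * Descent of forms to the rational numbers *)

(** The map z -> w extends to the splitting field of the minimal polynomial, a number field embedded
    in algC, and from there to algC. *)
Lemma aut_conjugate (z w : algC) : root (minCpoly z) w ->
  exists nu : {rmorphism algC -> algC}, nu z = w.
Proof.
move=> rw; have [p [Dp mon_p] dv_p] := minCpolyP z.
have [r Dr] := closed_field_poly_normal (minCpoly z : {poly algC}).
rewrite (monicP (minCpoly_monic z)) scale1r in Dr.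
have rz : z \in r by rewrite -root_prod_XsubC -Dr root_minCpoly.
have {rw} rw : w \in r by rewrite -root_prod_XsubC -Dr.
have [Qr [QrC [rr Drr genQr]]] := num_field_exists r.
have [zz Dz] : exists zz, QrC zz = z.
  by move: rz; rewrite -Drr => /mapP[zz]; exists zz.
have [ww Dw] : exists ww, QrC ww = w.
  by move: rw; rewrite -Drr => /mapP[ww]; exists ww.
have QrCQ q : map_poly QrC (map_poly (in_alg Qr) q) = pQtoC q.
  rewrite -map_poly_comp; apply: eq_map_poly => a.
  by rewrite /= alg_num_field fmorph_rat.
have homQ1 : kHom 1 1 (\1%VF : 'End(Qr)) by rewrite kHom1.
(* The minimal polynomial of [zz] over the prime field of [Qr] has rational coefficients and
   vanishes at z, so it is a multiple of p and vanishes at w. *)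
have root_w : root (map_poly \1%VF (minPoly 1 zz)) ww.
  rewrite -(fmorph_root QrC) Dw -map_poly_comp.
  rewrite (@eq_map_poly _ _ _ QrC) => [|a]; last by rewrite /= id_lfunE.
  have [q Dq] : exists q, minPoly 1 zz = map_poly (in_alg Qr) q.
    have aP i : (minPoly 1 zz)`_i \in 1%VS.
      by apply/polyOverP; apply: minPolyOver.
    have a_ i := sig_eqW (vlineP _ _ (aP i)).
    exists (\poly_(i < size (minPoly 1 zz)) sval (a_ i)).
    apply/polyP => i; rewrite coef_map coef_poly /=.
    case: ltnP => hi; first by case: (a_ i) => a /= ->.
    by rewrite scale0r nth_default.
  have : root (map_poly QrC (minPoly 1 zz)) z by rewrite -Dz fmorph_root root_minPoly.
  rewrite Dq QrCQ dv_p => /dvdpP[q1 ->].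
  by rewrite rmorphM rootM /= -Dp Dr root_prod_XsubC rw orbT.
have homz := kHomExtendP (subvv 1) homQ1 root_w.
have Qpr : map_poly (in_alg Qr) p \is a polyOver 1%VS.
  by apply/polyOverP => i; rewrite coef_map memvZ ?memv_line.
have splitQr : splittingFieldFor <<1; zz>> (map_poly (in_alg Qr) p) {:Qr}.
  apply: (@splittingFieldForS _ _ 1%AS) (subvf _) _; first exact: sub1v.
  exists rr => //; congr (_ %= _): (eqpxx (map_poly (in_alg Qr) p)).
  apply/(map_poly_inj QrC); rewrite QrCQ -Dp Dr -Drr big_map rmorph_prod /=.
  by apply: eq_bigr => x _; rewrite map_polyXsubC.
have [f1 aut_f1 Df1] := kHom_extends (sub1v _) homz Qpr splitQr.
pose f1M := GRing.isMonoidMorphism.Build _ _ f1 (kHom_monoid_morphism aut_f1).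
pose phi : {rmorphism Qr -> Qr} := HB.pack (fun_of_lfun f1) f1M.
have [nu Dnu] := extend_algC_subfield_aut QrC phi.
exists nu; rewrite -Dz -Dnu /= -Df1 ?memv_adjoin //.
by rewrite (kHomExtend_val homQ1 root_w) Dw.
Qed.

(** A double root of the minimal polynomial p is a conjugate of z, hence has p itself as minimal
    polynomial; then p would divide its derivative, against the degrees. So p has as many roots as
    its degree. *)
Lemma conjugates (z : algC) : exists r : seq algC,
  [/\ uniq r, (size r).+1 = size (minCpoly z)
    & forall w, w \in r -> exists nu : {rmorphism algC -> algC}, nu z = w].
Proof.
have [r Dr] := closed_field_poly_normal (minCpoly z : {poly algC}).
rewrite (monicP (minCpoly_monic z)) scale1r in Dr.
exists r; split; last 1 first.
- by move=> w rw; apply: aut_conjugate; rewrite Dr root_prod_XsubC.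
- rewrite -separable_prod_XsubC -Dr.
  have [p [Dp mon_p] dv_p] := minCpolyP z; rewrite Dp separable_map.
  apply: contraT => nsep.
  have {nsep}[w] : exists w : algC, root (pQtoC (gcdp p p^`())) w.
    apply/closed_rootP; rewrite size_map_poly.
    by rewrite separable_poly.unlock coprimep_def in nsep.
  rewrite gcdp_map root_gcd => /andP[]; rewrite -Dp => /aut_conjugate[nu Dnu].
  have [p' [Dp' _] dv_p'] := minCpolyP w.
  rewrite dv_p'.
  have -> : p' = p by apply: (map_poly_inj (ratr : {rmorphism rat -> algC}));
    rewrite -Dp -Dp' -Dnu minCpoly_aut.
  have szp : (1 < size p)%N by have := size_minCpoly z; rewrite Dp size_map_poly.
  have dp0 : p^`() != 0.
    apply: contraTneq szp => /(congr1 (fun q : {poly rat} => q`_(size p).-2)).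
    rewrite coef_deriv coef0 => /eqP; rewrite Num.Theory.mulrn_eq0 /=.
    case E : (size p) => [|[|k]] //=.
    by move: (monic_neq0 mon_p); rewrite -lead_coef_eq0 lead_coefE E => /negPf->.
  by move=> /(dvdp_leq dp0); rewrite leqNgt lt_size_deriv ?monic_neq0.
- by rewrite Dr size_prod_XsubC.
Qed.

Lemma choice_fun (A B : Type) (R : A -> B -> Prop) :
  (forall x, exists y, R x y) -> exists f, forall x, R x (f x).
Proof.
move=> h; exists (fun x => proj1_sig (constructive_indefinite_description _ (h x))).
by move=> x; case: constructive_indefinite_description.
Qed.

Lemma over_rationals n (p : {mpoly algC[n]}) :
  over rationals p <-> p \is a mpolyOver n Crat.
Proof. by split=> [h|/mpolyOverP h]; first apply/mpolyOverP. Qed.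

Lemma aut_meval (nu : {rmorphism algC -> algC}) n (p : {mpoly algC[n]}) (u : 'rV_n) :
  over rationals p -> nu p.@[u 0] = p.@[(map_mx nu u) 0].
Proof.
move=> hp; rewrite !mevalE rmorph_sum; apply: eq_bigr => m _ /=.
rewrite rmorphM rmorph_prod aut_Crat ?hp //; congr (_ * _).
by apply: eq_bigr => i _; rewrite mxE rmorphXn.
Qed.

(** For a conjugate w = nu z, the relation is taken at the point nu^-1(u), which lies on the locus
    because the equations are rational; applying nu gives sum_k w^k p_k(u) = 0. The polynomial with
    coefficients p_k(u) then has at least N roots, and its degree is less than N. *)
Lemma vanishes_rational_components n (s : seq {mpoly algC[n.+1]}) z N
    (p : 'I_N -> {mpoly algC[n.+1]}) :
  (forall q, q \in s -> over rationals q) -> (N < size (minCpoly z))%N ->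
  (forall k, over rationals (p k)) ->
  vanishes (locus s) (\sum_(k < N) z ^+ k *: p k) ->
  forall k, vanishes (locus s) (p k).
Proof.
move=> hs hN hp hv k u [u0 us].
have [r [r_uniq r_size r_conj]] := conjugates z.
pose pu (i : nat) := if insub i is Some k then (p k).@[u 0] else 0.
have puE (i : 'I_N) : pu i = (p i).@[u 0] by rewrite /pu valK.
suff /(congr1 (fun q : {poly algC} => q`_k)) : \poly_(i < N) pu i = 0.
  by rewrite coef_poly ltn_ord puE coef0.
apply: (roots_geq_poly_eq0 _ r_uniq); last first.
  by apply: leq_trans (size_poly _ _) _; rewrite -ltnS r_size.
apply/allP => w /r_conj[nu nuz].
pose u' := map_mx (algC_invaut nu) u.
have u'K : map_mx nu u' = u by apply/rowP => i; rewrite !mxE algC_invautK.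
have Vu' : locus s u'.
  split=> [|q qs].
    by apply: contraNneq u0 => u'0; rewrite -u'K u'0 map_mx0.
  by apply: (fmorph_inj nu); rewrite aut_meval ?u'K ?rmorph0 ?us //; apply: hs.
have e : \sum_(i < N) z ^+ i * (p i).@[u' 0] = 0.
  rewrite -[RHS](hv _ Vu') raddf_sum /=.
  by apply: eq_bigr => i _; rewrite mevalZ.
apply/rootP; have /(congr1 nu) := e; rewrite rmorph0 rmorph_sum horner_poly.
by apply: etrans; apply: eq_bigr => i _; rewrite rmorphM rmorphXn nuz aut_meval // u'K puE mulrC.
Qed.

(** Primitive element theorem, followed by reduction modulo the minimal polynomial of z. *)
Lemma algC_coordinates (s : seq algC) : exists (z : algC) (N : nat),
  (N < size (minCpoly z))%N /\ forall c, c \in s ->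
  exists a : 'I_N -> rat, c = \sum_(k < N) ratr (a k) * z ^+ k.
Proof.
have [z _ [ps Ds]] := algC_PET s; exists z, (size (minCpoly z)).-1.
have szz := size_minCpoly z; split; first by case: size szz.
rewrite {s}Ds => _ /mapP[p _ ->].
have [q [Dq mon_q] dv_q] := minCpolyP z.
exists (fun k => (p %% q)`_k); rewrite (divp_eq p q) rmorphD rmorphM /=.
rewrite hornerD hornerM -Dq (rootP (root_minCpoly z)) mulr0 add0r.
rewrite -divp_eq (@horner_coef_wide _ (size (minCpoly z)).-1); last first.
  rewrite size_map_poly Dq size_map_poly -ltnS prednK ?ltn_modp ?monic_neq0 //.
  by rewrite lt0n size_poly_eq0 monic_neq0.
by apply: eq_bigr => i _; rewrite coef_map.
Qed.

Lemma mpoly_coordinates n m (F : 'I_m -> {mpoly algC[n]}) :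
  exists (z : algC) (N : nat) (G : 'I_N -> 'I_m -> {mpoly algC[n]}),
  [/\ (N < size (minCpoly z))%N, forall k j, over rationals (G k j),
      forall k j d, F j \is d.-homog -> G k j \is d.-homog
    & forall j, F j = \sum_(k < N) z ^+ k *: G k j].
Proof.
have [z [N [hN coord]]] :=
  algC_coordinates (flatten [seq [seq (F j)@_x | x <- msupp (F j)] | j : 'I_m]).
have : forall jm : 'I_m * 'X_{1..n}, exists a : 'I_N -> rat, jm.2 \in msupp (F jm.1) ->
    (F jm.1)@_jm.2 = \sum_(k < N) ratr (a k) * z ^+ k.
  case=> j x /=; have [xF|_] := boolP (x \in msupp (F j)); last by exists (fun=> 0).
  have [|a ha] := coord (F j)@_x; last by exists a.
  apply/flattenP; exists [seq (F j)@_x | x <- msupp (F j)]; last exact: map_f.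
  exact: image_f.
case/choice_fun => a ha.
pose G (k : 'I_N) j : {mpoly algC[n]} :=
  \sum_(x <- msupp (F j)) ratr (a (j, x) k) *: 'X_[x].
exists z, N, G; split=> // [k j|k j d /dhomogP Fd|j].
- apply/over_rationals/rpred_sum => x _.
  by apply: mpolyOverZ; rewrite ?Crat_rat // mpolyOverX.
- rewrite /G big_seq; apply: rpred_sum => x xF.
  by rewrite dhomogZ // dhomogX; apply/eqP/Fd.
rewrite {1}(mpolyE (F j)) /G.
under [RHS]eq_bigr do rewrite scaler_sumr.
rewrite exchange_big /=; apply: eq_big_seq => x xF.
rewrite (ha (j, x) xF) scaler_suml; apply: eq_bigr => k _.
by rewrite scalerA mulrC.
Qed.

Lemma pihomogM n d e (p q : {mpoly algC[n]}) : q \is d.-homog ->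
  pihomog mdeg (e + d) (p * q) = pihomog mdeg e p * q.
Proof.
move=> hq; have h i : pihomog mdeg i p * q \is (i + d).-homog.
  by apply: dhomogM => //; apply: pihomogP.
rewrite {1}(@pihomog_partitionE _ _ mdeg _ p (leq_addr e (msize p))).
rewrite mulr_suml linear_sum /=.
have [he|he] := ltnP e (msize p + e); last first.
  have -> : pihomog mdeg e p = 0.
    rewrite pihomogE big_seq_cond big1 // => m /andP[/msize_mdeg_lt mp /eqP me].
    by move: he mp; rewrite me leqNgt => /negP + mp; case; rewrite (leq_trans mp) ?leq_addr.
  rewrite mul0r big1 // => i _; apply: (pihomog_ne0 _ (h i)).
  by rewrite eqn_add2r; apply: contraTneq (ltn_ord i) => ->; rewrite -leqNgt.
rewrite (bigD1 (Ordinal he)) //= big1 ?addr0 => [|i ie]; first exact: pihomog_dE.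
by apply: (pihomog_ne0 _ (h i)); rewrite eqn_add2r.
Qed.

(** Equality of two rational maps with denominators cleared. The zero vector is proportional to
    everything, so nonvanishing is always stated separately. *)
Definition proportional n m (V : 'rV[algC]_n -> Prop) (F G : 'I_m -> {mpoly algC[n]}) :=
  forall i j, vanishes V (F i * G j - F j * G i).

(** Proportionality to a fixed rational form vector F is linear in G. It therefore passes to a
    homogeneous component of G, then to its rational coordinates along the powers of z, and one of
    these is still nonzero at v. *)
Lemma rational_representative n m (s : seq {mpoly algC[n.+1]})
    (F G : 'I_m -> {mpoly algC[n.+1]}) d v j0 :
  (forall q, q \in s -> homogeneous q /\ over rationals q) ->
  (forall j, F j \is d.-homog /\ over rationals (F j)) ->
  proportional (locus s) G F -> (G j0).@[(v : 'rV_n.+1) 0] != 0 ->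
  exists G' : 'I_m -> {mpoly algC[n.+1]},
  [/\ exists e, forall j, G' j \is e.-homog /\ over rationals (G' j),
      proportional (locus s) G' F & (G' j0).@[v 0] != 0].
Proof.
move=> hs hF GF Gv.
have coneX := closed_cone (closed_locus (fun p ps => (hs p ps).1)).
have [e Gev] : exists e, (pihomog mdeg e (G j0)).@[v 0] != 0.
  apply: NNPP => /not_ex_all_not h; move/negP: Gv; apply; apply/eqP.
  rewrite (@pihomog_partitionE _ _ mdeg _ (G j0) (leqnn _)) raddf_sum big1 // => i _ /=.
  by apply/eqP; apply/negPn/negP/h.
have [z [N [H [hN HQ Hhom HE]]]] := mpoly_coordinates (fun j => pihomog mdeg e (G j)).
have [k Hkv] : exists k, (H k j0).@[v 0] != 0.
  apply: NNPP => /not_ex_all_not h; move/negP: Gev; apply; apply/eqP.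
  rewrite HE raddf_sum big1 // => i _ /=; rewrite mevalZ.
  by move/negP: (h i) => /negPn/eqP->; rewrite mulr0.
exists (H k); split=> // [|i j].
  by exists e => j; split; [apply/Hhom/pihomogP | apply: HQ].
apply: (@vanishes_rational_components _ s z N
  (fun k => H k i * F j - H k j * F i)) => //; first by move=> q /hs[].
  move=> k'; apply/over_rationals/rpredB; apply: rpredM; apply/over_rationals => //;
    by case: (hF i); case: (hF j).
have := vanishes_pihomog (e + d)%N coneX (GF i j).
rewrite pihomogB !pihomogM ?(hF i).1 ?(hF j).1 // !HE !mulr_suml -sumrB.
by under eq_bigr do rewrite -!scalerAl -scalerBr.
Qed.

(** * The local ring of a smooth curve *)

(** A nontrivial polynomial relation between f / l and t / l, of degree at most K in each, with
    denominators cleared by powers of l. This says that the transcendence degree is at most one. *)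
Definition functions_dependent n (V : 'rV[algC]_n -> Prop) : Prop :=
  forall d f t l, f \is d.-homog -> t \is d.-homog -> l \is d.-homog ->
  exists (K : nat) (phi : nat -> nat -> algC),
    (exists i j : 'I_K.+1, phi i j != 0) /\
    vanishes V (\sum_(i < K.+1) \sum_(j < K.+1)
                  phi i j *: (f ^+ i * t ^+ j * l ^+ (K - i + (K - j)))).

(** The least power of f that occurs is factored out and cancelled by primality; what remains has a
    nonzero part free of f, a form in t and l. *)
Lemma dependent_relation n (V : 'rV[algC]_n -> Prop) d f t l :
  prime_set V -> functions_dependent V ->
  f \is d.-homog -> t \is d.-homog -> l \is d.-homog -> ~ vanishes V f ->
  exists (M : nat) (c : nat -> algC) (r : {mpoly algC[n]}),
    (exists j : 'I_M.+1, c j != 0) /\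
    vanishes V (\sum_(j < M.+1) c j *: (t ^+ j * l ^+ (M - j)) - r * f).
Proof.
move=> prV depV hf ht hl fV; have [K [phi [[i0 [j0 phi0]] rel]]] := depV d f t l hf ht hl.
have exi : exists i, (i <= K)%N && [exists j : 'I_K.+1, phi i j != 0].
  by exists i0; rewrite -ltnS ltn_ord; apply/existsP; exists j0.
have [i1 /andP[i1K /existsP[j1 phi1]] i1min] := ex_minnP exi.
pose T i := \sum_(j < K.+1) phi i j *: (t ^+ j * l ^+ (K - i + (K - j))).
have relE : \sum_(i < K.+1) \sum_(j < K.+1)
      phi i j *: (f ^+ i * t ^+ j * l ^+ (K - i + (K - j))) =
    f ^+ i1 * \sum_(i < K.+1 | (i1 <= i)%N) f ^+ (i - i1) * T i.
  rewrite mulr_sumr [RHS]big_mkcond /=; apply: eq_bigr => i _.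
  case: leqP => [le_i1|lt_i].
    rewrite mulrA -exprD subnKC // /T [RHS]mulr_sumr.
    by apply: eq_bigr => j _; rewrite -scalerAr [in RHS]mulrA.
  apply: big1 => j _; suff -> : phi i j = 0 by rewrite scale0r.
  apply: contraTeq lt_i => phiij; rewrite -leqNgt; apply: i1min.
  by rewrite -ltnS ltn_ord; apply/existsP; exists j.
have f1V : ~ vanishes V (f ^+ i1).
  have [u Vu fu] := (not_vanishesP V f).1 fV; apply/not_vanishesP; exists u => //.
  by rewrite rmorphXn expf_neq0.
rewrite relE in rel; have {rel}rel := prime_setP prV f1V rel.
have i1S : (i1 < K.+1)%N by [].
(* The row [i1] has degree 2 K - i1 in t and l together, which is M; its coefficients beyond K are
   set to 0. *)
exists (K - i1 + K)%N, (fun j => if (j <= K)%N then phi i1 j else 0),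
  (- \sum_(i < K.+1 | (i1 < i)%N) f ^+ (i - i1.+1) * T i); split.
  have j1S : (j1 < (K - i1 + K).+1)%N.
    by rewrite ltnS (leq_trans _ (leq_addl _ _)) // -ltnS.
  by exists (Ordinal j1S) => /=; rewrite -ltnS ltn_ord.
have <- : \sum_(i < K.+1 | (i1 <= i)%N) f ^+ (i - i1) * T i =
    \sum_(j < (K - i1 + K).+1) (if (j <= K)%N then phi i1 j else 0) *:
      (t ^+ j * l ^+ (K - i1 + K - j)) -
    - (\sum_(i < K.+1 | (i1 < i)%N) f ^+ (i - i1.+1) * T i) * f.
  rewrite mulNr opprK (bigD1 (Ordinal i1S)) //= subnn expr0 mul1r; congr (_ + _).
    rewrite /T (big_ord_widen_cond (K - i1 + K).+1 xpredT
      (fun j => phi i1 j *: (t ^+ j * l ^+ (K - i1 + (K - j))))); last first.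
      by rewrite ltnS leq_addl.
    rewrite big_mkcond /=; apply: eq_bigr => j _; rewrite ltnS.
    by case: leqP => [jK|_]; rewrite ?scale0r // addnBA.
  rewrite mulr_suml; apply: eq_big => [i|i /andP[i1i ii1]].
    by rewrite ltn_neqAle andbC eq_sym.
  have lt_i : (i1 < i)%N by rewrite ltn_neqAle i1i eq_sym ii1.
  by rewrite mulrAC -exprSr subnSK.
exact: rel.
Qed.

Section LocalRing.

Variables (n : nat) (s : seq {mpoly algC[n.+1]}) (v : 'rV[algC]_n.+1) (i0 : 'I_n.+1).
Let X := locus s.
Hypothesis s_homog : forall p, p \in s -> homogeneous p.
Hypothesis X_v : X v.
Hypothesis v_i0 : v 0 i0 = 1.

(** These linear forms generate the ideal of the line through v; [w i0] is zero. *)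
Let w (j : 'I_n.+1) : {mpoly algC[n.+1]} := 'X_j - v 0 j *: 'X_i0.

Let eqw (p q : {mpoly algC[n.+1]}) : Prop := exists h, p - q = \sum_j h j * w j.

Let eqw0 p : eqw p p.
Proof. by exists (fun=> 0); rewrite subrr big1 // => j _; rewrite mul0r. Qed.

Let eqwD p1 q1 p2 q2 : eqw p1 q1 -> eqw p2 q2 -> eqw (p1 + p2) (q1 + q2).
Proof.
move=> [h1 e1] [h2 e2]; exists (fun j => h1 j + h2 j).
under eq_bigr do rewrite mulrDl.
by rewrite big_split /= -e1 -e2; ring.
Qed.

Let eqwM p1 q1 p2 q2 : eqw p1 q1 -> eqw p2 q2 -> eqw (p1 * p2) (q1 * q2).
Proof.
move=> [h1 e1] [h2 e2]; exists (fun j => p2 * h1 j + q1 * h2 j).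
under eq_bigr do rewrite mulrDl -!mulrA.
by rewrite big_split /= -!mulr_sumr -e1 -e2; ring.
Qed.

(** Modulo the [w j], each variable 'X_j may be replaced by v_j 'X_i0. *)
Lemma line_ideal p d : p \is d.-homog ->
  exists h : 'I_n.+1 -> {mpoly algC[n.+1]},
    p = p.@[v 0] *: 'X_i0 ^+ d + \sum_j h j * w j.
Proof.
move=> hp; suff [h e] : eqw p (p.@[v 0] *: 'X_i0 ^+ d).
  by exists h; rewrite -e; ring.
rewrite mevalE scaler_suml {1}(mpolyE p) !big_seq.
apply: (big_ind2 eqw) => [||m mp]; [exact: eqw0|exact: eqwD|].
rewrite -scalerA -![p@_m *: _]mul_mpolyC; apply: eqwM; first exact: eqw0.
rewrite mpolyXE_id -(dhomog_mf hp mp) /= mdegE -prodrXr -mul_mpolyC rmorph_prod -big_split /=.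
apply: (big_ind2 eqw) => [||j _]; [exact: eqw0|exact: eqwM|].
rewrite rmorphXn -exprMn.
elim: (m j) => [|k IH]; first by rewrite !expr0; exact: eqw0.
rewrite !exprS; apply: eqwM => //.
exists (fun i => (i == j)%:R); rewrite (bigD1 j) //= eqxx mul1r.
rewrite big1 ?addr0 => [|i /negPf->]; last by rewrite mul0r.
by rewrite /w mul_mpolyC.
Qed.

Lemma w_v j : (w j).@[v 0] = 0.
Proof. by rewrite /w mevalB mevalZ !mevalXU v_i0 mulr1 subrr. Qed.

Hypothesis smooth_v : \rank (jacobian s v) = n.-1.

(** Nakayama's lemma made explicit. The matrix E below is the identity at v, and on X it sends the
    column W of the [w j] to the constant column Y times t; multiplying by the adjugate of E
    isolates each [w j] up to D = det E. *)
Lemma tangent_ideal : exists (D t : {mpoly algC[n.+1]}) (A : 'I_n.+1 -> {mpoly algC[n.+1]}),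
  [/\ D.@[v 0] != 0, t.@[v 0] = 0, t \is 1.-homog
    & forall j, vanishes X (D * w j - A j * t)].
Proof.
have s_line (i : 'I_(size s)) : exists h : 'I_n.+1 -> {mpoly algC[n.+1]},
    h i0 = 0 /\ s`_i = \sum_j h j * w j.
  have si : s`_i \in s by apply: mem_nth.
  have [d hd] := s_homog si; have [h e] := line_ideal hd.
  exists (fun j => if j == i0 then 0 else h j); split; first by rewrite eqxx.
  rewrite e (X_v.2 _ si) scale0r add0r; apply: eq_bigr => j _.
  by case: eqP => // ->; rewrite /w v_i0 scale1r subrr !mulr0.
have [h hE] := choice_fun s_line.
pose H := \matrix_(i < size s, j < n.+1) h i j.
(* The added row expresses that [w i0] is zero: [Hp] still kills W on X, and its rank at v rises to
   at least n. *)
pose Hp := col_mx H (delta_mx 0 i0 : 'rV_n.+1).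
pose A0 := map_mx (meval (v 0)) Hp.
(* Since the [w j] vanish at v, only their own derivatives contribute, so H(v) has at least the rank
   of the Jacobian. *)
have jacE : jacobian s v = map_mx (meval (v 0)) H *m
    \matrix_(j, k) ((j == k)%:R - v 0 j * (k == i0)%:R).
  apply/matrixP => i k; rewrite !mxE (hE i).2.
  rewrite mderiv_sum meval_sum; apply: eq_bigr => j _.
  rewrite mderivM mevalD !mevalM w_v mulr0 add0r !mxE; congr (_ * _).
  by rewrite /w mderivB mderivZ !mderivXU mevalB mevalZ !mevalC eq_sym (eq_sym i0).
have rankA0 : (n <= \rank A0)%N.
  rewrite /A0 /Hp map_col_mx -addsmxE mxrank_disjoint_sum; last first.
    apply/eqP; rewrite -submx0; apply/rV_subP => x; rewrite sub_capmx submx0.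
    move=> /andP[/submxP[a ->] /submxP[b]] e.
    have := congr1 (mulmx^~ (delta_mx i0 0 : 'cV_n.+1)) e.
    rewrite -!mulmxA (_ : map_mx _ H *m _ = 0) ?mulmx0; last first.
      apply/colP => i; rewrite !mxE big1 // => j _; rewrite !mxE eqxx andbT.
      by case: eqP => [->|_]; rewrite ?mulr0 // (hE i).1 meval0 mul0r.
    rewrite map_delta_mx mul_delta_mx => /esym b0.
    have b00 : b = 0.
      apply/rowP => i; have /matrixP/(_ 0 0) := b0.
      by rewrite !mxE big_ord1 !mxE !eqxx mulr1 !ord1.
    by rewrite e b00 mul0mx.
  rewrite map_delta_mx mxrank_delta.
  have : (n.-1 <= \rank (map_mx (meval (v 0%R)) H))%N.
    by rewrite -smooth_v jacE mxrankM_maxl.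
  by rewrite addn1; move: (\rank _) => r; clear; case: n.
(* Q is a projection onto the row space of [A0]. The complementary projection has rank at most one,
   and its factorization Y T provides the linear form t. *)
pose Q := pinvmx A0 *m A0.
have A0Q : A0 *m Q = A0 by rewrite /Q mulmxA mulmxKpV.
have rank1Q : (\rank (1%:M - Q)%R <= 1)%N.
  have rQ : (n <= \rank Q)%N by rewrite (leq_trans rankA0) // -{1}A0Q mxrankM_maxr.
  have : ((1%:M - Q) <= kermx Q)%MS.
    by rewrite sub_kermx mulmxBl mul1mx -mulmxA A0Q subrr.
  move=> /mxrankS; rewrite mxrank_ker => /leq_trans; apply.
  by rewrite leq_subLR addn1 ltnS.
have [Y [T YT]] : exists (Y : 'cV_n.+1) (T : 'rV_n.+1), 1%:M - Q = Y *m T.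
  have := mulmx_base (1%:M - Q); move: (col_base _) (row_base _).
  case: (\rank _) rank1Q => [|[|//]] _ L R <-.
    by exists 0, 0; rewrite mulmx0 [L]thinmx0 mul0mx.
  by exists L, R.
pose C m k := map_mx (@mpolyC n.+1 algC) : 'M_(m, k) -> _.
pose E := 1%:M - C _ _ Q + C _ _ (pinvmx A0) *m Hp.
pose W := \col_j w j.
pose t := (C _ _ T *m W) 0 0.
have evC (u : 'rV[algC]_n.+1) m k (M : 'M_(m, k)) : map_mx (meval (u 0)) (C _ _ M) = M.
  by apply/matrixP => i j; rewrite !mxE mevalC.
have evW (u : 'rV[algC]_n.+1) : map_mx (meval (u 0)) W = \col_j (w j).@[u 0].
  by apply/colP => j; rewrite !mxE.
have evt (u : 'rV[algC]_n.+1) : t.@[u 0] = (T *m map_mx (meval (u 0)) W) 0 0.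
  by rewrite -(evC u _ _ T) -map_mxM /= mxE.
exists (\det E), t, (fun j => (\adj E *m C _ _ Y) j 0); split.
- rewrite -det_map_mx /E map_mxD map_mxB map_mx1 map_mxM !evC.
  by rewrite /Q subrK det1 oner_neq0.
- rewrite evt evW (_ : \col_j _ = 0) ?mulmx0 ?mxE //.
  by apply/colP => j; rewrite !mxE w_v.
- rewrite /t mxE; apply: rpred_sum => j _; rewrite !mxE mul_mpolyC dhomogZ //.
  by rewrite /w rpredB ?dhomogZ // dhomogX /= mdeg1.
move=> j u Xu; rewrite mevalB !mevalM evt.
have HpW : map_mx (meval (u 0)) Hp *m map_mx (meval (u 0)) W = 0.
  rewrite /Hp map_col_mx mul_col_mx -[RHS]col_mx0; congr col_mx.
    apply/colP => i; rewrite !mxE -[RHS](Xu.2 s`_i) ?mem_nth // (hE i).2 meval_sum.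
    by apply: eq_bigr => k _; rewrite !mxE mevalM.
  rewrite map_delta_mx -rowE; apply/rowP => k.
  by rewrite !mxE /w v_i0 scale1r subrr meval0.
have EW : map_mx (meval (u 0)) E *m map_mx (meval (u 0)) W =
    Y *m (T *m map_mx (meval (u 0)) W).
  rewrite {1}/E map_mxD map_mxB map_mx1 map_mxM !evC mulmxDl -mulmxA HpW mulmx0 addr0.
  by rewrite YT mulmxA.
have := congr1 (mulmx (map_mx (meval (u 0)) (\adj E))) EW.
rewrite [LHS]mulmxA -map_mxM mul_adj_mx map_scalar_mx mul_scalar_mx [RHS]mulmxA.
rewrite -[in RHS](evC u _ _ Y) -map_mxM => /colP/(_ j); rewrite evW.
rewrite [RHS]mxE big_ord1 [LHS]mxE [in LHS]mxE [map_mx _ _ j _]mxE => ->.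
exact: subrr.
Qed.

Hypothesis X_prime : prime_set X.
Hypothesis X_dep : functions_dependent X.

Let coneX : cone X := closed_cone (closed_locus s_homog).

(** While f vanishes at v it can be divided by t, up to a form that is nonzero at v. This stops
    because algebraic dependence provides a relation A f = B t^e on X with B nonzero at v, and each
    division lowers e by one. The relation thus does the work of Krull's intersection theorem. *)
Lemma local_ring_valuation : exists t : {mpoly algC[n.+1]}, forall d f,
  f \is d.-homog -> ~ vanishes X f ->
  exists (e : nat) (U U' : {mpoly algC[n.+1]}),
  [/\ U.@[v 0] != 0, U'.@[v 0] != 0 & vanishes X (U * f - U' * t ^+ e)].
Proof.
have [D [t [A [Dv tv ht DA]]]] := tangent_ideal; exists t.
have divide_t d f : f \is d.-homog -> ~ vanishes X f -> f.@[v 0] = 0 ->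
    exists D' f1 d', [/\ D'.@[v 0] != 0, f1 \is d'.-homog
                       & vanishes X (D' * f - f1 * t)].
  move=> hf fX fv; have [h fE] := line_ideal hf.
  rewrite fv scale0r add0r in fE.
  have d_gt0 : (0 < d)%N.
    case: d hf => // hf; case: fX => u _.
    by rewrite (meval_dhomog0 _ (v 0) hf).
  have DfX : vanishes X (D * f - (\sum_j h j * A j) * t).
    move=> u Xu; rewrite mevalB !mevalM.
    have -> : f.@[u 0] = \sum_j (h j).@[u 0] * (w j).@[u 0].
      by rewrite {1}fE meval_sum; apply: eq_bigr => j _; rewrite mevalM.
    rewrite meval_sum mulr_sumr mulr_suml -sumrB big1 // => j _.
    have := DA j u Xu; rewrite mevalB !mevalM => e.
    by rewrite mulrCA -mulrA -mulrBr e mulr0.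
  have [e De] : exists e, (pihomog mdeg e D).@[v 0] != 0.
    apply: NNPP => /not_ex_all_not De; move/negP: Dv; apply; apply/eqP.
    rewrite (@pihomog_partitionE _ _ mdeg _ D (leqnn _)) meval_sum big1 // => i _.
    by apply/eqP/negPn/negP/De.
  exists (pihomog mdeg e D), (pihomog mdeg (e + d.-1) (\sum_j h j * A j)), (e + d.-1)%N.
  split=> //; first exact: pihomogP.
  have := vanishes_pihomog (e + d)%N coneX DfX.
  have ed : (e + d = e + d.-1 + 1)%N by rewrite addn1 -addnS prednK.
  by rewrite pihomogB (pihomogM _ _ hf) ed (pihomogM _ _ ht).
move=> d f hf fX.
have lv : ('X_i0 : {mpoly algC[n.+1]}).@[v 0] = 1 by rewrite mevalXU.
have : exists e A B, B.@[v 0] != 0 /\ vanishes X (A * f - B * t ^+ e).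
  case: (posnP d) => [d0|d_gt0].
    exists 0%N, 1, f; split; last by move=> u _; rewrite expr0 mulr1 mul1r subrr meval0.
    have [u _ fu] := (not_vanishesP X f).1 fX.
    by rewrite d0 in hf; rewrite (meval_dhomog0 _ (u 0) hf).
  have hX k : ('X_i0 ^+ k : {mpoly algC[n.+1]}) \is k.-homog.
    by have := dhomogXn k (dhomogXU i0); rewrite muln1.
  have hl := hX d; have ht' : t * 'X_i0 ^+ d.-1 \is d.-homog.
    by have := dhomogM ht (hX d.-1); rewrite add1n prednK.
  have [M [c [r [[j0 cj0] rel]]]] := dependent_relation X_prime X_dep hf ht' hl fX.
  have exc : exists j, (j <= M)%N && (c j != 0) by exists j0; rewrite -ltnS ltn_ord.
  have [e /andP[eM ce] emin] := ex_minnP exc.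
  pose term j := c j *: (('X_i0 ^+ d.-1) ^+ j * ('X_i0 ^+ d) ^+ (M - j)) : {mpoly algC[n.+1]}.
  (* The lowest power of t in the relation is factored out. At v, where t is 0 and 'X_i0 is 1, the
     cofactor takes the value [c e], which is nonzero. *)
  exists e, r, (\sum_(j < M.+1 | (e <= j)%N) term j * t ^+ (j - e)); split.
    have eS : (e < M.+1)%N by [].
    rewrite meval_sum (bigD1 (Ordinal eS)) //= big1 => [|j /andP[ej je]].
      by rewrite /term subnn expr0 mulr1 addr0 mevalZ mevalM !rmorphXn /= lv !expr1n !mulr1.
    have : (0 < j - e)%N by rewrite subn_gt0 ltn_neqAle eq_sym je.
    by case: (j - e)%N => // k _; rewrite mevalM rmorphXn /= tv expr0n mulr0.
  move=> u Xu; have := rel u Xu; rewrite !mevalB => /eqP; rewrite subr_eq0 => /eqP <-.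
  apply/eqP; rewrite subr_eq0 mulr_suml; apply/eqP; congr (_.@[_]).
  rewrite [RHS]big_mkcond /=; apply: eq_bigr => j _; case: leqP => [ej|je].
    by rewrite -mulrA -exprD subnK // /term exprMn -scalerAl; congr (_ *: _); ring.
  have [->|cj] := eqVneq (c j) 0; first by rewrite scale0r.
  by have := emin j; rewrite -ltnS ltn_ord cj leqNgt je => /(_ isT).
move=> [e]; elim: e d f hf fX => [|e IH] d f hf fX [A' [B [Bv rel]]].
  have [fv|fv] := eqVneq f.@[v 0] 0; last first.
    exists 0%N, 1, f; split=> //; first by rewrite meval1 oner_eq0.
    by move=> u _; rewrite expr0 mulr1 mul1r subrr meval0.
  have := rel v X_v; rewrite mevalB !mevalM fv mulr0 expr0 meval1 mulr1 sub0r => /eqP.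
  by rewrite oppr_eq0 (negPf Bv).
have [fv|fv] := eqVneq f.@[v 0] 0; last first.
  exists 0%N, 1, f; split=> //; first by rewrite meval1 oner_eq0.
  by move=> u _; rewrite expr0 mulr1 mul1r subrr meval0.
have [D' [f1 [d' [D'v hf1 D'f]]]] := divide_t d f hf fX fv.
have D'fX : ~ vanishes X (f1 * t).
  have D'X : ~ vanishes X D' by apply/not_vanishesP; exists v.
  move=> f1t; apply: (not_vanishesM X_prime D'X fX) => u Xu.
  by have := D'f u Xu; rewrite mevalB (f1t u Xu) subr0.
have tX : ~ vanishes X t by move=> tX; apply: D'fX => u Xu; rewrite mevalM (tX u Xu) mulr0.
have f1X : ~ vanishes X f1 by move=> f1X; apply: D'fX => u Xu; rewrite mevalM (f1X u Xu) mul0r.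
have rel1 : vanishes X (A' * f1 - (D' * B) * t ^+ e).
  apply: (prime_setP X_prime tX) => u Xu.
  have := rel u Xu; have := D'f u Xu.
  rewrite !mevalB !mevalM !mevalB !mevalM !rmorphXn /= exprS => /eqP.
  rewrite subr_eq0 => /eqP e1 /eqP; rewrite subr_eq0 => /eqP e2.
  by ring: (esym e1) e2.
have [|e' [U [U' [Uv U'v rel']]]] := IH d' f1 hf1 f1X.
  by exists A', (D' * B); rewrite mevalM mulf_neq0.
exists e'.+1, (U * D'), U'; split=> //; first by rewrite mevalM mulf_neq0.
move=> u Xu; have := rel' u Xu; have := D'f u Xu.
rewrite !mevalB !mevalM !rmorphXn /= exprS => /eqP.
rewrite subr_eq0 => /eqP e1 /eqP; rewrite subr_eq0 => /eqP e2.
by ring: e1 e2.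
Qed.
End LocalRing.

(** The components of F are divided by the least power of t among their orders at v, after
    multiplication by the common denominator [UU]. *)
Lemma rational_map_regular n m (s : seq {mpoly algC[n.+1]})
    (F : 'I_m -> {mpoly algC[n.+1]}) d (v : 'rV[algC]_n.+1) (i0 : 'I_n.+1) :
  (forall p, p \in s -> homogeneous p) -> locus s v -> v 0 i0 = 1 ->
  \rank (jacobian s v) = n.-1 ->
  prime_set (locus s) -> functions_dependent (locus s) ->
  (forall j, F j \is d.-homog) -> (exists j, ~ vanishes (locus s) (F j)) ->
  exists G : 'I_m -> {mpoly algC[n.+1]},
    proportional (locus s) G F /\ exists j, (G j).@[v 0] != 0.
Proof.
move=> hs Xv vi0 sm prX depX hF [j1 Fj1].
have [t ht] := local_ring_valuation hs Xv vi0 sm prX depX.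
have /choice_fun[ord hord] : forall j, exists D : nat * {mpoly algC[n.+1]} * {mpoly algC[n.+1]},
    [/\ D.1.2.@[v 0] != 0, (~ vanishes (locus s) (F j) <-> D.2.@[v 0] != 0),
        (D.2.@[v 0] = 0 -> D.2 = 0)
      & vanishes (locus s) (D.1.2 * F j - D.2 * t ^+ D.1.1)].
  move=> j; have [Fj|Fj] := classic (vanishes (locus s) (F j)).
    (* A component that vanishes on X is recorded with [U'] = 0 and order 0. It is left out of the
       minimum, and the truncated subtraction in the exponent of t does no harm to it. *)
    exists (0%N, 1, 0); split=> //=; first by rewrite meval1 oner_eq0.
      by split=> [/(_ Fj)//|]; rewrite meval0 eqxx.
    by move=> u Xu; rewrite mul0r subr0 mul1r Fj.
  have [e [U [U' [Uv U'v rel]]]] := ht d (F j) (hF j) Fj.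
  by exists (e, U, U'); split=> //= U'0; move: U'v; rewrite U'0 eqxx.
pose e j := (ord j).1.1; pose U j := (ord j).1.2; pose U' j := (ord j).2.
have P1 : (U' j1).@[v 0] != 0 by have [_ [h _] _ _] := hord j1; apply: h.
have [j0 U'j0 e_min] := arg_minnP (P := fun j => (U' j).@[v 0] != 0) e P1.
pose UU := \prod_j U j.
pose G j := (\prod_(k | k != j) U k) * U' j * t ^+ (e j - e j0).
have GE j u : locus s u -> (UU * F j).@[u 0] = (G j * t ^+ e j0).@[u 0].
  move=> Xu; have [_ _ h] := hord j; rewrite -/(U' j) -/(U j) -/(e j) in h *.
  move=> /(_ u Xu); rewrite mevalB => /eqP; rewrite subr_eq0 => /eqP rel.
  rewrite /UU (bigD1 j) //= -mulrA [_ * F j]mulrC mulrA mevalM rel -mevalM.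
  congr (_.@[_]); rewrite /G.
  have [U'j|U'j] := eqVneq (U' j).@[v 0] 0; first by rewrite h // !(mulr0, mul0r).
  have le_e := e_min j U'j.
  rewrite -[in LHS](subnK le_e) exprD; ring.
exists G; split=> [i j|]; last first.
  exists j0; rewrite /G subnn expr0 mulr1 mevalM mulf_neq0 // meval_prod.
  by apply/prodf_neq0 => k _; have [] := hord k.
have UX : ~ vanishes (locus s) UU.
  apply/not_vanishesP; exists v => //; rewrite /UU meval_prod.
  by apply/prodf_neq0 => k _; have [] := hord k.
have Fj0 : ~ vanishes (locus s) (F j0) by have [_ [_ h] _ _] := hord j0; apply: h.
have UFX := not_vanishesM prX UX Fj0.
have tX : ~ vanishes (locus s) (t ^+ e j0).
  by move=> tX; apply: UFX => u Xu; rewrite GE // mevalM tX // mulr0.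
apply: (prime_setP prX (not_vanishesM prX UX tX)) => u Xu.
have := GE i u Xu; have := GE j u Xu; rewrite !mevalM mevalB !mevalM => e1 e2.
by ring: (esym e1) (esym e2).
Qed.

Definition smooth_along n (s : seq {mpoly algC[n.+1]}) :=
  forall v, locus s v -> \rank (jacobian s v) = n.-1.

Lemma rational_map_extends n m (s : seq {mpoly algC[n.+1]})
    (F : 'I_m.+1 -> {mpoly algC[n.+1]}) v :
  (forall q, q \in s -> homogeneous q /\ over rationals q) ->
  smooth_along s -> prime_set (locus s) -> functions_dependent (locus s) ->
  forms_over rationals F -> (exists j, ~ vanishes (locus s) (F j)) -> locus s v ->
  exists G : 'I_m.+1 -> {mpoly algC[n.+1]},
  [/\ forms_over rationals G, proportional (locus s) G F & eval_forms G v != 0].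
Proof.
move=> hs sm prX depX [d hF] Fne Xv.
have [i0 vi0] : exists i0, v 0 i0 != 0.
  apply: NNPP => /not_ex_all_not h; case: Xv => /eqP + _; apply; apply/rowP => i.
  by rewrite mxE; apply/eqP/negPn/negP/h.
have hs' p ps := (hs p ps).1.
pose v' := (v 0 i0)^-1 *: v.
have v0 : (v 0 i0)^-1 != 0 by rewrite invr_eq0.
have Xv' : locus s v' by apply: closed_cone (closed_locus hs') _ _ Xv v0.
have v'i0 : v' 0 i0 = 1 by rewrite mxE mulVf.
have [G [GF [j0 Gj0]]] :=
  rational_map_regular hs' Xv' v'i0 (sm _ Xv') prX depX (fun j => (hF j).1) Fne.
have [G' [[e hG'] G'F G'j0]] := rational_representative hs hF GF Gj0.
exists G'; split=> //; first by exists e.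
apply: contraNneq G'j0 => /rowP/(_ j0); rewrite !mxE => G'v.
by rewrite (meval_dhomogZ _ _ (hG' j0).1) G'v mulr0.
Qed.

(** * Morphisms and isomorphisms *)

Lemma peq_refl n (u : 'rV[algC]_n) : peq u u.
Proof. by exists 1; rewrite ?oner_neq0 ?scale1r. Qed.

Lemma peq_sym n (u v : 'rV[algC]_n) : peq u v -> peq v u.
Proof.
move=> [c c0 ->]; exists c^-1; first by rewrite invr_eq0.
by rewrite scalerA mulVf ?scale1r.
Qed.

Lemma peq_trans n (u v w : 'rV[algC]_n) : peq u v -> peq v w -> peq u w.
Proof.
move=> [c c0 ->] [d d0 ->]; exists (d * c); first by rewrite mulf_neq0.
by rewrite scalerA.
Qed.

Lemma rV_neq0P n (u : 'rV[algC]_n) : u != 0 <-> exists i, u 0 i != 0.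
Proof.
split=> [u0|[i ui]]; last by apply: contraNneq ui => ->; rewrite mxE.
apply: NNPP => /not_ex_all_not h; move/eqP: u0; apply; apply/rowP => i.
by rewrite mxE; apply/eqP/negPn/negP/h.
Qed.

Lemma peq_cross n (u v : 'rV[algC]_n) : u != 0 -> v != 0 ->
  (forall i j, u 0 i * v 0 j = u 0 j * v 0 i) -> peq u v.
Proof.
move=> /rV_neq0P[i ui] v0 uv.
have vE : v = (v 0 i / u 0 i) *: u.
  by apply/rowP => j; rewrite mxE mulrAC [v 0 i * _]mulrC -uv mulrAC mulfV ?mul1r.
exists (v 0 i / u 0 i) => //; apply: contraNneq v0 => c0.
by rewrite vE c0 scale0r.
Qed.

Lemma peq_neq0 n (u v : 'rV[algC]_n) : peq u v -> u != 0 -> v != 0.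
Proof. by move=> [c c0 ->] u0; rewrite scaler_eq0 negb_or c0. Qed.

Lemma peq_cone n (V : 'rV[algC]_n -> Prop) u v : cone V -> peq u v -> V u -> V v.
Proof. by move=> coneV [c c0 ->] Vu; apply: coneV. Qed.

Section Forms.

Variable k : algC -> Prop.
Hypotheses (k1 : k 1) (k0 : k 0).
Hypothesis kD : forall x y, k x -> k y -> k (x + y).
Hypothesis kM : forall x y, k x -> k y -> k (x * y).

Lemma overD n (p q : {mpoly algC[n]}) : over k p -> over k q -> over k (p + q).
Proof. by move=> hp hq m; rewrite mcoeffD; apply: kD. Qed.

Lemma over0 n : over k (0 : {mpoly algC[n]}).
Proof. by move=> m; rewrite mcoeff0. Qed.

Lemma over_sum n (I : Type) (r : seq I) (P : pred I) (F : I -> {mpoly algC[n]}) :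
  (forall i, P i -> over k (F i)) -> over k (\sum_(i <- r | P i) F i).
Proof.
by move=> hF; apply: (big_ind (@Pilot.Defs.over k n)) => //; [apply: over0|apply: overD].
Qed.

Lemma overM n (p q : {mpoly algC[n]}) : over k p -> over k q -> over k (p * q).
Proof.
move=> hp hq m; rewrite mcoeffM; apply: (big_ind k) => // a _; exact: kM.
Qed.

Lemma overX n m : over k ('X_[m] : {mpoly algC[n]}).
Proof. by move=> m'; rewrite mcoeffX; case: eqP. Qed.

Lemma overZ n c (p : {mpoly algC[n]}) : k c -> over k p -> over k (c *: p).
Proof. by move=> kc hp m; rewrite mcoeffZ; apply: kM. Qed.

Lemma over_prod n (I : Type) (r : seq I) (P : pred I) (F : I -> {mpoly algC[n]}) :
  (forall i, P i -> over k (F i)) -> over k (\prod_(i <- r | P i) F i).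
Proof.
move=> hF; apply: (big_ind (@Pilot.Defs.over k n)) => //; last exact: overM.
by rewrite -mpolyX0; apply: overX.
Qed.

Definition comp_form n m (p : {mpoly algC[m]}) (F : 'I_m -> {mpoly algC[n]}) :=
  p \mPo [tuple F i | i < m].

Lemma comp_formE n m (p : {mpoly algC[m]}) (F : 'I_m -> {mpoly algC[n]}) :
  comp_form p F = \sum_(x <- msupp p) p@_x *: \prod_i F i ^+ x i.
Proof.
rewrite /comp_form comp_mpolyEX; apply: eq_bigr => x _; congr (_ *: _).
by rewrite comp_mpolyX; apply: eq_bigr => i _; rewrite tnth_mktuple.
Qed.

Lemma over_comp_form n m (p : {mpoly algC[m]}) (F : 'I_m -> {mpoly algC[n]}) :
  over k p -> (forall i, over k (F i)) -> over k (comp_form p F).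
Proof.
move=> hp hF; rewrite comp_formE; apply: over_sum => x _; apply: overZ => //.
apply: over_prod => i _; elim: (x i) => [|e IH].
  by rewrite expr0 -mpolyX0; apply: overX.
by rewrite exprS; apply: overM.
Qed.

Lemma dhomog_comp_form n m d e (p : {mpoly algC[m]}) (F : 'I_m -> {mpoly algC[n]}) :
  p \is e.-homog -> (forall i, F i \is d.-homog) -> comp_form p F \is (e * d)%N.-homog.
Proof.
move=> /dhomogP hp hF; rewrite comp_formE big_seq; apply: rpred_sum => x /hp /= hx.
rewrite dhomogZ // -hx mdegE big_distrl /=.
elim/big_ind2: _ => [|a a' p1 p2 h1 h2|i _]; first exact: dhomog1.
  exact: dhomogM.
exact: dhomogXn.
Qed.

Lemma meval_comp_form n m (p : {mpoly algC[m.+1]}) (F : 'I_m.+1 -> {mpoly algC[n.+1]}) (u : 'rV_n.+1) :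
  (comp_form p F).@[u 0] = p.@[eval_forms F u 0].
Proof.
rewrite comp_formE meval_sum mevalE; apply: eq_bigr => x _.
rewrite mevalZ meval_prod; congr (_ * _); apply: eq_bigr => i _.
by rewrite rmorphXn mxE.
Qed.

Lemma eval_formsZ n m (F : 'I_m.+1 -> {mpoly algC[n.+1]}) d c u :
  (forall j, F j \is d.-homog) -> eval_forms F (c *: u) = c ^+ d *: eval_forms F u.
Proof. by move=> hF; apply/rowP => j; rewrite !mxE (meval_dhomogZ _ _ (hF j)). Qed.

Lemma morphism_peq n m V W (f : 'rV[algC]_n.+1 -> 'rV[algC]_m.+1) u v :
  morphism k V W f -> V u -> V v -> peq u v -> peq (f u) (f v).
Proof.
move=> [_ loc] Vu Vv [c c0 vE]; have [F [[d hF] Fu Ff]] := loc u Vu.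
have Fv : eval_forms F v = c ^+ d *: eval_forms F u.
  by rewrite vE (@eval_formsZ _ _ _ d) // => j; case: (hF j).
apply: peq_trans (peq_sym (Ff u Vu Fu)) _.
apply: peq_trans (Ff v Vv _); last by rewrite Fv scaler_eq0 negb_or expf_neq0.
by exists (c ^+ d); rewrite ?expf_neq0.
Qed.

(* The factor F j makes the composite vanish wherever F does, even if the forms
   F' are constants. *)
Lemma morphism_comp n m l V W U (f : 'rV[algC]_n.+1 -> 'rV[algC]_m.+1)
    (g : 'rV[algC]_m.+1 -> 'rV[algC]_l.+1) :
  morphism k V W f -> morphism k W U g -> morphism k V U (g \o f).
Proof.
move=> [fV locf] [gW locg]; split=> [v /fV/gW//|v Vv].
have [F [[d hF] Fv Ff]] := locf v Vv; have [F' [[e hF'] F'v F'g]] := locg _ (fV v Vv).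
have [j Fj] := (rV_neq0P _).1 Fv; rewrite mxE in Fj.
have F'Z c x : eval_forms F' (c *: x) = c ^+ e *: eval_forms F' x.
  by apply: eval_formsZ => i; case: (hF' i).
have HE u : eval_forms (fun i => F j * comp_form (F' i) F) u =
    (F j).@[u 0] *: eval_forms F' (eval_forms F u).
  by apply/rowP => i; rewrite !mxE mevalM meval_comp_form.
exists (fun i => F j * comp_form (F' i) F); split.
- exists (d + e * d)%N => i; split.
    apply: dhomogM; first by case: (hF j).
    by apply: dhomog_comp_form => [|i']; [case: (hF' i)|case: (hF i')].
  apply: overM; first by case: (hF j).
  by apply: over_comp_form => [|i']; [case: (hF' i)|case: (hF i')].
- have [c c0 fE] := Ff v Vv Fv.
  rewrite HE scaler_eq0 negb_or Fj /=; apply: contraNneq F'v => h.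
  by rewrite fE F'Z h scaler0.
move=> u Vu; rewrite HE scaler_eq0 negb_or => /andP[Fju F'u].
have [c c0 fE] : peq (eval_forms F u) (f u).
  by apply: Ff => //; apply/rV_neq0P; exists j; rewrite mxE.
apply: (@peq_trans _ _ (eval_forms F' (f u))).
  exists (c ^+ e / (F j).@[u 0]); first by rewrite mulf_neq0 ?expf_neq0 ?invr_eq0.
  by rewrite fE F'Z scalerA mulfVK.
apply: F'g; first exact: fV.
by rewrite fE F'Z scaler_eq0 negb_or expf_neq0.
Qed.

Lemma isomorphic_trans n m l (V : 'rV[algC]_n.+1 -> Prop) (W : 'rV[algC]_m.+1 -> Prop)
    (U : 'rV[algC]_l.+1 -> Prop) :
  isomorphic k V W -> isomorphic k W U -> isomorphic k V U.
Proof.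
move=> [f1 [g1 [mf1 mg1 gf1 fg1]]] [f2 [g2 [mf2 mg2 gf2 fg2]]].
exists (f2 \o f1), (g1 \o g2); split.
- exact: morphism_comp mf1 mf2.
- exact: morphism_comp mg2 mg1.
- move=> v Vv /=; have Wf := mf1.1 v Vv; apply: peq_trans (gf1 v Vv) _.
  by apply: (morphism_peq mg1) => //; [apply/mg2.1/mf2.1|apply: gf2].
- move=> w Uw /=; have Wg := mg2.1 w Uw; apply: peq_trans (fg2 w Uw) _.
  by apply: (morphism_peq mf2) => //; [apply/mf1.1/mg1.1|apply: fg1].
Qed.

Lemma linear_morphism n m (V : 'rV[algC]_n.+1 -> Prop) (W : 'rV[algC]_m.+1 -> Prop)
    (A : 'M[algC]_(n.+1, m.+1)) :
  (forall i j, k (A i j)) -> (forall v, V v -> W (v *m A)) ->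
  (forall v, V v -> v *m A != 0) -> morphism k V W (mulmx^~ A).
Proof.
move=> kA VW A0; split=> // v Vv.
pose F j : {mpoly algC[n.+1]} := \sum_i A i j *: 'X_i.
have FE u : eval_forms F u = u *m A.
  apply/rowP => j; rewrite !mxE meval_sum; apply: eq_bigr => i _.
  by rewrite mevalZ mevalXU mulrC.
exists F; split.
- exists 1%N => j; split; first by apply: rpred_sum => i _; rewrite dhomogZ // dhomogXU.
  by apply: over_sum => i _; apply: overZ => //; apply: overX.
- by rewrite FE A0.
by move=> u Vu _; rewrite FE; apply: peq_refl.
Qed.

Lemma linear_isomorphic n m (V : 'rV[algC]_n.+1 -> Prop) (W : 'rV[algC]_m.+1 -> Prop)
    (A : 'M[algC]_(n.+1, m.+1)) (B : 'M[algC]_(m.+1, n.+1)) :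
  (forall i j, k (A i j)) -> (forall i j, k (B i j)) ->
  (forall v, V v -> v != 0) -> (forall w, W w -> w != 0) ->
  (forall v, V v -> W (v *m A)) -> (forall w, W w -> V (w *m B)) ->
  (forall v, V v -> v *m A *m B = v) -> (forall w, W w -> w *m B *m A = w) ->
  isomorphic k V W.
Proof.
move=> kA kB V0 W0 VW WV AB BA; exists (mulmx^~ A), (mulmx^~ B); split.
- by apply: linear_morphism => // v /VW/W0.
- by apply: linear_morphism => // w /WV/V0.
- by move=> v Vv /=; rewrite AB //; apply: peq_refl.
- by move=> w Ww /=; rewrite BA //; apply: peq_refl.
Qed.

End Forms.

Lemma isomorphic_sym k n m (V : 'rV[algC]_n.+1 -> Prop) (W : 'rV[algC]_m.+1 -> Prop) :
  isomorphic k V W -> isomorphic k W V.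
Proof. by move=> [f [g [mf mg gf fg]]]; exists g, f. Qed.

Lemma isomorphic_weaken (k k' : algC -> Prop) n m (V : 'rV[algC]_n.+1 -> Prop)
    (W : 'rV[algC]_m.+1 -> Prop) :
  (forall x, k x -> k' x) -> isomorphic k V W -> isomorphic k' V W.
Proof.
move=> kk'.
have weak n' m' V' W' (h : 'rV_n'.+1 -> 'rV_m'.+1) :
    morphism k V' W' h -> morphism k' V' W' h.
  move=> [hV loc]; split=> // v /loc[F [[d hF] Fv Fh]]; exists F; split=> //.
  by exists d => j; have [? ov] := hF j; split=> // x; apply: kk'.
by move=> [f [g [mf mg gf fg]]]; exists f, g; split=> //; apply: weak.
Qed.

Lemma proportional_trans n m (V : 'rV[algC]_n -> Prop) (F G H : 'I_m -> {mpoly algC[n]}) :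
  prime_set V -> (exists j, ~ vanishes V (F j)) ->
  proportional V G F -> proportional V H F -> proportional V G H.
Proof.
move=> prV [l Fl] GF HF i j.
apply: (prime_setP prV (not_vanishesM prV Fl Fl)) => u Vu.
have GE i' : (G i').@[u 0] * (F l).@[u 0] = (G l).@[u 0] * (F i').@[u 0].
  by have /eqP := GF i' l u Vu; rewrite mevalB !mevalM subr_eq0 => /eqP.
have HE i' : (H i').@[u 0] * (F l).@[u 0] = (H l).@[u 0] * (F i').@[u 0].
  by have /eqP := HF i' l u Vu; rewrite mevalB !mevalM subr_eq0 => /eqP.
rewrite !mevalM mevalB !mevalM.
transitivity (((G i).@[u 0] * (F l).@[u 0]) * ((H j).@[u 0] * (F l).@[u 0]) -
  ((G j).@[u 0] * (F l).@[u 0]) * ((H i).@[u 0] * (F l).@[u 0])); first by ring.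
by rewrite !GE !HE; ring.
Qed.

Lemma proportional_scale n m (V : 'rV[algC]_n.+1 -> Prop)
    (F G : 'I_m.+1 -> {mpoly algC[n.+1]}) u :
  proportional V G F -> V u -> eval_forms F u != 0 ->
  exists c, eval_forms G u = c *: eval_forms F u.
Proof.
move=> GF Vu /rV_neq0P[l]; rewrite mxE => Fl; exists ((G l).@[u 0] / (F l).@[u 0]).
apply/rowP => i; rewrite !mxE mulrAC; apply: (mulIf Fl); rewrite mulfVK //.
by have /eqP := GF i l u Vu; rewrite mevalB !mevalM subr_eq0 => /eqP.
Qed.

Definition regular_curve n (s : seq {mpoly algC[n.+1]}) : Prop :=
  [/\ forall q, q \in s -> homogeneous q /\ over rationals q,
      smooth_along s, prime_set (locus s) & functions_dependent (locus s)].

(** Each point receives its own forms. Two choices are proportional by primality, hence agree up to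
    a scalar where both are nonzero. The values stay on the target because its equations, composed
    with the forms, vanish wherever F does not, and so on the whole source. *)
Lemma rational_map_morphism n m (s : seq {mpoly algC[n.+1]}) (r : seq {mpoly algC[m.+1]})
    (F : 'I_m.+1 -> {mpoly algC[n.+1]}) :
  regular_curve s -> (forall q, q \in r -> homogeneous q) ->
  forms_over rationals F -> (exists2 u, locus s u & eval_forms F u != 0) ->
  (forall u, locus s u -> eval_forms F u != 0 -> locus r (eval_forms F u)) ->
  exists f, morphism rationals (locus s) (locus r) f /\
    forall v, locus s v -> exists G, [/\ forms_over rationals G,
      proportional (locus s) G F, eval_forms G v != 0 & f v = eval_forms G v].
Proof.
move=> [hs sm prX depX] hr hF [u0 Xu0 Fu0] Fr.
have [l Fl] : exists l, ~ vanishes (locus s) (F l).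
  move/rV_neq0P: Fu0 => [l]; rewrite mxE => Fl; exists l.
  by apply/not_vanishesP; exists u0.
have /choice_fun[G hG] : forall v, exists G, locus s v ->
    [/\ forms_over rationals G, proportional (locus s) G F & eval_forms G v != 0].
  move=> v; have [Xv|nXv] := classic (locus s v); last by exists F.
  have [G hG] := rational_map_extends hs sm prX depX hF (ex_intro _ l Fl) Xv.
  by exists G.
have Gr H v : proportional (locus s) H F -> locus s v -> eval_forms H v != 0 ->
    locus r (eval_forms H v).
  move=> HF Xv Hv; split=> // q qr; have [e hq] := hr q qr.
  rewrite -meval_comp_form; suff : vanishes (locus s) (comp_form q H) by apply.
  apply: (prime_setP prX Fl) => u Xu.
  rewrite mevalM meval_comp_form.
  have [->|Flu] := eqVneq (F l).@[u 0] 0; first by rewrite mul0r.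
  have Fu : eval_forms F u != 0 by apply/rV_neq0P; exists l; rewrite mxE.
  have [c ->] := proportional_scale HF Xu Fu.
  by rewrite (meval_dhomogZ _ _ hq) (Fr u Xu Fu).2 // !mulr0.
exists (fun v => eval_forms (G v) v); split; last first.
  by move=> v Xv; have [h1 h2 h3] := hG v Xv; exists (G v).
split=> v Xv; have [Gover GF Gv] := hG v Xv.
  exact: Gr.
exists (G v); split=> // u Xu Gvu; have [_ GuF Gu] := hG u Xu.
have GG := proportional_trans prX (ex_intro _ l Fl) GF GuF.
apply: peq_cross => // i j; rewrite !mxE.
by have /eqP := GG i j u Xu; rewrite mevalB !mevalM subr_eq0 => /eqP.
Qed.

(** Where F and the composite of G with F are defined, the composite of G' with F' is a multiple of
    the identity. This is expressed by the vanishing of 2 by 2 minors, which primality extends to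
    the whole locus. *)
Lemma inverse_extends n m (s : seq {mpoly algC[n.+1]}) (r : seq {mpoly algC[m.+1]})
    (F F' : 'I_m.+1 -> {mpoly algC[n.+1]}) (G G' : 'I_n.+1 -> {mpoly algC[m.+1]}) u v :
  prime_set (locus s) -> proportional (locus s) F' F -> proportional (locus r) G' G ->
  forms_over rationals G' ->
  (forall u, locus s u -> eval_forms F u != 0 -> locus r (eval_forms F u)) ->
  (forall u, locus s u -> eval_forms F u != 0 -> eval_forms G (eval_forms F u) != 0 ->
    peq u (eval_forms G (eval_forms F u))) ->
  locus s u -> eval_forms F u != 0 -> eval_forms G (eval_forms F u) != 0 ->
  locus s v -> eval_forms G' (eval_forms F' v) != 0 ->
  peq v (eval_forms G' (eval_forms F' v)).
Proof.
move=> prX F'F G'G [e hG'] Fr GF Xu Fu GFu Xv G'v.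
apply: peq_cross => //; first by case: Xv.
move=> i j; move/rV_neq0P: (Fu) => [a]; rewrite mxE => Fa.
move/rV_neq0P: (GFu) => [b]; rewrite mxE => Gb.
have TX : ~ vanishes (locus s) (F a * comp_form (G b) F).
  by apply/not_vanishesP; exists u => //; rewrite mevalM meval_comp_form mulf_neq0.
suff : vanishes (locus s) ('X_i * comp_form (G' j) F' - 'X_j * comp_form (G' i) F').
  move=> /(_ v Xv)/eqP; rewrite mevalB !mevalM !mevalXU !meval_comp_form subr_eq0 !mxE.
  by move/eqP.
apply: (prime_setP prX TX) => x Xx; rewrite mevalM.
have [->|] := eqVneq (F a * comp_form (G b) F).@[x 0] 0; first by rewrite mul0r.
rewrite mevalM meval_comp_form mulf_eq0 negb_or => /andP[Fax Gbx].
have Fx : eval_forms F x != 0 by apply/rV_neq0P; exists a; rewrite mxE.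
have GFx : eval_forms G (eval_forms F x) != 0 by apply/rV_neq0P; exists b; rewrite mxE.
have [c _ xE] := GF x Xx Fx GFx.
have [c1 F'E] := proportional_scale F'F Xx Fx.
have [c2 G'E] := proportional_scale G'G (Fr x Xx Fx) GFx.
have E : eval_forms G' (eval_forms F' x) = (c1 ^+ e * c2 * c) *: x.
  rewrite F'E (@eval_formsZ _ _ _ e) => [|j']; last by case: (hG' j').
  by rewrite G'E xE !scalerA.
rewrite mevalB !mevalM !mevalXU !meval_comp_form.
have E' y : (G' y).@[eval_forms F' x 0] = c1 ^+ e * c2 * c * x 0 y.
  by have /rowP/(_ y) := E; rewrite !mxE.
by rewrite !E'; ring.
Qed.

Lemma birational_isomorphic n m (s : seq {mpoly algC[n.+1]}) (r : seq {mpoly algC[m.+1]})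
    (F : 'I_m.+1 -> {mpoly algC[n.+1]}) (G : 'I_n.+1 -> {mpoly algC[m.+1]}) :
  regular_curve s -> regular_curve r -> forms_over rationals F -> forms_over rationals G ->
  (forall u, locus s u -> eval_forms F u != 0 -> locus r (eval_forms F u)) ->
  (forall w, locus r w -> eval_forms G w != 0 -> locus s (eval_forms G w)) ->
  (forall u, locus s u -> eval_forms F u != 0 -> eval_forms G (eval_forms F u) != 0 ->
    peq u (eval_forms G (eval_forms F u))) ->
  (forall w, locus r w -> eval_forms G w != 0 -> eval_forms F (eval_forms G w) != 0 ->
    peq w (eval_forms F (eval_forms G w))) ->
  (exists u, [/\ locus s u, eval_forms F u != 0 & eval_forms G (eval_forms F u) != 0]) ->
  (exists w, [/\ locus r w, eval_forms G w != 0 & eval_forms F (eval_forms G w) != 0]) ->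
  isomorphic rationals (locus s) (locus r).
Proof.
move=> regs regr hF hG Fr Gs GF FG [u [Xu Fu GFu]] [w [Yw Gw FGw]].
have [hs _ prX _] := regs; have [hr _ prY _] := regr.
have hs' q qs := (hs q qs).1; have hr' q qr := (hr q qr).1.
have [f [mf locf]] := rational_map_morphism regs hr' hF (ex_intro2 _ _ u Xu Fu) Fr.
have [g [mg locg]] := rational_map_morphism regr hs' hG (ex_intro2 _ _ w Yw Gw) Gs.
exists f, g; split=> // [v Xv|v Yv].
  have [F' [_ F'F _ fE]] := locf v Xv; have [G' [hG' G'G G'v gE]] := locg _ (mf.1 v Xv).
  rewrite gE fE in G'v *.
  exact: (inverse_extends prX F'F G'G hG' Fr GF Xu Fu GFu).
have [G' [_ G'G _ gE]] := locg v Yv; have [F' [hF' F'F F'v fE]] := locf _ (mg.1 v Yv).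
rewrite fE gE in F'v *.
exact: (inverse_extends prY G'G F'F hF' Gs FG Yw Gw FGw).
Qed.

(** * The Kummer curve *)

Definition at_inner (c : algC) (P : {poly {poly algC}}) : {poly algC} :=
  map_poly (horner_eval c) P.

Lemma coef_at_inner c (P : {poly {poly algC}}) i : (at_inner c P)`_i = (P`_i).[c].
Proof. by rewrite coef_map. Qed.

Lemma at_innerM c (P Q : {poly {poly algC}}) :
  at_inner c (P * Q) = at_inner c P * at_inner c Q.
Proof. exact: rmorphM. Qed.

Lemma at_inner_eq0 c (P : {poly {poly algC}}) : at_inner c P = 0 ->
  exists P', P = ('X - c%:P) *: P'.
Proof.
move=> P0; exists (\poly_(i < size P) (P`_i %/ ('X - c%:P))).
apply/polyP => i; rewrite coefZ coef_poly; case: ltnP => hi; last first.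
  by rewrite mulr0 nth_default.
rewrite mulrC divpK // dvdp_XsubCl; apply/rootP.
by rewrite -coef_at_inner P0 coef0.
Qed.

Lemma linear_factor (k : {poly algC}) : k != 0 -> size k != 1%N ->
  exists c k', [/\ k = ('X - c%:P) * k', k' != 0 & (size k' < size k)%N].
Proof.
move=> k0 /closed_rootP[c]; rewrite root_factor_theorem => /dvdpP[k' kE].
have k'0 : k' != 0 by apply: contraNneq k0 => k'0; rewrite kE k'0 mul0r.
exists c, k'; split=> //; first by rewrite mulrC.
by rewrite kE size_mul ?polyXsubC_eq0 // size_XsubC addn2.
Qed.

Section Primitive.

Variable E : {poly {poly algC}}.
Hypothesis E_primitive : forall c, at_inner c E != 0.

(** Gauss's lemma: at a root c of k the product W E vanishes and E does not, so 'X - c divides W and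
    can be cancelled. The induction is on the size of k. *)
Lemma primitive_dvdp (k : {poly algC}) (P W : {poly {poly algC}}) : k != 0 -> k *: P = W * E ->
  exists W', P = W' * E.
Proof.
have [m] := ubnP (size k); elim: m => // m IH in k W *; rewrite ltnS => km k0 e.
have [/eqP/size_poly1P[x x0 kE]|/linear_factor[//|c [k' [kE k'0 k'k]]]] := eqVneq (size k) 1%N.
  exists (x^-1%:P *: W); rewrite -scalerAl -e kE scalerA -polyCM mulVf //.
  by rewrite scale1r.
have : at_inner c W * at_inner c E = 0.
  rewrite -at_innerM -e; apply/polyP => i.
  by rewrite coef_at_inner coefZ kE !hornerM hornerXsubC subrr !mul0r coef0.
move/eqP; rewrite mulf_eq0 (negPf (E_primitive c)) orbF => /eqP/at_inner_eq0[W' WE].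
apply: (IH k' W') => //; first exact: leq_trans k'k km.
have XcI : injective (fun p : {poly {poly algC}} => ('X - c%:P) *: p).
  by move=> p q; rewrite -!mul_polyC; apply: mulfI; rewrite polyC_eq0 polyXsubC_eq0.
apply: XcI; rewrite scalerA -kE e WE -scalerAl.
by [].
Qed.

(** The roots of k are removed one at a time, each linear factor dividing P or Q; being constant in
    the outer variable, it leaves the sizes unchanged. *)
Lemma primitive_factor (k : {poly algC}) (P Q : {poly {poly algC}}) : k != 0 -> k *: E = P * Q ->
  exists P' Q', [/\ E = P' * Q', size P' = size P & size Q' = size Q].
Proof.
have [m] := ubnP (size k); elim: m => // m IH in k P Q *; rewrite ltnS => km k0 e.
have [/eqP/size_poly1P[x x0 kE]|/linear_factor[//|c [k' [kE k'0 k'k]]]] := eqVneq (size k) 1%N.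
  exists (x^-1%:P *: P), Q; split=> //.
    by rewrite -scalerAl -e kE scalerA -polyCM mulVf // scale1r.
  by rewrite size_scale // polyC_eq0 invr_eq0.
have XcI : injective (fun p : {poly {poly algC}} => ('X - c%:P) *: p).
  by move=> p q; rewrite -!mul_polyC; apply: mulfI; rewrite polyC_eq0 polyXsubC_eq0.
have : at_inner c P * at_inner c Q = 0.
  rewrite -at_innerM -e; apply/polyP => i.
  by rewrite coef_at_inner coefZ kE !hornerM hornerXsubC subrr !mul0r coef0.
move/eqP; rewrite mulf_eq0 => /orP[] /eqP/at_inner_eq0[P' PE].
  have [|||P1 [Q1 [EE sP sQ]]] := IH k' P' Q => //; first exact: leq_trans k'k km.
    by apply: XcI; rewrite scalerA -kE e PE -scalerAl.
  by exists P1, Q1; split=> //; rewrite sP PE size_scale // polyXsubC_eq0.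
have [|||P1 [Q1 [EE sP sQ]]] := IH k' P P' => //; first exact: leq_trans k'k km.
  by apply: XcI; rewrite scalerA -kE e PE -scalerAr.
by exists P1, Q1; split=> //; rewrite sQ PE size_scale // polyXsubC_eq0.
Qed.

End Primitive.

(* The generic point of the model below is (a c : a^3 : - c : a^2) where
   (c + 1) a^5 = c^2 (c - 1); the outer variable is a, the inner one c. *)
Definition kummer : {poly {poly algC}} := ('X + 1) *: 'X^5 - ('X^2 * ('X - 1))%:P.

Lemma horner_kummer a c : kummer.[a%:P].[c] = (c + 1) * a ^+ 5 - c ^+ 2 * (c - 1).
Proof. by rewrite /kummer !hornerE. Qed.

Lemma size_kummer : size kummer = 6%N.
Proof.
have X1 : 'X + 1 != 0 :> {poly algC} by rewrite -size_poly_eq0 size_XaddC.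
rewrite /kummer size_polyDl size_scale ?size_polyXn // size_polyN.
by apply: leq_ltn_trans (size_polyC_leq1 _) _.
Qed.

Lemma kummer_primitive c : at_inner c kummer != 0.
Proof.
apply/eqP => /polyP e; have := e 5%N; have := e 0%N.
rewrite !coef_at_inner /kummer !coefB !coefZ !coefXn !coefC /= !mulr0 !mulr1 subr0 ?coef0.
rewrite sub0r !hornerE => e0 /eqP; rewrite addr_eq0 => /eqP c1.
move/eqP: e0; rewrite c1; apply/negP.
rewrite (_ : - _ = 2%:R); last by ring.
by rewrite Num.Theory.pnatr_eq0.
Qed.

(* Eisenstein's criterion at c = 1. *)
Lemma kummer_irreducible P Q : kummer = P * Q -> size P = 1%N \/ size Q = 1%N.
Proof.
move=> e; have K0 : kummer != 0 by rewrite -size_poly_eq0 size_kummer.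
have [P0 Q0] : P != 0 /\ Q != 0.
  by move: K0; rewrite e mulf_eq0 => /norP.
(* The degree in a does not drop at c = 1, so P and Q reduce to monomials of their own degrees. If
   both degrees were positive, both constant terms would vanish at c = 1, and - c^2 (c - 1) would
   have a double zero there, whereas its derivative is -1. *)
have K1 : at_inner 1%R kummer = 2%:R *: 'X^5.
  apply/polyP => i; rewrite coef_at_inner /kummer coefB !coefZ !coefXn coefC !hornerE.
  by case: i => [|[|[|[|[|[|i]]]]]] /=; rewrite ?hornerE; ring.
have eQ : at_inner 1%R P * at_inner 1%R Q = 2%:R *: 'X^5 by rewrite -at_innerM -e.
have two0 : 2%:R != 0 :> algC by rewrite Num.Theory.pnatr_eq0.
have [P1 Q1] : at_inner 1%R P != 0 /\ at_inner 1%R Q != 0.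
  by apply/norP; rewrite -mulf_eq0 -at_innerM -e kummer_primitive.
have size_inner R : (size (at_inner 1%R R) <= size R)%N by apply: size_poly.
have sz : (size (at_inner 1%R P) + size (at_inner 1%R Q) = size P + size Q)%N.
  have := congr1 (fun p : {poly algC} => size p) eQ; rewrite size_mul // size_scale // size_polyXn => e1.
  have := size_kummer; rewrite e size_mul // => e2.
  have eq7 (x y : nat) : (x + y).-1 = 6%N -> (x + y)%N = 7%N by case: (x + y)%N => //= k ->.
  by rewrite (eq7 _ _ e1) (eq7 _ _ e2).
have [szP szQ] : size (at_inner 1%R P) = size P /\ size (at_inner 1%R Q) = size Q.
  by have := size_inner P; have := size_inner Q; lia.
have root0 R S : at_inner 1%R R * at_inner 1%R S = 2%:R *: 'X^5 ->
    size (at_inner 1%R R) != 1%N -> (R`_0).[1] = 0.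
  move=> eR /closed_rootP[x xR].
  have : (at_inner 1%R R * at_inner 1%R S).[x] = 0 by rewrite hornerM (rootP xR) mul0r.
  rewrite eR hornerZ hornerXn => /eqP; rewrite mulf_eq0 (negPf two0) expf_eq0 /= => /eqP x0.
  by rewrite -coef_at_inner -horner_coef0 -x0 (rootP xR).
apply: NNPP => /not_or_and[sP sQ].
have hP : (P`_0).[1] = 0 by apply: (root0 P Q); rewrite // szP; apply/eqP.
have hQ : (Q`_0).[1] = 0 by apply: (root0 Q P); rewrite 1?mulrC // szQ; apply/eqP.
have : kummer`_0 = P`_0 * Q`_0 by rewrite e coef0M.
move/(congr1 (fun p => p^`().[1])); rewrite derivM hornerD !hornerM hP hQ mul0r mulr0 addr0.
rewrite /kummer coefB coefZ coefXn coefC /= mulr0 sub0r.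
rewrite !derivE !hornerE /=; apply/eqP.
by rewrite subrr mulr0 add0r expr1n subr0 mul1r oppr_eq0 oner_neq0.
Qed.

(** Over the ring of polynomials in c, division and gcd are taken up to nonzero inner factors, that
    is over the field of rational functions of c; the two preceding lemmas remove these factors. *)
Lemma kummer_coprime_or_divides (P : {poly {poly algC}}) :
  coprimep kummer P \/ exists W, P = W * kummer.
Proof.
set g := gcdp kummer P.
have /Pdiv.Idomain.dvdpP[[k h] /= k0 e] : g %| kummer by apply: dvdp_gcdl.
have [h' [g' [e' sh sg]]] := primitive_factor k0 e.
have [h1|g1] := kummer_irreducible e'; last first.
  by left; rewrite coprimep_def -/g -sg g1.
right; have /Pdiv.Idomain.dvdpP[[k2 h2] /= k20 e2] : g %| P by apply: dvdp_gcdr.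
move: h1; rewrite sh => /eqP/size_poly1P[x x0 hE].
apply: (@primitive_dvdp _ kummer_primitive (x * k2) _ (k *: h2)).
  by rewrite mulf_neq0.
by rewrite -scalerA e2 -scalerAl [RHS]scalerAr e hE mul_polyC [LHS]scalerAr.
Qed.

Lemma nonroot (p : {poly algC}) : p != 0 -> exists c, p.[c] != 0.
Proof.
move=> p0; apply: NNPP => /not_ex_all_not h; move/eqP: p0; apply.
by apply: poly_eq0_of_nonzero_roots => c _; apply/eqP/negPn/negP/h.
Qed.

(** If [kummer] were coprime to both, a Bezout identity would give a nonzero polynomial in c alone
    vanishing at every point of the curve with a nonzero. But almost every c carries such a
    point. *)
Lemma kummer_prime (P Q : {poly {poly algC}}) :
  (forall a c, a != 0 -> kummer.[a%:P].[c] = 0 -> (P * Q).[a%:P].[c] = 0) ->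
  (exists W, P = W * kummer) \/ (exists W, Q = W * kummer).
Proof.
move=> PQ0.
have [coP|] := kummer_coprime_or_divides P; last by left.
have [coQ|] := kummer_coprime_or_divides Q; last by right.
have : coprimep kummer (P * Q) by rewrite coprimepMr coP.
move=> /Pdiv.Idomain.Bezout_coprimepP[[U V] /= /Pdiv.Idomain.eqpP[[k1 k2] /= /andP[k10 k20] e]].
have X1 : 'X + 1 != 0 :> {poly algC} by rewrite -size_poly_eq0 size_XaddC.
have X2 : 'X - 1 != 0 :> {poly algC} by rewrite -size_poly_eq0 size_XsubC.
(* The values 0, -1 and 1 are the zeros and poles of a^5 as a function of c. *)
have : k2 * ('X * ('X + 1) * ('X - 1)) != 0 by rewrite !mulf_neq0 // polyX_eq0.
move=> /nonroot[c]; rewrite !hornerE !mulf_eq0 !negb_or -!andbA.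
move=> /and4P[k2c c0 c1 c2].
have [a aE] : exists a, a ^+ 5 = c ^+ 2 * (c - 1) / (c + 1).
  have /closed_rootP[a] : size ('X^5 - (c ^+ 2 * (c - 1) / (c + 1))%:P) != 1%N.
    by rewrite size_XnsubC.
  rewrite /root !hornerE subr_eq0 => /eqP aE; by exists a.
have Ea : kummer.[a%:P].[c] = 0.
  by rewrite horner_kummer aE mulrC divfK // subrr.
have a0 : a != 0.
  have : a ^+ 5 != 0 by rewrite aE !mulf_neq0 ?invr_eq0 ?expf_neq0.
  by rewrite expf_eq0.
have := PQ0 a c a0 Ea; rewrite !hornerM => PQac.
move: (kummer) Ea e => K Ka /(congr1 (fun p => p.[a%:P].[c])).
rewrite !(hornerZ, hornerD, hornerM, hornerC) Ka PQac !mulr0 addr0 mulr0 mulr1 => k2c0.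
by rewrite -k2c0 eqxx in k2c.
Qed.

(** * The canonical model *)

Definition vec n (s : seq algC) : 'rV[algC]_n.+1 := \row_i s`_i.

Lemma vecE n s k : (k < n.+1)%N -> vec n s 0 (inord k) = s`_k.
Proof. by move=> kn; rewrite mxE inordK. Qed.

Lemma row_inordP n (u v : 'rV[algC]_n.+1) :
  (forall k, (k < n.+1)%N -> u 0 (inord k) = v 0 (inord k)) -> u = v.
Proof. by move=> e; apply/rowP => i; rewrite -[i]inord_val; apply: e. Qed.

Lemma vec_neq0 n s k : (k < n.+1)%N -> s`_k != 0 -> vec n s != 0.
Proof. by move=> kn sk; apply/rV_neq0P; exists (inord k); rewrite vecE. Qed.

Definition var n (k : nat) : {mpoly algC[n.+1]} := 'X_(inord k).

Lemma meval_var n k (v : 'rV[algC]_n.+1) : (var n k).@[v 0] = v 0 (inord k).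
Proof. exact: mevalXU. Qed.

Lemma dhomog_var n k : var n k \is 1.-homog.
Proof. exact: dhomogXU. Qed.

Lemma over_var n k : over rationals (var n k).
Proof. by apply/over_rationals; rewrite mpolyOverX. Qed.

(* The canonical model of Hulek-Craig's curve: the coordinates y_1, ..., y_4
   (of index 0, ..., 3) are those of Bring's curve in which the 5-cycle of S_5
   is diagonal. *)
Definition canonical_model : seq {mpoly algC[4]} :=
  let y := var 3 in
  [:: y 0%N * y 3%N + y 1%N * y 2%N;
      y 0%N ^+ 2 * y 2%N + y 0%N * y 1%N ^+ 2 + y 2%N ^+ 2 * y 3%N + y 1%N * y 3%N ^+ 2].

Lemma canonical_modelP v : locus canonical_model v <->
  [/\ v != 0, v 0 (inord 0) * v 0 (inord 3) + v 0 (inord 1) * v 0 (inord 2) = 0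
    & v 0 (inord 0) ^+ 2 * v 0 (inord 2) + v 0 (inord 0) * v 0 (inord 1) ^+ 2
      + v 0 (inord 2) ^+ 2 * v 0 (inord 3) + v 0 (inord 1) * v 0 (inord 3) ^+ 2 = 0].
Proof.
split=> [[v0 vs]|[v0 e1 e2]].
  have [p q] := (vs _ (mem_head _ _), vs _ (mem_last _ _)).
  by split=> //; [rewrite -[RHS]p|rewrite -[RHS]q];
    rewrite !(mevalD, mevalM, rmorphXn) /= !meval_var.
split=> // p; rewrite !inE => /orP[] /eqP->.
  by rewrite !(mevalD, mevalM) !meval_var.
by rewrite !(mevalD, mevalM, rmorphXn) /= !meval_var.
Qed.

Lemma canonical_model_forms q : q \in canonical_model ->
  homogeneous q /\ over rationals q.
Proof.
have h k := dhomog_var 3 k.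
rewrite !inE => /orP[] /eqP->; split.
- by exists 2%N; apply: dhomogD; apply: (dhomogM (h _) (h _)).
- apply/over_rationals; rewrite !(rpredD, rpredM) //; exact/over_rationals/over_var.
- exists 3%N; have h2 k := dhomogXn 2 (h k).
  do 3?[apply: dhomogD]; first [exact: (dhomogM (h2 _) (h _))|exact: (dhomogM (h _) (h2 _))].
- apply/over_rationals; rewrite !(rpredD, rpredM, rpredX) //; exact/over_rationals/over_var.
Qed.

Definition generic_point (a c : algC) : 'rV[algC]_4 := vec 3 [:: a * c; a ^+ 3; - c; a ^+ 2].

Lemma generic_point_canonical a c : a != 0 -> kummer.[a%:P].[c] = 0 ->
  locus canonical_model (generic_point a c).
Proof.
rewrite horner_kummer => a0 e; apply/canonical_modelP; split.
- by apply: (@vec_neq0 _ _ 1) => //=; rewrite expf_neq0.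
- by rewrite !vecE //=; ring.
- rewrite !vecE //=; transitivity (a ^+ 2 * ((c + 1) * a ^+ 5 - c ^+ 2 * (c - 1))).
    ring.
  by rewrite e mulr0.
Qed.

(** The part of N covered by [generic_point], up to scalars; its complement consists of the four
    coordinate points. *)
Definition open_part (v : 'rV[algC]_4) :=
  [/\ locus canonical_model v, v 0 (inord 1) != 0 & v 0 (inord 3) != 0].

Lemma open_part_generic v : open_part v ->
  exists a c k, [/\ a != 0, k != 0, kummer.[a%:P].[c] = 0 & v = k *: generic_point a c].
Proof.
move=> [/canonical_modelP[v0 e1 e2] y1 y3].
pose a := v 0 (inord 1) / v 0 (inord 3); pose c := - (v 0 (inord 2) * a ^+ 2 / v 0 (inord 3)).
pose k := v 0 (inord 3) / a ^+ 2.
have a0 : a != 0 by rewrite mulf_neq0 ?invr_eq0.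
have k0 : k != 0 by rewrite mulf_neq0 ?invr_eq0 ?expf_neq0.
have vE : v = k *: generic_point a c.
  apply: row_inordP => -[|[|[|[|//]]]] _; rewrite mxE vecE //=.
  - rewrite /k /c; apply: (mulIf y3).
    move/eqP: e1; rewrite addr_eq0 => /eqP->.
    by rewrite /a; field; rewrite y1 y3.
  - by rewrite /k /a; field; rewrite y1 y3.
  - by rewrite /k /c; field; rewrite a0 y3.
  - by rewrite /k mulfVK ?expf_neq0.
exists a, c, k; split=> //; rewrite horner_kummer.
have ka : k ^+ 3 * a ^+ 2 != 0 by rewrite mulf_neq0 ?expf_neq0.
apply: (mulfI ka); rewrite mulr0 -[RHS]e2.
have vk i : v 0 i = k * generic_point a c 0 i by rewrite {1}vE mxE.
by rewrite !vk !vecE //=; ring.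
Qed.

Lemma pullback (p : {mpoly algC[4]}) : exists P : {poly {poly algC}},
  forall a c, P.[a%:P].[c] = p.@[generic_point a c 0].
Proof.
have [Y YE] : exists Y : 'I_4 -> {poly {poly algC}},
    forall i a c, (Y i).[a%:P].[c] = generic_point a c 0 i.
  exists (fun i => [:: 'X *: 'X; 'X^3; - 'X%:P; 'X^2]`_i) => i a c; rewrite mxE /=.
  by case: i => m /= +; case: m => [|[|[|[|//]]]] _; rewrite /= !hornerE // mulrC.
exists (\sum_(m <- msupp p) (p@_m)%:P%:P * \prod_i Y i ^+ m i) => a c.
rewrite mevalE !horner_sum; apply: eq_bigr => m _.
rewrite !hornerM !hornerC; congr (_ * _); rewrite !horner_prod; apply: eq_bigr => i _.
by rewrite !horner_exp YE.
Qed.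

Lemma generic_open a c : a != 0 -> kummer.[a%:P].[c] = 0 -> open_part (generic_point a c).
Proof.
by move=> a0 e; split; rewrite ?vecE ?expf_neq0 //; apply: generic_point_canonical.
Qed.

Lemma open_part_prime p q : homogeneous p -> homogeneous q ->
  vanishes open_part (p * q) -> vanishes open_part p \/ vanishes open_part q.
Proof.
move=> [d hp] [e hq] pq.
have [[P PE] [Q QE]] := (pullback p, pullback q).
have [a c a0 Eac|[W PW]|[W QW]] := @kummer_prime P Q.
- by rewrite !hornerM PE QE -mevalM; apply/pq/generic_open.
- left=> v /open_part_generic[a [c [k [a0 _ Eac ->]]]].
  by rewrite (meval_dhomogZ _ _ hp) -PE PW !hornerM Eac !mulr0.
- right=> v /open_part_generic[a [c [k [a0 _ Eac ->]]]].
  by rewrite (meval_dhomogZ _ _ hq) -QE QW !hornerM Eac !mulr0.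
Qed.

Definition e_ k : 'rV[algC]_4 := vec 3 [seq (i == k)%:R | i <- iota 0 4].

(* The point (a, c) = (0, 1) of the Kummer model. *)
Lemma open_part_closure2 p : homogeneous p -> vanishes open_part p -> p.@[e_ 2 0] = 0.
Proof.
move=> [d hp] pU; have [P PE] := pullback p.
(* Primality is applied with second factor 1, which is not a multiple of [kummer] since the latter
   vanishes at (0, 1). *)
have [W PW] : exists W, P = W * kummer.
  have [a c a0 Eac|//|[W e]] := @kummer_prime P 1.
    by rewrite mulr1 PE; apply/pU/generic_open.
  have := congr1 (fun R : {poly {poly algC}} => R.[0%:P].[1]) e.
  rewrite !hornerM horner_kummer !hornerC subrr expr0n !mulr0 subrr mulr0 => /eqP.
  by rewrite oner_eq0.
have e2E : e_ 2 = (-1) *: generic_point 0 1.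
  apply: row_inordP => -[|[|[|[|//]]]] _; rewrite [RHS]mxE !vecE //=; ring.
rewrite e2E (meval_dhomogZ _ _ hp) -PE PW !hornerM horner_kummer; ring.
Qed.

(** Multiplication of the index of y_j by 2 modulo 5, an automorphism of N coming from the
    normalizer of the 5-cycle in S_5. It permutes the four coordinate points cyclically, so only one
    of them has to be reached as a limit by hand. *)
Definition rotate_coords (v : 'rV[algC]_4) : 'rV[algC]_4 :=
  vec 3 [:: v 0 (inord 1); v 0 (inord 3); v 0 (inord 0); v 0 (inord 2)].

Definition rotate_form (p : {mpoly algC[4]}) : {mpoly algC[4]} :=
  comp_form p (fun i => [:: var 3 1; var 3 3; var 3 0; var 3 2]`_i).

Lemma meval_rotate_form p (v : 'rV_4) : (rotate_form p).@[v 0] = p.@[rotate_coords v 0].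
Proof.
rewrite meval_comp_form (_ : eval_forms _ v = rotate_coords v) //.
by apply: row_inordP => -[|[|[|[|//]]]] _; rewrite vecE // mxE inordK //= meval_var.
Qed.

Lemma homogeneous_rotate_form p : homogeneous p -> homogeneous (rotate_form p).
Proof.
move=> [d hp]; exists (d * 1)%N; apply: dhomog_comp_form => //.
by move=> i /=; case: i => m /= +; case: m => [|[|[|[|//]]]] _; apply: dhomog_var.
Qed.

Lemma rotate_open v : open_part v -> open_part (rotate_coords v).
Proof.
move=> [/canonical_modelP[v0 e1 e2] y1 y3].
have y2 : v 0 (inord 2) != 0.
  apply/eqP => y2; move: e1 e2; rewrite y2 mulr0 addr0 => /eqP.
  rewrite mulf_eq0 (negPf y3) orbF => /eqP->.
  rewrite expr0n !(mul0r, add0r) /= => /eqP.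
  by rewrite mulf_eq0 expf_eq0 /= (negPf y1) (negPf y3).
split; [apply/canonical_modelP; split|by rewrite vecE|by rewrite vecE].
- by apply: (@vec_neq0 _ _ 0).
- by rewrite !vecE //= -[RHS]e1; ring.
- by rewrite !vecE //= -[RHS]e2; ring.
Qed.

Lemma vanishes_rotate_form p : vanishes open_part p -> vanishes open_part (rotate_form p).
Proof. by move=> pU v /rotate_open/pU; rewrite meval_rotate_form. Qed.

Lemma open_part_closure p k : (k < 4)%N -> homogeneous p -> vanishes open_part p ->
  p.@[e_ k 0] = 0.
Proof.
have rot q i j : homogeneous q -> vanishes open_part q -> e_ j = rotate_coords (e_ i) ->
    (forall r, homogeneous r -> vanishes open_part r -> r.@[e_ i 0] = 0) -> q.@[e_ j 0] = 0.
  move=> hq qU -> h; rewrite -meval_rotate_form; apply: h.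
    exact: homogeneous_rotate_form.
  exact: vanishes_rotate_form.
have e32 : e_ 3 = rotate_coords (e_ 2).
  by apply: row_inordP => -[|[|[|[|//]]]] _; rewrite !vecE.
have e13 : e_ 1 = rotate_coords (e_ 3).
  by apply: row_inordP => -[|[|[|[|//]]]] _; rewrite !vecE.
have e01 : e_ 0 = rotate_coords (e_ 1).
  by apply: row_inordP => -[|[|[|[|//]]]] _; rewrite !vecE.
have h3 q : homogeneous q -> vanishes open_part q -> q.@[e_ 3 0] = 0.
  by move=> hq qU; apply: (rot _ 2%N) => //; apply: open_part_closure2.
have h1 q : homogeneous q -> vanishes open_part q -> q.@[e_ 1 0] = 0.
  by move=> hq qU; apply: (rot _ 3%N).
case: k => [|[|[|[|//]]]] _ hp pU; [|exact: h1|exact: open_part_closure2|exact: h3].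
by apply: (rot _ 1%N).
Qed.

Lemma not_open_part v : locus canonical_model v -> ~ open_part v ->
  exists k c, (k < 4)%N /\ v = c *: e_ k.
Proof.
move=> Xv nU; have /canonical_modelP[v0 e1 e2] := Xv.
have ek k : (k < 4)%N ->
    (forall i, (i < 4)%N -> i != k -> v 0 (inord i) = 0) -> v = v 0 (inord k) *: e_ k.
  move=> k4 h; apply: row_inordP => i i4; rewrite mxE vecE // (nth_map 0%N) ?size_iota //.
  rewrite nth_iota // add0n; have [->|ik] := eqVneq i k; first by rewrite mulr1.
  by rewrite mulr0 h.
have [y3|y3] := eqVneq (v 0 (inord 3)) 0.
  move: e1 e2; rewrite y3 expr0n /= !mulr0 !addr0 add0r => /eqP.
  rewrite mulf_eq0 => /orP[] /eqP y12; rewrite y12 ?expr0n /= !(mulr0, addr0, add0r) => /eqP.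
    rewrite mulf_eq0 expf_eq0 /= => /orP[] /eqP y.
      exists 2%N, (v 0 (inord 2)); split=> //; apply: ek => //.
      by move=> [|[|[|[|//]]]].
    exists 0%N, (v 0 (inord 0)); split=> //; apply: ek => //.
    by move=> [|[|[|[|//]]]].
  rewrite mulf_eq0 expf_eq0 /= => /orP[] /eqP y.
    exists 1%N, (v 0 (inord 1)); split=> //; apply: ek => //.
    by move=> [|[|[|[|//]]]].
  exists 0%N, (v 0 (inord 0)); split=> //; apply: ek => //.
  by move=> [|[|[|[|//]]]].
have [y1|y1] := eqVneq (v 0 (inord 1)) 0; last by case: nU.
move: e1 e2; rewrite y1 !mul0r addr0 => /eqP.
rewrite mulf_eq0 (negPf y3) orbF => /eqP y0.
rewrite y0 expr0n /= !(mul0r, add0r, addr0) => /eqP.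
rewrite mulf_eq0 (negPf y3) orbF expf_eq0 /= => /eqP y2.
exists 3%N, (v 0 (inord 3)); split=> //; apply: ek => //.
by move=> [|[|[|[|//]]]].
Qed.

Lemma vanishes_canonical p : homogeneous p -> vanishes open_part p ->
  vanishes (locus canonical_model) p.
Proof.
move=> hp pU v Xv; have [|nU] := classic (open_part v); first exact: pU.
have [k [c [k4 ->]]] := not_open_part Xv nU; have [d hd] := hp.
by rewrite (meval_dhomogZ _ _ hd) open_part_closure // mulr0.
Qed.

Lemma canonical_e k : (k < 4)%N -> locus canonical_model (e_ k).
Proof.
move=> k4; apply/canonical_modelP.
case: k k4 => [|[|[|[|//]]]] _; (split; [|by rewrite !vecE //=; ring..]).
- by apply: (@vec_neq0 _ _ 0) => //=; rewrite oner_neq0.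
- by apply: (@vec_neq0 _ _ 1) => //=; rewrite oner_neq0.
- by apply: (@vec_neq0 _ _ 2) => //=; rewrite oner_neq0.
- by apply: (@vec_neq0 _ _ 3) => //=; rewrite oner_neq0.
Qed.

Lemma canonical_irreducible : irreducible (locus canonical_model).
Proof.
apply: irreducible_of_prime; first by exists (e_ 0); apply: canonical_e.
move=> p q hp hq pq.
have : vanishes open_part (p * q) by move=> v [Xv _ _]; apply: pq.
by move=> /(open_part_prime hp hq)[]; [left|right]; apply: vanishes_canonical.
Qed.

Lemma canonical_prime : prime_set (locus canonical_model).
Proof.
apply: irreducible_prime canonical_irreducible.
by apply: closed_locus => q /canonical_model_forms[].
Qed.

Lemma mderiv_var n k l : (k < n.+1)%N -> (l < n.+1)%N ->
  (var n k)^`M(inord l) = (k == l)%:R%:MP.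
Proof. by move=> kn ln; rewrite mderivXU -val_eqE /= !inordK. Qed.

(* Vanishing of the combination l dQ - dF of the two gradients. *)
Lemma canonical_no_tangency (y0 y1 y2 y3 l : algC) :
  y0 * y3 + y1 * y2 = 0 ->
  2%:R * (y0 * y2) + y1 ^+ 2 = l * y3 -> 2%:R * (y0 * y1) + y3 ^+ 2 = l * y2 ->
  y0 ^+ 2 + 2%:R * (y2 * y3) = l * y1 -> y2 ^+ 2 + 2%:R * (y1 * y3) = l * y0 ->
  [/\ y0 = 0, y1 = 0, y2 = 0 & y3 = 0].
Proof.
move=> q e0 e1 e2 e3.
have q' : y1 * y2 = - (y0 * y3) by apply/eqP; rewrite -addr_eq0 addrC q.
have nz k : (k.+1%:R : algC) != 0 by rewrite Num.Theory.pnatr_eq0.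
(* Each gradient equation, times one variable, links two consecutive monomials of the cubic. Going
   once round the cycle gives A = 16 A - 15 k for A = y0^2 y2, hence A = k and the other monomials
   are k or - k. *)
pose k := l * (y0 * y3).
have lq : l * (y1 * y2) = - k by rewrite q' mulrN.
have B : y0 * y1 ^+ 2 = k - 2%:R * (y0 ^+ 2 * y2).
  by rewrite /k (mulrCA l) -e0; ring.
have D : y1 * y3 ^+ 2 = - k - 2%:R * (y0 * y1 ^+ 2).
  by rewrite -lq (mulrCA l) -e1; ring.
have C : y2 ^+ 2 * y3 = k - 2%:R * (y1 * y3 ^+ 2).
  by rewrite /k (mulrA l) -e3; ring.
have A' : y0 ^+ 2 * y2 = - k - 2%:R * (y2 ^+ 2 * y3).
  by rewrite -lq (mulrA l) -e2; ring.
have A : y0 ^+ 2 * y2 = k.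
  apply: (mulfI (nz 14)); transitivity (16%:R * (y0 ^+ 2 * y2) - y0 ^+ 2 * y2); first by ring.
  by rewrite {2}A' C D B; ring.
have {}B : y0 * y1 ^+ 2 = - k by rewrite B A; ring.
have {}D : y1 * y3 ^+ 2 = k by rewrite D B; ring.
have {A' }C : y2 ^+ 2 * y3 = - k by rewrite C D; ring.
(* Multiplied in pairs, the four monomials give k^2 twice; by the quadric, one product is - (y0
   y3)^3 and the other (y0 y3)^3. *)
have p3 : (y0 * y3) ^+ 3 = 0.
  have e : k ^+ 2 = - (y0 * y3) ^+ 3.
    transitivity ((y0 * y3) ^+ 2 * (y1 * y2)); last by rewrite q'; ring.
    by rewrite expr2 -{1}A -D; ring.
  have e' : k ^+ 2 = (y0 * y3) ^+ 3.
    transitivity ((y0 * y3) * (y1 * y2) ^+ 2); last by rewrite q'; ring.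
    transitivity ((- k) * (- k)); first by ring.
    by rewrite -{1}B -C; ring.
  apply: (mulfI (nz 1)); rewrite mulr0.
  transitivity ((y0 * y3) ^+ 3 - (- (y0 * y3) ^+ 3)); first by ring.
  by rewrite -e -e' subrr.
have {p3}p : y0 * y3 = 0 by apply/eqP; rewrite -[_ == 0](expf_eq0 _ 3) p3.
have k0 : k = 0 by rewrite /k p mulr0.
rewrite {}k0 oppr0 in A B C D.
have sq0 (x : algC) : x ^+ 2 = 0 -> x = 0 by move=> /eqP; rewrite expf_eq0 => /eqP.
move/eqP: p; rewrite mulf_eq0 => /orP[] /eqP y0'.
  have y3' : y3 = 0.
    apply/eqP; apply: contraT => y3n.
    move/eqP: C; rewrite mulf_eq0 (negPf y3n) orbF => /eqP/sq0 y2'.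
    by move/eqP: e1; rewrite y0' y2' mul0r !mulr0 add0r expf_eq0 /= (negPf y3n).
  move: e0 e3; rewrite y0' y3' !(mul0r, mulr0, addr0, add0r) => /sq0 y1' /sq0 y2'.
  by split.
have y0n : y0 = 0.
  apply/eqP; apply: contraT => y0n.
  move/eqP: A; rewrite mulf_eq0 expf_eq0 /= (negPf y0n) => /eqP y2'.
  move/eqP: B; rewrite mulf_eq0 (negPf y0n) => /eqP/sq0 y1'.
  by move/eqP: e2; rewrite y2' y1' mul0r !mulr0 addr0 expf_eq0 /= (negPf y0n).
move: e0 e3; rewrite y0n y0' !(mul0r, mulr0, addr0, add0r) => /sq0 y1' /sq0 y2'.
by split.
Qed.

Lemma canonical_smooth : smooth_along canonical_model.
Proof.
move=> v Xv; have /canonical_modelP[v0 e1 e2] := Xv.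
suff : row_free (jacobian canonical_model v) by move=> /eqP->.
apply: inj_row_free => /= a; rewrite /jacobian => aJ.
have eqs j : a 0 0 * ((canonical_model`_0)^`M(j)).@[v 0] +
             a 0 (inord 1) * ((canonical_model`_1)^`M(j)).@[v 0] = 0.
  move/rowP/(_ j): aJ; rewrite !mxE !big_ord_recl big_ord0 addr0 !mxE => e.
  rewrite -[RHS]e; congr (_ * _ + _ * _); congr (a 0 _); apply: val_inj => /=.
  by rewrite inordK.
pose a0 := a 0 0; pose a1 := a 0 (inord 1).
have := (eqs (inord 0), eqs (inord 1), eqs (inord 2), eqs (inord 3)).
rewrite -/a0 -/a1 /canonical_model !expr2 /= !(mderivD, mderivM) !mderiv_var //=.
rewrite !(mevalD, mevalM, meval_var, mevalC).
have v_eq0 : v 0 (inord 0) = 0 -> v 0 (inord 1) = 0 -> v 0 (inord 2) = 0 ->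
    v 0 (inord 3) = 0 -> False.
  move=> z0 z1 z2 z3; move/eqP: v0; apply.
  by apply: row_inordP => -[|[|[|[|//]]]] _; rewrite mxE.
move: (v 0 (inord 0)) (v 0 (inord 1)) (v 0 (inord 2)) (v 0 (inord 3)) e1 e2 v_eq0.
move=> y0 y1 y2 y3 q _ v_eq0 [[[E0 E1] E2] E3].
(* If the cubic does not occur in the dependence, the gradient of the quadric vanishes; but its
   entries are the coordinates themselves. Otherwise l = - a0 / a1 contradicts
   [canonical_no_tangency]. *)
have [a10|a1n] := eqVneq a1 0.
  suff a00 : a0 = 0.
    apply/rowP => i; rewrite mxE -[i]inord_val; case: i => m /= +; case: m => [|[|//]] _ //.
    by rewrite -[inord 0](_ : 0 = _) //; apply: val_inj; rewrite /= inordK.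
  have [//|a0n] := eqVneq a0 0; case: v_eq0; apply: (mulfI a0n); rewrite mulr0.
  - by rewrite -E3 a10; ring.
  - by rewrite -E2 a10; ring.
  - by rewrite -E1 a10; ring.
  - by rewrite -E0 a10; ring.
have solve x y : a0 * y + a1 * x = 0 -> x = - (a0 / a1) * y.
  by move=> e; apply: (mulfI a1n); rewrite -[LHS]subr0 -e; field.
have [||||z0 z1 z2 z3] := @canonical_no_tangency y0 y1 y2 y3 (- (a0 / a1)) q.
- by apply: solve; rewrite -[RHS]E0; ring.
- by apply: solve; rewrite -[RHS]E1; ring.
- by apply: solve; rewrite -[RHS]E2; ring.
- by apply: solve; rewrite -[RHS]E3; ring.
by case: v_eq0.
Qed.

(* Modulo the Kummer equation, which is monic of degree 3 in c. *)
Definition reduced (D : nat) (g : algC -> algC -> algC) : Prop :=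
  exists R : 'I_3 -> {poly algC}, (forall k, (size (R k) <= D)%N) /\
    forall a c, kummer.[a%:P].[c] = 0 -> g a c = \sum_k (R k).[a] * c ^+ k.

Lemma reduced_ext D g h :
  (forall a c, g a c = h a c) -> reduced D g -> reduced D h.
Proof. by move=> gh [R [sR RE]]; exists R; split=> // a c e; rewrite -gh RE. Qed.

Lemma reduced_widen D D' g : (D <= D')%N -> reduced D g -> reduced D' g.
Proof. by move=> DD' [R [sR RE]]; exists R; split=> // k; apply: leq_trans (sR k) DD'. Qed.

Lemma reduced_scale D x g : reduced D g -> reduced D (fun a c => x * g a c).
Proof.
move=> [R [sR RE]]; exists (fun k => x *: R k); split=> [k|a c e].
  exact: leq_trans (size_scale_leq _ _) (sR k).
by rewrite RE // mulr_sumr; apply: eq_bigr => k _; rewrite hornerZ mulrA.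
Qed.

Lemma reduced_sum D (I : eqType) (r : seq I) (g : I -> algC -> algC -> algC) :
  (forall i, i \in r -> reduced D (g i)) -> reduced D (fun a c => \sum_(i <- r) g i a c).
Proof.
elim: r => [|i r IH] h.
  exists (fun=> 0); split=> [k|a c _]; first by rewrite size_poly0.
  by rewrite big_nil big1 // => k _; rewrite horner0 mul0r.
have [|R [sR RE]] := IH; first by move=> j jr; apply: h; rewrite inE jr orbT.
have [S [sS SE]] := h i (mem_head _ _).
exists (fun k => S k + R k); split=> [k|a c e].
  by rewrite (leq_trans (size_polyD _ _)) // geq_max sS sR.
by rewrite big_cons SE // RE // -big_split; apply: eq_bigr => k _; rewrite hornerD mulrDl.
Qed.

Lemma reducedA D g : reduced D g -> reduced D.+1 (fun a c => a * g a c).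
Proof.
move=> [R [sR RE]]; exists (fun k => 'X * R k); split=> [k|a c e].
  rewrite mulrC; have [->|R0] := eqVneq (R k) 0; first by rewrite mul0r size_poly0.
  by rewrite size_mulX // ltnS.
by rewrite RE // mulr_sumr; apply: eq_bigr => k _; rewrite hornerM hornerX mulrA.
Qed.

(** The Kummer equation reads c^3 = c^2 + a^5 c + a^5, so multiplication by c raises degrees in a by
    at most 5. *)
Lemma reducedC D g : reduced D g -> reduced (D + 5) (fun a c => c * g a c).
Proof.
move=> [R [sR RE]].
have sX5 : (size (R (inord 2) * 'X^5)%R <= D + 5)%N.
  have [->|R0] := eqVneq (R (inord 2)) 0; first by rewrite mul0r size_poly0.
  by rewrite size_mulXn // addnC leq_add2r.
have sR' k : (size (R k) <= D + 5)%N by rewrite (leq_trans (sR k)) ?leq_addr.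
have sD (p q : {poly algC}) : (size p <= D + 5)%N -> (size q <= D + 5)%N ->
    (size (p + q)%R <= D + 5)%N.
  by move=> hp hq; rewrite (leq_trans (size_polyD _ _)) // geq_max hp hq.
exists (fun k => [:: R (inord 2) * 'X^5; R (inord 0) + R (inord 2) * 'X^5;
                     R (inord 1) + R (inord 2)]`_k); split=> [k|a c].
  by case: k => m /= +; case: m => [|[|[|//]]] _ //=; apply: sD.
move=> e'; have := e'; rewrite horner_kummer => e; rewrite RE // !big_ord_recl !big_ord0 /= !hornerE /=.
have -> : R 0 = R (inord 0) by congr R; apply: val_inj; rewrite /= inordK.
have -> : R (lift ord0 ord0) = R (inord 1) by congr R; apply: val_inj; rewrite /= inordK.
have -> : R (lift ord0 (lift ord0 ord0)) = R (inord 2).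
  by congr R; apply: val_inj; rewrite /= inordK.
apply/eqP; rewrite -subr_eq0; apply/eqP.
transitivity (- (R (inord 2)).[a] * ((c + 1) * a ^+ 5 - c ^+ 2 * (c - 1))).
  by rewrite /bump /=; ring.
by rewrite e mulr0.
Qed.

(** The most expensive coordinate is a c, at 1 + 5. *)
Lemma reduced_coord D i g : reduced D g ->
  reduced (D + 6) (fun a c => generic_point a c 0 i * g a c).
Proof.
move=> hg; have [m m4 ->] : exists2 m, (m < 4)%N & i = inord m.
  by exists i => //; rewrite inord_val.
case: m m4 => [|[|[|[|//]]]] _.
- apply: (@reduced_ext _ (fun a c => a * (c * g a c))) => [a c|].
    by rewrite vecE // mulrA.
  by rewrite addnS; apply/reducedA/reducedC.
- apply: (@reduced_ext _ (fun a c => a * (a * (a * g a c)))) => [a c|].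
    by rewrite vecE //=; ring.
  by apply: (@reduced_widen D.+3); [lia|do 3!apply: reducedA].
- apply: (@reduced_ext _ (fun a c => -1 * (c * g a c))) => [a c|].
    by rewrite vecE //=; ring.
  by apply: (@reduced_widen (D + 5)); [lia|apply/reduced_scale/reducedC].
- apply: (@reduced_ext _ (fun a c => a * (a * g a c))) => [a c|].
    by rewrite vecE //=; ring.
  by apply: (@reduced_widen D.+2); [lia|do 2!apply: reducedA].
Qed.

Lemma reduced_form p e : p \is e.-homog ->
  reduced (6 * e + 1) (fun a c => p.@[generic_point a c 0]).
Proof.
move=> hp.
apply: (@reduced_ext _ (fun a c =>
    \sum_(m <- msupp p) p@_m * \prod_i generic_point a c 0 i ^+ m i)).
  by move=> a c; rewrite mevalE.
apply: reduced_sum => m mp; apply: reduced_scale.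
rewrite -(dhomog_mf hp mp) /= mdegE.
elim: (index_enum _) => [|i r IH].
  apply: (@reduced_ext _ (fun _ _ => 1)) => [a c|]; first by rewrite big_nil.
  rewrite big_nil muln0; exists (fun k => (k == 0 :> nat)%:R); split=> [k|a c _].
    by case: eqP; rewrite ?size_poly1 ?size_poly0.
  rewrite big_ord_recl big1 => [|k _]; last by rewrite horner0 mul0r.
  by rewrite /= !hornerE.
apply: (@reduced_ext _ (fun a c => generic_point a c 0 i ^+ m i *
    \prod_(j <- r) generic_point a c 0 j ^+ m j)) => [a c|]; first by rewrite big_cons.
rewrite big_cons mulnDr -addnA addnC.
elim: (m i) => [|k IHk].
  by rewrite muln0 addn0; apply: reduced_ext IH => a c; rewrite expr0 mul1r.
rewrite mulnS (addnC 6) addnA.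
by apply: reduced_ext (reduced_coord i IHk) => a c; rewrite exprS mulrA.
Qed.

(** The (K + 1)^2 products of degree 2 K d restrict, on generic points, to a space of dimension at
    most 3 D = 36 K d + 3. With K = 36 d + 3, the square K^2 = 36 K d + 3 K is already larger, so
    some combination restricts to zero. *)
Lemma canonical_dependent : functions_dependent (locus canonical_model).
Proof.
move=> d f t l hf ht hl; pose K := (36 * d + 3)%N; pose D := (12 * K * d + 1)%N.
pose I := ('I_K.+1 * 'I_K.+1)%type.
pose g (ij : I) := f ^+ ij.1 * t ^+ ij.2 * l ^+ (K - ij.1 + (K - ij.2)).
have hg ij : g ij \is (2 * K * d)%N.-homog.
  have [i1 i2] : (ij.1 <= K /\ ij.2 <= K)%N by split; rewrite -ltnS ltn_ord.
  have -> : (2 * K * d = ij.1 * d + ij.2 * d + (K - ij.1 + (K - ij.2)) * d)%N.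
    by rewrite -!mulnDl; congr (_ * _)%N; lia.
  by rewrite /g; do 2?[apply: dhomogM]; apply: dhomogXn.
have /choice_fun[R hR] : forall ij, exists R : 'I_3 -> {poly algC},
    (forall k, (size (R k) <= D)%N) /\ forall a c, kummer.[a%:P].[c] = 0 ->
    (g ij).@[generic_point a c 0] = \sum_k (R k).[a] * c ^+ k.
  move=> ij; have [R [sR RE]] := reduced_form (hg ij); exists R; split=> // k.
  by rewrite (leq_trans (sR k)) // /D !mulnA.
pose M := \matrix_(r < #|{: I}|, k < #|{: 'I_3 * 'I_D}|)
  (R (enum_val r) (enum_val k).1)`_(enum_val k).2.
have [u u0 uM] : exists2 u : 'rV_#|{: I}|, u != 0 & u *m M = 0.
  have : kermx M != 0.
    rewrite -mxrank_eq0 mxrank_ker -lt0n subn_gt0 (leq_ltn_trans (rank_leq_col _)) //.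
    rewrite !card_prod !card_ord /D.
    have K3 : (2 < K)%N by rewrite /K addnC.
    have KK : (K * K = 36 * (K * d) + 3 * K)%N.
      by rewrite -[in LHS]/(36 * d + 3)%N -/K mulnDr mulnCA (mulnC K 3).
    by move: (K) KK K3 => k kk k3; clear -kk k3; lia.
  move=> /rowV0Pn[u /sub_kermxP uM u0]; by exists u.
exists K, (fun i j => u 0 (enum_rank (inord i, inord j))); split.
  have [r ur] := (rV_neq0P u).1 u0; exists (enum_val r).1, (enum_val r).2.
  by rewrite !inord_val -surjective_pairing enum_valK.
rewrite (_ : \sum_(i < K.+1) _ = \sum_r u 0 r *: g (enum_val r)); last first.
  rewrite pair_big /= (reindex (@enum_val _ {: I})) /=; last exact/onW_bij/enum_val_bij.
  by apply: eq_big => // r _; rewrite !inord_val -surjective_pairing enum_valK.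
apply: vanishes_canonical.
  by exists (2 * K * d)%N; apply: rpred_sum => r _; rewrite dhomogZ.
have gU a c : kummer.[a%:P].[c] = 0 ->
    (\sum_r u 0 r *: g (enum_val r)).@[generic_point a c 0] = 0.
  move=> e; rewrite meval_sum.
  under eq_bigr => r _ do rewrite mevalZ (hR (enum_val r)).2 // mulr_sumr.
  rewrite exchange_big big1 //= => k _.
  under eq_bigr => r _ do rewrite mulrA -hornerZ.
  rewrite -mulr_suml -horner_sum (_ : \sum_r _ = 0) ?horner0 ?mul0r //.
  apply/polyP => i; rewrite coef_sum coef0.
  have [iD|Di] := ltnP i D; last first.
    by apply: big1 => r _; rewrite coefZ nth_default ?mulr0 // (leq_trans ((hR _).1 k)).
  move/rowP/(_ (enum_rank (k, Ordinal iD))): uM.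
  rewrite [LHS]mxE [RHS]mxE; apply: etrans.
  by apply: eq_bigr => r _; rewrite !mxE enum_rankK coefZ.
move=> v /open_part_generic[a [c [k [_ _ e ->]]]].
rewrite (@meval_dhomogZ _ (2 * K * d)) ?gU ?mulr0 //.
by apply: rpred_sum => r _; rewrite dhomogZ.
Qed.

(* Algebraic dependence is transported along a dominant rational map F: the
   points of W where T does not vanish are values of F. *)
Lemma functions_dependent_image n m (V : 'rV[algC]_n.+1 -> Prop)
    (W : 'rV[algC]_m.+1 -> Prop) e (F : 'I_m.+1 -> {mpoly algC[n.+1]}) T :
  functions_dependent V -> (forall j, F j \is e.-homog) ->
  prime_set W -> ~ vanishes W T ->
  (forall w, W w -> T.@[w 0] != 0 -> exists2 v, V v & peq (eval_forms F v) w) ->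
  functions_dependent W.
Proof.
move=> depV hF prW TW TF d f t l hf ht hl.
have [K [phi [nz rel]]] := depV (d * e)%N _ _ _
  (dhomog_comp_form hf hF) (dhomog_comp_form ht hF) (dhomog_comp_form hl hF).
exists K, phi; split=> //; apply: (prime_setP prW TW) => w Ww; rewrite mevalM.
have [->|Tw] := eqVneq T.@[w 0] 0; first by rewrite mul0r.
have [v Vv [c c0 wE]] := TF w Ww Tw.
have := congr1 (fun x => c ^+ (2 * K * d) * x) (rel v Vv).
rewrite /= mulr0 !meval_sum mulr_sumr => e0.
rewrite [X in _ * X](_ : _ = 0) ?mulr0 //; apply: etrans e0.
apply: eq_bigr => i _; rewrite !meval_sum mulr_sumr.
apply: eq_bigr => j _; rewrite !mevalZ !mevalM !rmorphXn /= !meval_comp_form.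
rewrite wE (meval_dhomogZ _ _ hf) (meval_dhomogZ _ _ ht) (meval_dhomogZ _ _ hl).
have [iK jK] : (i <= K /\ j <= K)%N by split; rewrite -ltnS ltn_ord.
have -> : (2 * K * d = d * i + d * j + d * (K - i + (K - j)))%N.
  by rewrite -!mulnDr mulnC; congr (_ * _)%N; lia.
by rewrite mulnDr !exprD !exprMn -!exprM; ring.
Qed.

(** As h vanishes on Z, the relation between x_i x_j^(d-1), x_j^d and h becomes an equation q(x_i /
    x_j) = 0 on Z in one unknown. The polynomial q splits into linear factors, and primality of Z
    makes one of them vanish. *)
Lemma coordinates_proportional n (X Z : 'rV[algC]_n.+1 -> Prop) d h i j :
  prime_set X -> functions_dependent X -> h \is d.-homog -> ~ vanishes X h ->
  closed Z -> irreducible Z -> incl Z X -> vanishes Z h ->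
  ~ vanishes Z 'X_j ->
  exists r : algC, vanishes Z ('X_i - r *: 'X_j).
Proof.
move=> prX depX hh hX clZ irrZ ZX hZ jZ.
have prZ := irreducible_prime clZ irrZ; have [[z Zz] _] := irrZ.
have d_gt0 : (0 < d)%N.
  case: d hh => // hh; have [u Xu hu] := (not_vanishesP X h).1 hX.
  by move: hu; rewrite (meval_dhomog0 _ (z 0) hh) hZ // eqxx.
have hXk k (x : 'I_n.+1) : ('X_x ^+ k : {mpoly algC[n.+1]}) \is k.-homog.
  by have := dhomogXn k (dhomogXU x); rewrite muln1.
have ht : ('X_i * 'X_j ^+ d.-1 : {mpoly algC[n.+1]}) \is d.-homog.
  by have := dhomogM (dhomogXU i) (hXk d.-1 j); rewrite add1n prednK.
have [M [c [r [[j0 cj0] rel]]]] := dependent_relation prX depX hh ht (hXk d j) hX.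
pose q := \poly_(k < M.+1) c k.
have q0 : q != 0.
  apply: contraNneq cj0 => /(congr1 (fun p : {poly algC} => p`_j0)).
  by rewrite coef_poly ltn_ord coef0 => ->.
have [rs qE] := closed_field_poly_normal q.
have lq0 : lead_coef q != 0 by rewrite lead_coef_eq0.
apply: NNPP => /not_ex_all_not noroot.
have := @not_vanishes_prod _ Z _ rs xpredT _ prZ (ex_intro _ z Zz) noroot.
apply; apply: (prime_setP prZ jZ) => u Zu; rewrite mevalM meval_prod.
have [->|uj] := eqVneq ('X_j : {mpoly algC[n.+1]}).@[u 0] 0; first by rewrite mul0r.
rewrite mevalXU in uj *.
have qu : q.[u 0 i / u 0 j] = 0.
  apply: (mulfI (expf_neq0 (d * M) uj)); rewrite mulr0 horner_poly mulr_sumr.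
  have := rel u (ZX u Zu); rewrite mevalB mevalM (hZ u Zu) mulr0 subr0 meval_sum.
  apply: etrans; apply: eq_bigr => k _.
  rewrite mevalZ !mevalM !rmorphXn /= mevalM !rmorphXn /= !mevalXU mulrCA; congr (_ * _).
  have kM : (k <= M)%N by rewrite -ltnS ltn_ord.
  have -> : (d * M = k + d.-1 * k + d * (M - k))%N.
    by rewrite -{1}(subnK kM) mulnDr addnC -mulSn prednK.
  by rewrite !exprD !exprMn -!exprM exprVn; field; rewrite expf_neq0.
move: qu; rewrite qE hornerZ horner_prod => /eqP.
rewrite mulf_eq0 (negPf lq0) prodf_seq_eq0 => /hasP[x xr]; rewrite /= hornerXsubC => /eqP e.
rewrite (big_rem x) //= mevalB mevalZ !mevalXU.
have -> : u 0 i - x * u 0 j = 0 by rewrite -(mulr0 (u 0 j)) -e; field.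
by rewrite mul0r mulr0.
Qed.

(** The middle term of a chain lies in the zeros of a form h that does not vanish on X, so all its
    coordinates are proportional. It is a single point, which leaves no room for a smaller nonempty
    set. *)
Lemma no_chain2 n (X : 'rV[algC]_n.+1 -> Prop) :
  prime_set X -> functions_dependent X -> ~ has_chain X 2.
Proof.
move=> prX depX [Z [hZ Z_lt]].
have [[cl0 irr0 _] [cl1 irr1 Z1X] [cl2 irr2 Z2X]] := And3 (hZ 0%N isT) (hZ 1%N isT) (hZ 2%N isT).
have [[Z01 nZ10] [Z12 nZ21]] := (Z_lt 0%N isT, Z_lt 1%N isT).
have [u /(imply_to_and (Z 2%N u))[Zu nZu]] := not_all_ex_not _ _ nZ21.
have [s hs Zs] := cl1.
have [h [[d hh] hu hZ1]] : exists h, [/\ homogeneous h, h.@[u 0] != 0 & vanishes (Z 1%N) h].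
  apply: NNPP => nh; apply/nZu/Zs; split; first exact: closed_neq0 cl2 Zu.
  move=> p ps; apply: NNPP => pu; apply: nh; exists p; split; [exact: hs|exact/eqP|].
  by move=> w /Zs[_]; apply.
have hX : ~ vanishes X h by apply/not_vanishesP; exists u => //; apply: Z2X.
have [[v0 Zv0] _] := irr1.
have [j v0j] := (rV_neq0P v0).1 (closed_neq0 cl1 Zv0).
have jZ : ~ vanishes (Z 1%N) 'X_j by apply/not_vanishesP; exists v0; rewrite ?mevalXU.
have /choice_fun[r hr] :=
  fun i => coordinates_proportional i prX depX hh hX cl1 irr1 Z1X hZ1 jZ.
have rE w : Z 1%N w -> w = w 0 j *: \row_i r i.
  move=> Zw; apply/rowP => i; rewrite !mxE; have /eqP := hr i w Zw.
  by rewrite mevalB mevalZ !mevalXU subr_eq0 mulrC => /eqP.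
apply: nZ10 => w Zw; have [[z Zz] _] := irr0.
have Z1z := Z01 z Zz; apply: (peq_cone (closed_cone cl0) _ Zz).
apply: peq_cross; [exact: closed_neq0 cl0 Zz|exact: closed_neq0 cl1 Zw|].
by move=> a b; rewrite (rE w Zw) (rE z Z1z) !mxE; ring.
Qed.

Lemma point_chain : has_chain (locus canonical_model) 1.
Proof.
pose s : seq {mpoly algC[4]} := [:: var 3 1; var 3 2; var 3 3].
have hs p : p \in s -> homogeneous p.
  by rewrite !inE => /or3P[] /eqP->; exists 1%N; apply: dhomog_var.
have sE v : locus s v -> v = v 0 (inord 0) *: e_ 0.
  move=> [v0 vs]; apply: row_inordP => -[|[|[|[|//]]]] _; rewrite mxE vecE //= ?mulr1 ?mulr0 //.
  - by rewrite -meval_var vs // !inE eqxx.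
  - by rewrite -meval_var vs // !inE eqxx orbT.
  - by rewrite -meval_var vs // !inE eqxx !orbT.
have s0 : locus s (e_ 0).
  split; first by apply: (@vec_neq0 _ _ 0) => //=; rewrite oner_neq0.
  by move=> p; rewrite !inE => /or3P[] /eqP->; rewrite meval_var vecE.
exists (fun i => if i == 0%N then locus s else locus canonical_model); split.
  move=> [|[|//]] _ /=; split=> //.
  - exact: closed_locus.
  - apply: irreducible_of_prime; first by exists (e_ 0).
    move=> p q [d hp] [e hq] pq; have /eqP := pq _ s0; rewrite mevalM mulf_eq0.
    move=> /orP[] /eqP z; [left|right] => v /sE->.
      by rewrite (meval_dhomogZ _ _ hp) z mulr0.
    by rewrite (meval_dhomogZ _ _ hq) z mulr0.
  - move=> v sv; have := sv.1; rewrite (sE v sv) => v0.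
    apply: closed_cone (canonical_e (k := 0) isT) _.
      by apply: closed_locus => q /canonical_model_forms[].
    by apply: contraNneq v0 => ->; rewrite scale0r.
  - by apply: closed_locus => q /canonical_model_forms[].
  - exact: canonical_irreducible.
move=> [|//] _ /=; split.
  move=> v sv; have := sv.1; rewrite (sE v sv) => v0.
  apply: closed_cone (canonical_e (k := 0) isT) _.
    by apply: closed_locus => q /canonical_model_forms[].
  by apply: contraNneq v0 => ->; rewrite scale0r.
move=> /(_ _ (canonical_e (k := 1) isT))[_ /(_ (var 3 1))].
rewrite inE eqxx meval_var vecE //= => /(_ isT)/eqP.
by rewrite oner_eq0.
Qed.

Lemma canonical_dimension : dimension (locus canonical_model) 1.
Proof.
by split; [apply: point_chain|apply: no_chain2 canonical_prime canonical_dependent].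
Qed.

(** * The desingularization of the plane sextic *)

Lemma hulek_craigP w : locus hulek_craig_plane w <-> w != 0 /\
  w 0 (inord 0) * (w 0 (inord 1) ^+ 5 + w 0 (inord 2) ^+ 5)
  + w 0 (inord 0) ^+ 2 * w 0 (inord 1) ^+ 2 * w 0 (inord 2) ^+ 2
  - w 0 (inord 0) ^+ 4 * w 0 (inord 1) * w 0 (inord 2)
  - 2%:R * (w 0 (inord 1) ^+ 3 * w 0 (inord 2) ^+ 3) = 0.
Proof.
have E : (hulek_craig_plane`_0).@[w 0] =
  w 0 (inord 0) * (w 0 (inord 1) ^+ 5 + w 0 (inord 2) ^+ 5)
  + w 0 (inord 0) ^+ 2 * w 0 (inord 1) ^+ 2 * w 0 (inord 2) ^+ 2
  - w 0 (inord 0) ^+ 4 * w 0 (inord 1) * w 0 (inord 2)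
  - 2%:R * (w 0 (inord 1) ^+ 3 * w 0 (inord 2) ^+ 3).
  by rewrite /= !(mevalB, mevalD, mevalM, rmorphXn, mevalMn, meval1) /= !mevalXU.
split=> [[w0 ws]|[w0 e]]; first by rewrite -E; split=> //; apply: ws; rewrite inE.
by split=> // p; rewrite inE => /eqP->; rewrite -[RHS]e -E.
Qed.

(* The cubics through the six nodes of the plane sextic. *)
Definition cubics (R : comNzRingType) (x y z : R) : seq R :=
  [:: y * (x ^+ 2 - y * z); z ^+ 3 - x * y ^+ 2;
      x * z ^+ 2 - y ^+ 3; - (z * (x ^+ 2 - y * z))].

(* Three representations of the inverse map, agreeing on the canonical model and
   without common base point there. *)
Definition quadrics (R : comNzRingType) (k : nat) (n1 n2 n3 n4 : R) : seq R :=
  match k with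
  | 0 => [:: 2%:R * (n2 * n3); n2 * n4 + n3 ^+ 2; n1 * n3 + n2 ^+ 2]
  | 1 => [:: n1 ^+ 2 + n3 * n4; - (n1 * n2); n2 * n4]
  | _ => [:: - (n1 * n2 + n4 ^+ 2); - (n1 * n3); n3 * n4]
  end.

Definition cubic_forms (i : 'I_4) : {mpoly algC[3]} :=
  (cubics (var 2 0) (var 2 1) (var 2 2))`_i.

Definition quadric_forms (k : nat) (i : 'I_3) : {mpoly algC[4]} :=
  (quadrics k (var 3 0) (var 3 1) (var 3 2) (var 3 3))`_i.

Lemma eval_cubic_forms (w : 'rV_3) :
  eval_forms cubic_forms w = vec 3 (cubics (w 0 (inord 0)) (w 0 (inord 1)) (w 0 (inord 2))).
Proof.
apply: row_inordP => -[|[|[|[|//]]]] _; rewrite vecE // mxE /cubic_forms inordK //=;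
by rewrite !(mevalB, mevalD, mevalN, mevalM, rmorphXn) /= !meval_var.
Qed.

Lemma eval_quadric_forms k (v : 'rV_4) : eval_forms (quadric_forms k) v =
  vec 2 (quadrics k (v 0 (inord 0)) (v 0 (inord 1)) (v 0 (inord 2)) (v 0 (inord 3))).
Proof.
apply: row_inordP => -[|[|[|//]]] _; rewrite vecE // mxE /quadric_forms inordK //=;
by case: k => [|[|k]] /=; rewrite !(mevalB, mevalD, mevalN, mevalM, rmorphXn, mevalMn, meval1) /= !meval_var.
Qed.

Lemma dhomog_cubic_forms i : cubic_forms i \is 3.-homog.
Proof.
have h k := dhomog_var 2 k.
have h2 k : var 2 k ^+ 2 \is 2.-homog := dhomogXn 2 (h k).
have h3 k : var 2 k ^+ 3 \is 3.-homog := dhomogXn 3 (h k).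
have hq : var 2 0 ^+ 2 - var 2 1 * var 2 2 \is 2.-homog.
  by rewrite rpredB //; apply: (dhomogM (h _) (h _)).
have h12 k l : var 2 k * var 2 l ^+ 2 \is 3.-homog := dhomogM (h k) (h2 l).
have hkq k : var 2 k * (var 2 0 ^+ 2 - var 2 1 * var 2 2) \is 3.-homog := dhomogM (h k) hq.
rewrite /cubic_forms; case: i => m /= +; case: m => [|[|[|[|//]]]] _ /=.
- exact: hkq.
- by apply: rpredB; [exact: h3|exact: h12].
- by apply: rpredB; [exact: h12|exact: h3].
- by rewrite rpredN; apply: hkq.
Qed.

Lemma dhomog_quadric_forms k i : quadric_forms k i \is 2.-homog.
Proof.
have h k := dhomog_var 3 k.
have h2 k : var 3 k ^+ 2 \is 2.-homog := dhomogXn 2 (h k).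
have h11 k l : var 3 k * var 3 l \is 2.-homog := dhomogM (h k) (h l).
by rewrite /quadric_forms; case: i => m /= +; case: m => [|[|[|//]]] _;
  case: k => [|[|k]] /=; rewrite ?mulr_natl ?rpredMn ?rpredN ?rpredD //;
  first [exact: h2|exact: h11].
Qed.

Lemma cubic_forms_over : forms_over rationals cubic_forms.
Proof.
exists 3%N => i; split; first exact: dhomog_cubic_forms.
apply/over_rationals; have h k : var 2 k \is a mpolyOver 3 Crat by apply: mpolyOverX.
rewrite /cubic_forms; case: i => m /= +; case: m => [|[|[|[|//]]]] _ /=;
  rewrite ?(rpredN, rpredB, rpredM, rpredX) //; exact: h.
Qed.

Lemma quadric_forms_over k : forms_over rationals (quadric_forms k).
Proof.
exists 2%N => i; split; first exact: dhomog_quadric_forms.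
apply/over_rationals; have h l : var 3 l \is a mpolyOver 4 Crat by apply: mpolyOverX.
rewrite /quadric_forms; case: i => m /= +; case: m => [|[|[|//]]] _;
  case: k => [|[|k]] /=; rewrite ?(rpredN, rpredD, rpredM, rpredX) //; first [exact: h|exact: rpred1].
Qed.

Lemma cross_lt n (u v : 'rV[algC]_n.+1) :
  (forall i j, (i < j)%N -> (j < n.+1)%N ->
    u 0 (inord i) * v 0 (inord j) = u 0 (inord j) * v 0 (inord i)) ->
  forall i j, u 0 i * v 0 j = u 0 j * v 0 i.
Proof.
move=> h i j; rewrite -[i]inord_val -[j]inord_val.
by case: (ltngtP i j) => [/h->//|/h->//|/val_inj->].
Qed.

(** The Kummer equation is stated with c^3 isolated so that [ring: e] can reduce modulo it;
    identities between forms on N become computations in a and c. *)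
Lemma vanishes_generic p : homogeneous p ->
  (forall a c, c ^+ 3 = c ^+ 2 + a ^+ 5 * c + a ^+ 5 -> p.@[generic_point a c 0] = 0) ->
  vanishes (locus canonical_model) p.
Proof.
move=> hp pg; apply: vanishes_canonical => // v /open_part_generic[a [c [k [_ _ e ->]]]].
have [d hd] := hp; rewrite (meval_dhomogZ _ _ hd) pg ?mulr0 //.
apply/eqP; rewrite eq_sym -subr_eq0; apply/eqP.
by move: e; rewrite horner_kummer => e; rewrite -[RHS]e; ring.
Qed.

Lemma dhomog_hulek_craig p : p \in hulek_craig_plane -> p \is 6.-homog.
Proof.
rewrite inE => /eqP->.
have h k' m : var 2 k' ^+ m \is m.-homog.
  by have := dhomogXn m (dhomog_var 2 k'); rewrite muln1.
have h1 k' := dhomog_var 2 k'.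
rewrite rpredB //; [rewrite rpredB //; [rewrite rpredD //|]|].
- by apply: (dhomogM (h1 _)); apply: rpredD; apply: h.
- by apply: (dhomogM (dhomogM (h _ 2%N) (h _ 2%N)) (h _ 2%N)).
- by apply: (dhomogM (dhomogM (h _ 4%N) (h1 _)) (h1 _)).
- by rewrite mulr_natl rpredMn //; apply: (dhomogM (h _ 3%N) (h _ 3%N)).
Qed.

Lemma quadrics_hulek_craig k v : locus canonical_model v ->
  eval_forms (quadric_forms k) v != 0 -> locus hulek_craig_plane (eval_forms (quadric_forms k) v).
Proof.
move=> Xv v0; split=> // p ps.
rewrite -meval_comp_form; set q := comp_form _ _.
suff : vanishes (locus canonical_model) q by apply.
apply: vanishes_generic => [|a c e].
  exists (6 * 2)%N; apply: dhomog_comp_form; last exact: dhomog_quadric_forms.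
  exact: dhomog_hulek_craig.
move: ps; rewrite inE => /eqP pE.
rewrite /q pE meval_comp_form eval_quadric_forms !(mevalB, mevalD, mevalM, rmorphXn, mevalMn, meval1) /=.
rewrite !mevalXU !vecE //=.
by clear v0 q pE; case: k => [|[|k]] /=; ring: e.
Qed.

Lemma quadrics_agree k l v : locus canonical_model v ->
  eval_forms (quadric_forms k) v != 0 -> eval_forms (quadric_forms l) v != 0 ->
  peq (eval_forms (quadric_forms k) v) (eval_forms (quadric_forms l) v).
Proof.
move=> Xv kv lv; apply: peq_cross => // i j; apply/eqP; rewrite -subr_eq0 !mxE.
have := dhomog_quadric_forms; move: k l {kv lv} => k l h2.
rewrite -!mevalM -mevalB; apply/eqP; move: v Xv.
change (vanishes (locus canonical_model)
  (quadric_forms k i * quadric_forms l j - quadric_forms k j * quadric_forms l i)).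
apply: vanishes_generic => [|a c e].
  by exists 4%N; apply: rpredB; apply: (dhomogM (h2 _ _) (h2 _ _)).
rewrite mevalB !mevalM; apply/eqP; rewrite subr_eq0; apply/eqP.
have := @cross_lt 2 (eval_forms (quadric_forms k) (generic_point a c))
  (eval_forms (quadric_forms l) (generic_point a c)).
rewrite !eval_quadric_forms => h.
have {}h := h _ i j; move: h; rewrite -!eval_quadric_forms ![eval_forms _ _ _ _]mxE; apply.
move=> {}i {}j ij j3; rewrite !eval_quadric_forms !vecE ?(ltn_trans ij) //=.
by case: k l i j ij j3 => [|[|k]] [|[|l]] [|[|[|i]]] [|[|[|j]]] //= _ _; ring: e.
Qed.

Lemma quadrics_base_point_free v : locus canonical_model v ->
  exists k, (k < 3)%N /\ eval_forms (quadric_forms k) v != 0.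
Proof.
move=> /canonical_modelP[v0 _ _]; apply: NNPP => h.
have q0 k i : (k < 3)%N -> (i < 3)%N ->
    (quadrics k (v 0 (inord 0)) (v 0 (inord 1)) (v 0 (inord 2)) (v 0 (inord 3)))`_i = 0.
  move=> k3 i3; apply/eqP; apply: contraT => qi; case: h; exists k; split=> //.
  by rewrite eval_quadric_forms; apply: vec_neq0 qi.
have v_eq0 : v 0 (inord 0) = 0 -> v 0 (inord 1) = 0 -> v 0 (inord 2) = 0 ->
    v 0 (inord 3) = 0 -> False.
  move=> z0 z1 z2 z3; move/eqP: v0; apply.
  by apply: row_inordP => -[|[|[|[|//]]]] _; rewrite mxE.
move: (v 0 (inord 0)) (v 0 (inord 1)) (v 0 (inord 2)) (v 0 (inord 3)) q0 v_eq0.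
move=> n1 n2 n3 n4 q0 v_eq0.
have sq0 (x : algC) : x ^+ 2 = 0 -> x = 0 by move=> /eqP; rewrite expf_eq0 => /eqP.
have n10 : n1 = 0.
  apply/eqP; apply: contraT => n1n.
  have /eqP := q0 1%N 1%N isT isT; rewrite /= oppr_eq0 mulf_eq0 (negPf n1n) => /eqP n20.
  have /eqP := q0 2%N 1%N isT isT; rewrite /= oppr_eq0 mulf_eq0 (negPf n1n) => /eqP n30.
  have /eqP := q0 1%N 0%N isT isT; rewrite /= n30 mul0r addr0 expf_eq0 /=.
  by rewrite (negPf n1n).
have /eqP := q0 2%N 0%N isT isT; rewrite /= n10 mul0r add0r oppr_eq0 => /eqP/sq0 n40.
have := q0 0%N 1%N isT isT; rewrite /= n40 mulr0 add0r => /sq0 n30.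
have := q0 0%N 2%N isT isT; rewrite /= n10 mul0r add0r => /sq0 n20.
exact: v_eq0.
Qed.

Lemma cubics_quadrics k v : locus canonical_model v ->
  eval_forms cubic_forms (eval_forms (quadric_forms k) v) != 0 ->
  peq v (eval_forms cubic_forms (eval_forms (quadric_forms k) v)).
Proof.
move=> Xv fv; apply: peq_cross => //; first by case: Xv.
have h2 := dhomog_quadric_forms k.
suff h i j : vanishes (locus canonical_model)
    ('X_i * comp_form (cubic_forms j) (quadric_forms k) -
     'X_j * comp_form (cubic_forms i) (quadric_forms k)).
  move=> i j; have /eqP := h i j v Xv.
  by rewrite mevalB !mevalM !mevalXU !meval_comp_form subr_eq0 !mxE => /eqP.
apply: vanishes_generic => [|a c e].
  exists (1 + 3 * 2)%N; apply: rpredB; apply: (dhomogM (dhomogXU _));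
    by apply: dhomog_comp_form => //; apply: dhomog_cubic_forms.
rewrite mevalB !mevalM !mevalXU !meval_comp_form; apply/eqP; rewrite subr_eq0; apply/eqP.
have h := @cross_lt 3 (generic_point a c)
  (eval_forms cubic_forms (eval_forms (quadric_forms k) (generic_point a c))).
have {}h := h _ i j; move: h; rewrite [eval_forms cubic_forms _ _ i]mxE.
rewrite [eval_forms cubic_forms _ _ j]mxE; apply.
move=> {}i {}j ij j4; rewrite eval_cubic_forms eval_quadric_forms !vecE ?(ltn_trans ij) //.
clear fv h2; case: k => [|[|k]];
by case: i j ij j4 => [|[|[|[|i]]]] [|[|[|[|j]]]] //= _ _; ring: e.
Qed.

(** The quadric of N pulls back to the sextic itself, while the cubic of N vanishes identically on
    the four cubics: cubics through six points map the plane to a cubic surface, here the Clebsch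
    surface sum x_i = sum x_i^3 = 0. *)
Lemma cubics_canonical w : locus hulek_craig_plane w -> eval_forms cubic_forms w != 0 ->
  locus canonical_model (eval_forms cubic_forms w).
Proof.
move=> /hulek_craigP[_ e] w0; apply/canonical_modelP; split=> //.
  by rewrite eval_cubic_forms !vecE //= -[RHS]e; ring.
by rewrite eval_cubic_forms !vecE //=; ring.
Qed.

Lemma quadrics_cubics k w : locus hulek_craig_plane w ->
  eval_forms (quadric_forms k) (eval_forms cubic_forms w) != 0 ->
  peq w (eval_forms (quadric_forms k) (eval_forms cubic_forms w)).
Proof.
move=> /hulek_craigP[w0 e] qw; apply: peq_cross => //; apply: cross_lt => i j ij j3.
rewrite eval_quadric_forms eval_cubic_forms !vecE ?(ltn_trans ij) //.
apply/eqP; rewrite -subr_eq0; apply/eqP.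
clear qw w0; case: k => [|[|k]]; case: i j ij j3 => [|[|[|i]]] [|[|[|j]]] //= _ _;
move: (w 0 (inord 0)) (w 0 (inord 1)) (w 0 (inord 2)) e => x y z e;
(* Each 2 by 2 minor is identically zero, or the sextic times - y or - z. *)
by [ring|rewrite -[RHS](mulr0 (- y)) -e; ring|rewrite -[RHS](mulr0 (- z)) -e; ring].
Qed.

Definition desingularization_map (v : 'rV[algC]_4) : 'rV[algC]_3 :=
  if eval_forms (quadric_forms 0) v != 0 then eval_forms (quadric_forms 0) v
  else if eval_forms (quadric_forms 1) v != 0 then eval_forms (quadric_forms 1) v
  else eval_forms (quadric_forms 2) v.

Lemma desingularization_mapP v : locus canonical_model v ->
  exists k, eval_forms (quadric_forms k) v != 0 /\
    desingularization_map v = eval_forms (quadric_forms k) v.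
Proof.
move=> Xv; rewrite /desingularization_map.
have [q0|q0] := boolP (eval_forms (quadric_forms 0) v != 0); first by exists 0%N.
have [q1|q1] := boolP (eval_forms (quadric_forms 1) v != 0); first by exists 1%N.
have [k [k3 qk]] := quadrics_base_point_free Xv; exists 2%N; split=> //.
by case: k k3 qk q0 q1 => [|[|[|//]]] _ // ->.
Qed.

Lemma desingularization_mapE k v : locus canonical_model v ->
  eval_forms (quadric_forms k) v != 0 ->
  peq (eval_forms (quadric_forms k) v) (desingularization_map v).
Proof.
by move=> Xv kv; have [l [lv ->]] := desingularization_mapP Xv; apply: quadrics_agree.
Qed.

Lemma desingularization_morphism :
  morphism rationals (locus canonical_model) (locus hulek_craig_plane) desingularization_map.
Proof.
split=> v Xv; have [k [kv E]] := desingularization_mapP Xv.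
  by rewrite E; apply: quadrics_hulek_craig.
exists (quadric_forms k); split=> // [|u Xu ku]; first exact: quadric_forms_over.
exact: desingularization_mapE.
Qed.

(** Where some cubic is nonzero, the cubics provide a preimage. The remaining points are the six
    nodes [1 : 0 : 0] and [1 : t : 1/t] with t^5 = 1, for which one is written down. Nodes matter
    later, because the forms inverse to an arbitrary desingularization are only known to be nonzero
    at some point of the sextic. *)
Lemma desingularization_map_surjective w : locus hulek_craig_plane w ->
  exists2 v, locus canonical_model v & peq (desingularization_map v) w.
Proof.
move=> Cw; have [f0|f0] := eqVneq (eval_forms cubic_forms w) 0; last first.
  have Xf := cubics_canonical Cw f0; exists (eval_forms cubic_forms w) => //.
  have [k [kf E]] := desingularization_mapP Xf.
  by rewrite E; apply/peq_sym/quadrics_cubics.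
have /hulek_craigP[w0 _] := Cw.
have f_ k : (k < 4)%N ->
    (cubics (w 0 (inord 0)) (w 0 (inord 1)) (w 0 (inord 2)))`_k = 0.
  by move=> k4; rewrite -(vecE _ k4) -eval_cubic_forms f0 mxE.
have pre v k : locus canonical_model v -> eval_forms (quadric_forms k) v != 0 ->
    peq (eval_forms (quadric_forms k) v) w ->
    exists2 v, locus canonical_model v & peq (desingularization_map v) w.
  move=> Xv kv kw; exists v => //.
  exact: peq_trans (peq_sym (desingularization_mapE Xv kv)) kw.
have := (f_ 0%N isT, f_ 1%N isT, f_ 2%N isT, f_ 3%N isT); rewrite /=.
have wE : w = vec 2 [:: w 0 (inord 0); w 0 (inord 1); w 0 (inord 2)].
  by apply: row_inordP => -[|[|[|//]]] _; rewrite vecE.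
move: wE w0; move: (w 0 (inord 0)) (w 0 (inord 1)) (w 0 (inord 2)) => x y z wE w0.
move=> [[[f1 f2] f3] f4].
have [q0|q0] := eqVneq (x ^+ 2 - y * z) 0; last first.
  have y0 : y = 0 by move/eqP: f1; rewrite mulf_eq0 (negPf q0) orbF => /eqP.
  have z0 : z = 0 by move/eqP: f4; rewrite oppr_eq0 mulf_eq0 (negPf q0) orbF => /eqP.
  have x0 : x != 0.
    apply: contraNneq w0 => x0; rewrite wE x0 y0 z0.
    by apply/eqP/row_inordP => -[|[|[|//]]] _; rewrite vecE // mxE.
  apply: (pre (e_ 0) 1%N); first exact: canonical_e.
    rewrite eval_quadric_forms; apply: (@vec_neq0 _ _ 0); rewrite //= !vecE //=.
    by rewrite mul0r expr1n addr0 oner_neq0.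
  exists x => //; rewrite wE y0 z0; apply: row_inordP => -[|[|[|//]]] _;
  by rewrite [RHS]mxE eval_quadric_forms !vecE //=; ring.
have sq0 n (t : algC) : t ^+ n.+1 = 0 -> t = 0 by move=> /eqP; rewrite expf_eq0 => /eqP.
have x0 : x != 0.
  apply: contraNneq w0 => x0; rewrite wE.
  have z0 : z = 0 by apply: (@sq0 2); rewrite -[RHS]f2 x0; ring.
  have y0 : y = 0 by apply: (@sq0 2); apply: oppr_inj; rewrite oppr0 -[RHS]f3 x0; ring.
  by rewrite x0 y0 z0; apply/eqP/row_inordP => -[|[|[|//]]] _; rewrite vecE // mxE.
have y0 : y != 0.
  by apply: contraNneq x0 => y0; apply/eqP/(@sq0 1); rewrite -[RHS]q0 y0; ring.
(* The roots are (3 + sqrt 5) / 2 and (3 - sqrt 5) / 2. Each of them gives, through v below, a point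
   of N above the node [1 : t : 1/t]. *)
have [th thE] : exists th : algC, th ^+ 2 - 3%:R * th + 1 = 0.
  have /closed_rootP[th] : size ('X^2 + (- (3%:R *: 'X) + 1) : {poly algC}) != 1%N.
    rewrite size_polyDl size_polyXn //; apply: leq_ltn_trans (size_polyD _ _) _.
    rewrite gtn_max size_polyN size_poly1 andbT.
    by apply: leq_ltn_trans (size_scale_leq _ _) _; rewrite size_polyX.
  by rewrite /root !hornerE => /eqP th0; exists th; rewrite -[RHS]th0.
have th1 : th + 1 != 0.
  apply/eqP => /eqP; rewrite addr_eq0 => /eqP e; move/eqP: thE; rewrite e.
  rewrite (_ : _ + 1 = 5%:R); last by ring.
  by rewrite Num.Theory.pnatr_eq0.
have th2 : 3%:R - 2%:R * th != 0.
  apply/eqP => e.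
  have : 4%:R * (th ^+ 2 - 3%:R * th + 1) = (3%:R - 2%:R * th) ^+ 2 - 5%:R by ring.
  rewrite e thE mulr0 expr0n sub0r => /eqP.
  by rewrite eq_sym oppr_eq0 Num.Theory.pnatr_eq0.
have [t t0 yE] : exists2 t, t != 0 & y = t * x.
  by exists (y / x); rewrite ?mulf_neq0 ?invr_eq0 // mulfVK.
have zE : z = x / t.
  have yz : y * z = x ^+ 2 by rewrite -[LHS]addr0 -q0; ring.
  by apply: (mulfI y0); rewrite yz {1}yE; field.
have t5 : t ^+ 5 = 1.
  have e : x ^+ 3 * (t ^+ 5 - 1) = 0.
    rewrite -[RHS](mulr0 (- t ^+ 3)) -f2 zE yE; field.
    by [].
  by apply/eqP; move/eqP: e; rewrite mulf_eq0 expf_eq0 (negPf x0) subr_eq0.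
pose v := vec 3 [:: - (th + 1) * t; (3%:R - 2%:R * th) * t ^+ 2;
                    (2%:R - 3%:R * th) * t ^+ 3; (th + 1) * t ^+ 4].
have th2E : th ^+ 2 = 3%:R * th - 1 by apply/eqP; rewrite -subr_eq0 -[X in _ == X]thE; apply/eqP; ring.
apply: (pre v 1%N).
- apply/canonical_modelP; split; rewrite ?vecE //=.
  + by apply: (@vec_neq0 _ _ 0) => //=; rewrite mulf_neq0 ?oppr_eq0.
  + by ring: th2E t5.
  + by ring: th2E t5.
- rewrite eval_quadric_forms; apply: (@vec_neq0 _ _ 1) => //.
  by rewrite !vecE //= oppr_eq0 !mulf_neq0 ?oppr_eq0 ?expf_neq0.
exists (x / ((th + 1) * (3%:R - 2%:R * th) * t ^+ 2)).
  by rewrite mulf_neq0 ?invr_eq0 // !mulf_neq0 ?expf_neq0.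
rewrite {1}wE zE yE; apply: row_inordP => -[|[|[|//]]] _;
  rewrite [RHS]mxE eval_quadric_forms !vecE //=.
- have -> : (- (th + 1) * t) ^+ 2 + (2%:R - 3%:R * th) * t ^+ 3 * ((th + 1) * t ^+ 4) =
    (th + 1) * (3%:R - 2%:R * th) * t ^+ 2 by ring: t5.
  by rewrite divfK // !mulf_neq0 ?expf_neq0.
- by field; rewrite ?th1 ?th2 ?t0.
- have -> : (3%:R - 2%:R * th) * t ^+ 2 * ((th + 1) * t ^+ 4) =
    (3%:R - 2%:R * th) * (th + 1) * t by ring: t5.
  by field; rewrite ?th1 ?th2 ?t0.
Qed.

(* The point a^5 = 4/3, c = 2. *)
Lemma cubics_quadrics_neq0 : exists2 v, locus canonical_model v &
  forall k, eval_forms cubic_forms (eval_forms (quadric_forms k) v) != 0.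
Proof.
have nz k : (k.+1%:R : algC) != 0 by rewrite Num.Theory.pnatr_eq0.
have [a a5] : exists a : algC, a ^+ 5 = 4%:R / 3%:R.
  have /closed_rootP[a] : size ('X^5 - (4%:R / 3%:R : algC)%:P) != 1%N by rewrite size_XnsubC.
  by rewrite /root !hornerE subr_eq0 => /eqP aE; exists a.
have a0 : a != 0.
  have : a ^+ 5 != 0 by rewrite a5 mulf_neq0 ?invr_eq0 ?nz.
  by rewrite expf_eq0.
exists (generic_point a 2%:R).
  by apply: generic_point_canonical => //; rewrite horner_kummer a5; field.
move=> k; rewrite eval_cubic_forms; apply: (@vec_neq0 _ _ 0) => //.
rewrite eval_quadric_forms !vecE //=.
case: k => [|[|k]] /=.
- rewrite [X in X != 0](_ : _ = (a ^+ 5 + 4%:R) *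
      (16%:R * a * a ^+ 5 - (a ^+ 5 + 4%:R) * (a * a ^+ 5 - 4%:R * a))); last by ring.
  rewrite a5 [X in X != 0](_ : _ * _ = (16%:R / 3%:R) * (320%:R / 9%:R) * a); last by field.
  by rewrite !mulf_neq0 ?invr_eq0 // ?(nz 15%N) ?(nz 2%N) ?(nz 319%N) ?(nz 8%N).
- rewrite [X in X != 0](_ : _ = - (2%:R * a ^+ 8 * (4%:R + 2%:R * a ^+ 5))); last by ring.
  rewrite a5 (_ : _ + _ = 20%:R / 3%:R); last by field.
  by rewrite oppr_eq0 !mulf_neq0 ?invr_eq0 ?expf_neq0 // ?(nz 1%N) ?(nz 2%N) ?(nz 19%N).
- rewrite [X in X != 0](_ : _ = 4%:R * a ^+ 4 * (9%:R * a ^+ 5 + 8%:R)); last by ring.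
  rewrite a5 (_ : _ + _ = 20%:R); last by field.
  by rewrite !mulf_neq0 ?expf_neq0 // ?(nz 3%N) ?(nz 19%N).
Qed.

(** * Uniqueness of the desingularization *)

Lemma eval_forms_peq k n m (F : 'I_m.+1 -> {mpoly algC[n.+1]}) u v :
  forms_over k F -> peq u v -> peq (eval_forms F u) (eval_forms F v).
Proof.
move=> [d hF] [c c0 ->]; exists (c ^+ d); first by rewrite expf_neq0.
by apply: eval_formsZ => j; case: (hF j).
Qed.

Lemma eval_forms_neq0 k n m (F : 'I_m.+1 -> {mpoly algC[n.+1]}) u v :
  forms_over k F -> peq u v -> eval_forms F u != 0 -> eval_forms F v != 0.
Proof. by move=> hF uv; apply: peq_neq0; apply: eval_forms_peq hF uv. Qed.

Lemma canonical_regular : regular_curve canonical_model.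
Proof.
split; [exact: canonical_model_forms|exact: canonical_smooth|exact: canonical_prime|].
exact: canonical_dependent.
Qed.

Lemma canonical_desingularization :
  desingularization rationals canonical_model hulek_craig_plane desingularization_map.
Proof.
split.
  split; [exact: canonical_model_forms|exact: canonical_irreducible|
          exact: canonical_dimension|exact: canonical_smooth].
split; first exact: desingularization_morphism.
exists cubic_forms; split; first exact: cubic_forms_over.
- have [v Xv fv] := cubics_quadrics_neq0.
  have [k [kv _]] := desingularization_mapP Xv.
  by exists (eval_forms (quadric_forms k) v); [apply: quadrics_hulek_craig|apply: fv].
- move=> w Cw fw; have Xf := cubics_canonical Cw fw; split=> //.
  by have [k [kf ->]] := desingularization_mapP Xf; apply: quadrics_cubics.
- move=> v Xv; have [k [kv ->]] := desingularization_mapP Xv; exact: cubics_quadrics.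
Qed.

(* The composite form, multiplied by a coordinate so as to vanish where F does. *)
Definition comp_forms n m l (a : 'I_m.+1) (G : 'I_l.+1 -> {mpoly algC[m.+1]})
    (F : 'I_m.+1 -> {mpoly algC[n.+1]}) (i : 'I_l.+1) : {mpoly algC[n.+1]} :=
  F a * comp_form (G i) F.

Lemma eval_comp_forms n m l (a : 'I_m.+1) (G : 'I_l.+1 -> {mpoly algC[m.+1]})
    (F : 'I_m.+1 -> {mpoly algC[n.+1]}) (u : 'rV_n.+1) :
  eval_forms (comp_forms a G F) u = (F a).@[u 0] *: eval_forms G (eval_forms F u).
Proof. by apply/rowP => i; rewrite !mxE mevalM meval_comp_form. Qed.

Lemma comp_formsP n m l (a : 'I_m.+1) (G : 'I_l.+1 -> {mpoly algC[m.+1]})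
    (F : 'I_m.+1 -> {mpoly algC[n.+1]}) (u : 'rV_n.+1) :
  eval_forms (comp_forms a G F) u != 0 ->
  [/\ eval_forms F u != 0, eval_forms G (eval_forms F u) != 0
    & peq (eval_forms G (eval_forms F u)) (eval_forms (comp_forms a G F) u)].
Proof.
rewrite eval_comp_forms scaler_eq0 negb_or => /andP[Fa GF]; split=> //.
  by apply/rV_neq0P; exists a; rewrite mxE.
by exists (F a).@[u 0].
Qed.

Lemma comp_forms_over n m l (a : 'I_m.+1) (G : 'I_l.+1 -> {mpoly algC[m.+1]})
    (F : 'I_m.+1 -> {mpoly algC[n.+1]}) :
  forms_over rationals G -> forms_over rationals F -> forms_over rationals (comp_forms a G F).
Proof.
have [Q1 Q0] : rationals 1 /\ rationals 0 by split; [apply: rpred1|apply: rpred0].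
have QD x y : rationals x -> rationals y -> rationals (x + y) by apply: rpredD.
have QM x y : rationals x -> rationals y -> rationals (x * y) by apply: rpredM.
move=> [e hG] [d hF]; exists (d + e * d)%N => i; split.
  apply: dhomogM; first by case: (hF a).
  by apply: dhomog_comp_form => [|j]; [case: (hG i)|case: (hF j)].
apply: overM => //; first by case: (hF a).
by apply: over_comp_form => // [|j]; [case: (hG i)|case: (hF j)].
Qed.

Section Uniqueness.

Variables (n : nat) (X : seq {mpoly algC[n.+1]}) (pi : 'rV[algC]_n.+1 -> 'rV[algC]_3).
Hypothesis X_desing : desingularization rationals X hulek_craig_plane pi.

(** F follows the quadrics by the forms [GX] inverse to pi, and G follows forms P for pi around one
    point by the cubics. The two are inverse to each other where both are defined. *)
Lemma canonical_isomorphic : isomorphic rationals (locus canonical_model) (locus X).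
Proof.
have [[hX irrX _ smX] [pi_mor [GX [hGX [w0 Cw0 Gw0] GC GV]]]] := X_desing.
have hX' p ps := (hX p ps).1.
have prX := irreducible_prime (closed_locus hX') irrX.
have [n0 Nn0 n0w0] := desingularization_map_surjective Cw0.
have [k [kn0 pin0]] := desingularization_mapP Nn0; rewrite {}pin0 in n0w0.
have hQ := quadric_forms_over k; have hC := cubic_forms_over.
have [a Qa] := (rV_neq0P _).1 kn0; rewrite mxE in Qa.
pose F := comp_forms a GX (quadric_forms k).
have hF : forms_over rationals F by apply: comp_forms_over.
have Fn0 : eval_forms F n0 != 0.
  rewrite eval_comp_forms scaler_eq0 negb_or Qa /=.
  by apply: eval_forms_neq0 hGX (peq_sym n0w0) Gw0.
have FX u : locus canonical_model u -> eval_forms F u != 0 ->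
    [/\ locus X (eval_forms F u), eval_forms (quadric_forms k) u != 0,
        peq (eval_forms GX (eval_forms (quadric_forms k) u)) (eval_forms F u)
      & peq (eval_forms (quadric_forms k) u) (pi (eval_forms F u))].
  move=> Nu /comp_formsP[ku Gku GF]; have Ck := quadrics_hulek_craig Nu ku.
  have [XG wG] := GC _ Ck Gku; have XF := peq_cone (closed_cone (closed_locus hX')) GF XG.
  by split=> //; apply: peq_trans wG (morphism_peq pi_mor XG XF GF).
(* The forms P only represent pi near a chosen point, so that point must be one from which the
   cubics lead back to N. Two nonempty open subsets of N meet by primality, which provides [n1] and
   its image [x1]. *)
have [n1 [Nn1 Fn1 fn1]] : exists n1, [/\ locus canonical_model n1, eval_forms F n1 != 0
    & eval_forms cubic_forms (eval_forms (quadric_forms k) n1) != 0].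
  have [n2 Nn2 /(_ k)/rV_neq0P[c]] := cubics_quadrics_neq0.
  rewrite mxE -meval_comp_form => fc.
  have [b Fb] := (rV_neq0P _).1 Fn0; rewrite mxE in Fb.
  have : ~ vanishes (locus canonical_model) (F b * comp_form (cubic_forms c) (quadric_forms k)).
    by apply: (not_vanishesM canonical_prime); apply/not_vanishesP; [exists n0|exists n2].
  move=> /not_vanishesP[n1 Nn1]; rewrite mevalM meval_comp_form mulf_eq0 negb_or => /andP[Fb1 fc1].
  by exists n1; split=> //; apply/rV_neq0P; [exists b|exists c]; rewrite mxE.
have [Xx1 kn1 GFx1 pix1] := FX n1 Nn1 Fn1; set x1 := eval_forms F n1 in Xx1 GFx1 pix1.
have [P [hP Px1 Ppi]] := pi_mor.2 x1 Xx1.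
have [b Pb] := (rV_neq0P _).1 Px1; rewrite mxE in Pb.
pose G := comp_forms b cubic_forms P.
have hG : forms_over rationals G by apply: comp_forms_over.
have Gx1 : eval_forms G x1 != 0.
  rewrite eval_comp_forms scaler_eq0 negb_or Pb /=.
  apply: eval_forms_neq0 hC _ fn1.
  by apply: peq_trans pix1 (peq_sym (Ppi _ Xx1 Px1)).
have clC : cone (locus hulek_craig_plane).
  by apply: closed_cone; apply: closed_locus => p ps; exists 6%N; apply: dhomog_hulek_craig.
have clN : cone (locus canonical_model).
  by apply: closed_cone; apply: closed_locus => q /canonical_model_forms[].
have GN x : locus X x -> eval_forms G x != 0 ->
    [/\ locus hulek_craig_plane (eval_forms P x), peq (eval_forms P x) (pi x),
        locus canonical_model (eval_forms G x)
      & peq (eval_forms cubic_forms (eval_forms P x)) (eval_forms G x)].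
  move=> Xx /comp_formsP[Px fPx fG]; have Ppix := Ppi x Xx Px.
  have CP := peq_cone clC (peq_sym Ppix) (pi_mor.1 x Xx).
  by split=> //; apply: peq_cone clN fG (cubics_canonical CP fPx).
have GF u : locus canonical_model u -> eval_forms F u != 0 ->
    eval_forms G (eval_forms F u) != 0 -> peq u (eval_forms G (eval_forms F u)).
  move=> Nu Fu GFu; have [XF ku _ piF] := FX u Nu Fu.
  have [CP Ppix _ fG] := GN _ XF GFu.
  have [_ fPF _] := comp_formsP GFu.
  have kP := peq_trans piF (peq_sym Ppix).
  apply: peq_trans fG; apply: peq_trans (eval_forms_peq hC kP).
  by apply: cubics_quadrics => //; apply: eval_forms_neq0 hC (peq_sym kP) fPF.
have FG x : locus X x -> eval_forms G x != 0 -> eval_forms F (eval_forms G x) != 0 ->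
    peq x (eval_forms F (eval_forms G x)).
  move=> Xx Gx FGx; have [CP Ppix NG fG] := GN x Xx Gx.
  have [_ kG GkF _] := FX _ NG FGx; have [_ GkG _] := comp_formsP FGx.
  have kf : peq (eval_forms P x) (eval_forms (quadric_forms k) (eval_forms G x)).
    apply: peq_trans (eval_forms_peq hQ fG).
    by apply: quadrics_cubics => //; apply: eval_forms_neq0 hQ (peq_sym fG) kG.
  have pik := peq_trans (peq_sym Ppix) kf.
  apply: peq_trans GkF; apply: peq_trans (eval_forms_peq hGX pik).
  by apply: GV => //; apply: eval_forms_neq0 hGX (peq_sym pik) GkG.
have n1x1 : peq n1 (eval_forms G x1) by apply: GF.
have FGx1 : eval_forms F (eval_forms G x1) != 0 by apply: eval_forms_neq0 hF n1x1 Fn1.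
(* Where G and F after G are nonzero, a point of X is the image under F of a point of N, so the
   dependence is inherited. *)
have depX : functions_dependent (locus X).
  have [c Gc] := (rV_neq0P _).1 Gx1; have [d Fd] := (rV_neq0P _).1 FGx1.
  rewrite mxE in Gc; rewrite mxE -meval_comp_form in Fd; have [e hFe] := hF.
  apply: (@functions_dependent_image _ _ _ _ e F (G c * comp_form (F d) G)
    canonical_dependent _ prX) => [j||x Xx].
  - by case: (hFe j).
  - apply/not_vanishesP; exists x1 => //; rewrite mevalM mulf_neq0 //.
  rewrite mevalM meval_comp_form mulf_eq0 negb_or => /andP[Gcx Fdx].
  have Gx : eval_forms G x != 0 by apply/rV_neq0P; exists c; rewrite mxE.
  have FGx : eval_forms F (eval_forms G x) != 0 by apply/rV_neq0P; exists d; rewrite mxE.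
  exists (eval_forms G x); first by have [] := GN x Xx Gx.
  exact/peq_sym/FG.
have regX : regular_curve X by split.
apply: (birational_isomorphic canonical_regular regX hF hG) => //.
- by move=> u Nu Fu; have [] := FX u Nu Fu.
- by move=> x Xx Gx; have [] := GN x Xx Gx.
- by exists n1.
- by exists x1.
Qed.

End Uniqueness.

(** * The linear isomorphisms *)

Definition table m n (t : seq (seq algC)) : 'M[algC]_(m.+1, n.+1) :=
  \matrix_(i, j) (nth [::] t i)`_j.

Lemma mul_table4 n t (v : 'rV[algC]_4) k : (k < n.+1)%N ->
  (v *m table 3 n t) 0 (inord k) = v 0 (inord 0) * (nth [::] t 0)`_k + v 0 (inord 1) * (nth [::] t 1)`_k
    + v 0 (inord 2) * (nth [::] t 2)`_k + v 0 (inord 3) * (nth [::] t 3)`_k.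
Proof.
move=> kn; rewrite mxE !big_ord_recl big_ord0 !mxE addr0 !addrA inordK //=.
by congr (v 0 _ * _ + v 0 _ * _ + v 0 _ * _ + v 0 _ * _); apply: val_inj; rewrite /= inordK.
Qed.

Lemma mul_table5 n t (v : 'rV[algC]_5) k : (k < n.+1)%N ->
  (v *m table 4 n t) 0 (inord k) = v 0 (inord 0) * (nth [::] t 0)`_k + v 0 (inord 1) * (nth [::] t 1)`_k
    + v 0 (inord 2) * (nth [::] t 2)`_k + v 0 (inord 3) * (nth [::] t 3)`_k
    + v 0 (inord 4) * (nth [::] t 4)`_k.
Proof.
move=> kn; rewrite mxE !big_ord_recl big_ord0 !mxE addr0 !addrA inordK //=.
by congr (v 0 _ * _ + v 0 _ * _ + v 0 _ * _ + v 0 _ * _ + v 0 _ * _);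
  apply: val_inj; rewrite /= inordK.
Qed.

Lemma modular_modelP v : locus modular_model v <-> [/\ v != 0,
  - (v 0 (inord 0) ^+ 2 + v 0 (inord 1) ^+ 2)
    + 2%:R * (v 0 (inord 2) ^+ 2 + v 0 (inord 3) ^+ 2) = 0
  & v 0 (inord 0) ^+ 3 + v 0 (inord 0) * v 0 (inord 1) ^+ 2 + 2%:R * v 0 (inord 1) ^+ 3
    - 4%:R * (v 0 (inord 0) * v 0 (inord 2) ^+ 2)
    - 8%:R * (v 0 (inord 0) * v 0 (inord 2) * v 0 (inord 3)) = 0].
Proof.
have E0 : (modular_model`_0).@[v 0] = - (v 0 (inord 0) ^+ 2 + v 0 (inord 1) ^+ 2)
    + 2%:R * (v 0 (inord 2) ^+ 2 + v 0 (inord 3) ^+ 2).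
  by rewrite /= !(mevalN, mevalD, mevalM, rmorphXn, mevalMn, meval1) /= !mevalXU.
have E1 : (modular_model`_1).@[v 0] =
    v 0 (inord 0) ^+ 3 + v 0 (inord 0) * v 0 (inord 1) ^+ 2 + 2%:R * v 0 (inord 1) ^+ 3
    - 4%:R * (v 0 (inord 0) * v 0 (inord 2) ^+ 2)
    - 8%:R * (v 0 (inord 0) * v 0 (inord 2) * v 0 (inord 3)).
  by rewrite /= !(mevalB, mevalD, mevalM, rmorphXn, mevalMn, meval1) /= !mevalXU.
split=> [[v0 vs]|[v0 e0 e1]].
  by split=> //; [rewrite -E0|rewrite -E1]; apply: vs; rewrite !inE eqxx ?orbT.
by split=> // p; rewrite !inE => /orP[] /eqP->; [rewrite -[RHS]e0 -E0|rewrite -[RHS]e1 -E1].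
Qed.

Lemma table_in (k : algC -> Prop) m n (t : seq (seq algC)) : k 0 ->
  (forall r x, r \in t -> x \in r -> k x) -> forall i j, k (table m n t i j).
Proof.
move=> k0 kt i j; rewrite mxE.
have [ti|ti] := ltnP i (size t); last by rewrite (nth_default _ ti) nth_nil.
have [tj|tj] := ltnP j (size (nth [::] t i)); last by rewrite nth_default.
by apply: (kt (nth [::] t i)); apply: mem_nth.
Qed.

Lemma mulmx_inj_neq0 m n (A : 'M[algC]_(m, n)) (B : 'M[algC]_(n, m)) (v : 'rV_m) :
  v *m A *m B = v -> v != 0 -> v *m A != 0.
Proof. by move=> vAB; apply: contraNneq => vA; rewrite -vAB vA mul0mx. Qed.

(** Eigenvectors of the involution of N that exchanges y_j and y_(5-j): the coordinates x and y are
    invariant, z and w change sign. *)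
Definition to_modular := table 3 3
  [:: [:: 1; 1; 1; 0]; [:: -1; 1; 0; 1]; [:: -1; 1; 0; -1]; [:: 1; 1; -1; 0]].

Definition of_modular : 'M[algC]_4 :=
  let q := 4%:R^-1 in let h := 2%:R^-1 in
  table 3 3 [:: [:: q; - q; - q; q]; [:: q; q; q; q]; [:: h; 0; 0; - h]; [:: 0; h; - h; 0]].

Lemma to_modularK (v : 'rV_4) : v *m to_modular *m of_modular = v.
Proof.
by apply: row_inordP => -[|[|[|[|//]]]] _; rewrite mul_table4 // !mul_table4 //=; field.
Qed.

Lemma of_modularK (v : 'rV_4) : v *m of_modular *m to_modular = v.
Proof.
by apply: row_inordP => -[|[|[|[|//]]]] _; rewrite mul_table4 // !mul_table4 //=; field.
Qed.

Lemma canonical_modular : isomorphic rationals (locus canonical_model) (locus modular_model).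
Proof.
have Q0 : rationals 0 by apply: rpred0.
have Qin x : x \in Crat -> rationals x by [].
have Q1 : rationals 1 by apply: rpred1.
have QD x y : rationals x -> rationals y -> rationals (x + y) by apply: rpredD.
have QM x y : rationals x -> rationals y -> rationals (x * y) by apply: rpredM.
have toX v : locus modular_model (v *m to_modular) <-> locus canonical_model v.
  have Q2 : - (8%:R * (v 0 (inord 0) * v 0 (inord 3) + v 0 (inord 1) * v 0 (inord 2))) =
    - ((v *m to_modular) 0 (inord 0) ^+ 2 + (v *m to_modular) 0 (inord 1) ^+ 2)
    + 2%:R * ((v *m to_modular) 0 (inord 2) ^+ 2 + (v *m to_modular) 0 (inord 3) ^+ 2).
    by rewrite !mul_table4 //=; ring.
  (* The two cubics correspond only modulo the quadric, with multiplier x + y. *)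
  have Q3 : 16%:R * (v 0 (inord 0) ^+ 2 * v 0 (inord 2) + v 0 (inord 0) * v 0 (inord 1) ^+ 2
      + v 0 (inord 2) ^+ 2 * v 0 (inord 3) + v 0 (inord 1) * v 0 (inord 3) ^+ 2)
      + ((v *m to_modular) 0 (inord 0) + (v *m to_modular) 0 (inord 1))
        * (8%:R * (v 0 (inord 0) * v 0 (inord 3) + v 0 (inord 1) * v 0 (inord 2))) =
    (v *m to_modular) 0 (inord 0) ^+ 3
    + (v *m to_modular) 0 (inord 0) * (v *m to_modular) 0 (inord 1) ^+ 2
    + 2%:R * (v *m to_modular) 0 (inord 1) ^+ 3
    - 4%:R * ((v *m to_modular) 0 (inord 0) * (v *m to_modular) 0 (inord 2) ^+ 2)
    - 8%:R * ((v *m to_modular) 0 (inord 0) * (v *m to_modular) 0 (inord 2)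
              * (v *m to_modular) 0 (inord 3)).
    by rewrite !mul_table4 //=; ring.
  split=> [/modular_modelP[w0 e0 e1]|/canonical_modelP[v0 e0 e1]].
    have q0 : v 0 (inord 0) * v 0 (inord 3) + v 0 (inord 1) * v 0 (inord 2) = 0.
      apply/eqP; move/eqP: e0; rewrite -Q2 oppr_eq0 mulf_eq0.
      by rewrite Num.Theory.pnatr_eq0.
    apply/canonical_modelP; split=> //.
      by apply: contraNneq w0 => ->; rewrite mul0mx.
    apply/eqP; move/eqP: e1; rewrite -Q3 q0 !mulr0 addr0 mulf_eq0.
    by rewrite Num.Theory.pnatr_eq0.
  apply/modular_modelP; split.
  - exact: mulmx_inj_neq0 (to_modularK v) v0.
  - by rewrite -Q2 e0 mulr0 oppr0.
  - by rewrite -Q3 e0 e1 !mulr0 addr0.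
have inQ (t : seq (seq algC)) : all (all (fun x => x \in Crat)) t ->
    forall r x, r \in t -> x \in r -> rationals x.
  by move=> /allP ht r x /ht /allP hr /hr.
have QV n : (n%:R^-1 : algC) \in Crat by rewrite rpredV rpred_nat.
apply: (@linear_isomorphic rationals Q1 Q0 QD QM _ _ _ _ to_modular of_modular).
- apply: table_in => //; apply: inQ.
  by rewrite /= !(rpredN, rpred1, rpred0).
- apply: table_in => //; apply: inQ.
  by rewrite /= !(rpredN, rpred0) !QV.
- by move=> v [].
- by move=> v [].
- by move=> v /toX.
- by move=> w Mw; apply/toX; rewrite of_modularK.
- by move=> v _; apply: to_modularK.
- by move=> v _; apply: of_modularK.
Qed.

Lemma bringP v : locus bring v <-> [/\ v != 0,
  v 0 (inord 0) + v 0 (inord 1) + v 0 (inord 2) + v 0 (inord 3) + v 0 (inord 4) = 0,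
  v 0 (inord 0) ^+ 2 + v 0 (inord 1) ^+ 2 + v 0 (inord 2) ^+ 2 + v 0 (inord 3) ^+ 2
    + v 0 (inord 4) ^+ 2 = 0
  & v 0 (inord 0) ^+ 3 + v 0 (inord 1) ^+ 3 + v 0 (inord 2) ^+ 3 + v 0 (inord 3) ^+ 3
    + v 0 (inord 4) ^+ 3 = 0].
Proof.
have E m : (\sum_(i < 5) 'X_i ^+ m : {mpoly algC[5]}).@[v 0] =
    v 0 (inord 0) ^+ m + v 0 (inord 1) ^+ m + v 0 (inord 2) ^+ m + v 0 (inord 3) ^+ m
    + v 0 (inord 4) ^+ m.
  rewrite meval_sum !big_ord_recl big_ord0 addr0 !addrA.
  by do !congr (_ + _); rewrite rmorphXn /= mevalXU; congr (v 0 _ ^+ _);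
    apply: val_inj; rewrite /= inordK.
have E1 : (\sum_(i < 5) 'X_i : {mpoly algC[5]}) = \sum_(i < 5) 'X_i ^+ 1 by [].
split=> [[v0 vs]|[v0 e1 e2 e3]].
  split=> //.
  - by rewrite -[RHS](vs (\sum_(i < 5) 'X_i)) ?E1 ?E ?expr1 // !inE eqxx.
  - by rewrite -E; apply: vs; rewrite !inE eqxx orbT.
  - by rewrite -E; apply: vs; rewrite !inE eqxx !orbT.
split=> // p; rewrite !inE => /or3P[] /eqP->.
- by rewrite E1 E !expr1.
- by rewrite E.
- by rewrite E.
Qed.

Section Cyclotomic.

Variable z : algC.
Hypothesis hz : 5.-primitive_root z.

Lemma z4E : z ^+ 4 = - 1 - z - z ^+ 2 - z ^+ 3.
Proof.
have z1 : z - 1 != 0.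
  rewrite subr_eq0; apply/eqP => z1; have := prim_order_dvd hz 1.
  by rewrite z1 expr1n eqxx.
apply: (mulfI z1); apply/eqP; rewrite -subr_eq0; apply/eqP.
transitivity (z ^+ 5 - 1); first by ring.
by rewrite (prim_expr_order hz) subrr.
Qed.

Definition fourier : 'M[algC]_(5, 4) := table 4 3
  [seq [seq z ^+ (i * j) | j <- iota 1 4] | i <- iota 0 5].

(** Fourier inversion, with z^4 in place of the inverse of z. The missing frequency j = 0 is the sum
    of the x_i, which is zero on Bring's curve. *)
Definition inverse_fourier : 'M[algC]_(4, 5) := table 3 4
  [seq [seq z ^+ (4 * i * j) / 5%:R | i <- iota 0 5] | j <- iota 1 4].

Lemma inverse_fourierK (v : 'rV_4) : v *m inverse_fourier *m fourier = v.
Proof.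
apply: row_inordP => -[|[|[|[|//]]]] _; rewrite mul_table5 // !mul_table4 //=;
by field: z4E.
Qed.

Lemma fourierK (v : 'rV_5) :
  v 0 (inord 0) + v 0 (inord 1) + v 0 (inord 2) + v 0 (inord 3) + v 0 (inord 4) = 0 ->
  v *m fourier *m inverse_fourier = v.
Proof.
move=> /eqP; rewrite addrC addr_eq0 => /eqP e.
by apply: row_inordP => -[|[|[|[|[|//]]]]] _; rewrite mul_table4 // !mul_table5 //= ?e;
  field: z4E.
Qed.


(** By orthogonality of characters, the sum of the x_i^m is 5^(1-m) times the sum of the products of
    m of the y_j with indices adding up to 0 modulo 5. This gives the quadric with factor 2/5 and
    the cubic with factor 3/25. *)
Lemma bring_inverse_fourier (v : 'rV_4) :
  locus bring (v *m inverse_fourier) <-> locus canonical_model v.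
Proof.
set x := v *m inverse_fourier.
have e1 : x 0 (inord 0) + x 0 (inord 1) + x 0 (inord 2) + x 0 (inord 3) + x 0 (inord 4) = 0.
  by rewrite !mul_table4 //=; field: z4E.
have e2 : x 0 (inord 0) ^+ 2 + x 0 (inord 1) ^+ 2 + x 0 (inord 2) ^+ 2 + x 0 (inord 3) ^+ 2
    + x 0 (inord 4) ^+ 2 =
    2%:R / 5%:R * (v 0 (inord 0) * v 0 (inord 3) + v 0 (inord 1) * v 0 (inord 2)).
  by rewrite !mul_table4 //=; field: z4E.
have e3 : x 0 (inord 0) ^+ 3 + x 0 (inord 1) ^+ 3 + x 0 (inord 2) ^+ 3 + x 0 (inord 3) ^+ 3
    + x 0 (inord 4) ^+ 3 =
    3%:R / 25%:R * (v 0 (inord 0) ^+ 2 * v 0 (inord 2) + v 0 (inord 0) * v 0 (inord 1) ^+ 2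
      + v 0 (inord 2) ^+ 2 * v 0 (inord 3) + v 0 (inord 1) * v 0 (inord 3) ^+ 2).
  by rewrite !mul_table4 //=; field: z4E.
have nz k : (k.+1%:R : algC) != 0 by rewrite Num.Theory.pnatr_eq0.
split=> [/bringP[x0 _ f2 f3]|/canonical_modelP[v0 f2 f3]].
  apply/canonical_modelP; split.
  - by apply: contraNneq x0 => v0; rewrite /x v0 mul0mx.
  - apply: (@mulfI _ (2%:R / 5%:R)); first by rewrite mulf_neq0 ?invr_eq0 ?nz.
    by rewrite mulr0 -e2.
  - apply: (@mulfI _ (3%:R / 25%:R)); first by rewrite mulf_neq0 ?invr_eq0 ?nz.
    by rewrite mulr0 -e3.
apply/bringP; split=> //.
- exact: mulmx_inj_neq0 (inverse_fourierK v) v0.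
- by rewrite e2 f2 mulr0.
- by rewrite e3 f3 mulr0.
Qed.

Let k := rationals_adjoin z.

Lemma adjoin_horner (p : {poly rat}) : k (map_poly ratr p).[z].
Proof. by exists p, 1; rewrite rmorph1 hornerC divr1 oner_neq0. Qed.

Lemma adjoin_ratr (a : rat) : k (ratr a).
Proof. by have := adjoin_horner a%:P; rewrite map_polyC hornerC. Qed.

Lemma adjoin_pow m (a : rat) : k (z ^+ m * ratr a).
Proof.
have := adjoin_horner (a *: 'X^m).
by rewrite linearZ /= map_polyXn hornerZ hornerXn mulrC.
Qed.

Lemma adjoinD x y : k x -> k y -> k (x + y).
Proof.
move=> [p1 [q1 [q1z ->]]] [p2 [q2 [q2z ->]]].
exists (p1 * q2 + p2 * q1), (q1 * q2).
by rewrite !rmorphD !rmorphM /= !hornerE mulf_neq0 // addf_div.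
Qed.

Lemma adjoinM x y : k x -> k y -> k (x * y).
Proof.
move=> [p1 [q1 [q1z ->]]] [p2 [q2 [q2z ->]]]; exists (p1 * p2), (q1 * q2).
by rewrite !rmorphM /= !hornerM mulf_neq0 //; split=> //; rewrite mulf_div.
Qed.

Lemma bring_canonical : isomorphic k (locus bring) (locus canonical_model).
Proof.
have k1 : k 1 by have := adjoin_ratr 1; rewrite rmorph1.
have k0 : k 0 by have := adjoin_ratr 0; rewrite rmorph0.
apply: (@linear_isomorphic k k1 k0 adjoinD adjoinM _ _ _ _ fourier inverse_fourier).
- apply: table_in => // r x /mapP[i _ ->] /mapP[j _ ->].
  by have := adjoin_pow (i * j) 1; rewrite rmorph1 mulr1.
- apply: table_in => // r x /mapP[i _ ->] /mapP[j _ ->].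
  by have := adjoin_pow (4 * j * i) 5%:R^-1; rewrite fmorphV rmorph_nat.
- by move=> v [].
- by move=> v [].
- move=> v Bv; apply/bring_inverse_fourier; rewrite fourierK //.
  by have /bringP[] := Bv.
- by move=> w /bring_inverse_fourier.
- by move=> v /bringP[_ e _ _]; apply: fourierK.
- by move=> w _; apply: inverse_fourierK.
Qed.

End Cyclotomic.

Theorem theorem1p1 (zeta5 : algC) (hzeta5 : 5.-primitive_root zeta5) :
  (exists (n : nat) (XHC : seq {mpoly algC[n.+1]})
          (pi : 'rV[algC]_n.+1 -> 'rV[algC]_3),
     desingularization rationals XHC hulek_craig_plane pi) /\
  (forall (n : nat) (XHC : seq {mpoly algC[n.+1]})
          (pi : 'rV[algC]_n.+1 -> 'rV[algC]_3),
     desingularization rationals XHC hulek_craig_plane pi ->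
     isomorphic (rationals_adjoin zeta5) (locus bring) (locus XHC) /\
     isomorphic rationals (locus XHC) (locus modular_model)).
Proof.
split; first by exists 3%N, canonical_model, desingularization_map; apply: canonical_desingularization.
move=> n X pi /canonical_isomorphic canX; split.
  have k1 : rationals_adjoin zeta5 1 by have := adjoin_ratr zeta5 1; rewrite rmorph1.
  have k0 : rationals_adjoin zeta5 0 by have := adjoin_ratr zeta5 0; rewrite rmorph0.
  apply: (isomorphic_trans k1 k0 (@adjoinD _) (@adjoinM _) (bring_canonical hzeta5)).
  by apply: isomorphic_weaken canX => _ /CratP[a ->]; apply: adjoin_ratr.
apply: isomorphic_trans (isomorphic_sym canX) canonical_modular.
- exact: rpred1.
- exact: rpred0.
- by move=> x y; apply: rpredD.
- by move=> x y; apply: rpredM.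
Qed.
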